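(* The polar space $\mathcal{S}$ admits a tight embedding if and only if $\mathcal{S}$ admits a $\perp$-minimal pair of opposite sub-generators $N$ and $N'$ such that $|\{N,N'\}^\perp| > 1$ and $\langle N, N'\rangle$ is optimally embeddable.
   Context: $\mathcal{S}$ is a non-degenerate thick-lined polar space of rank at least $2$ (the rank $\mathrm{rk}(\mathcal{S})$ may be infinite), and $\mathcal{S}$ is assumed to be embeddable; all embeddings are full projective embeddings $\varepsilon:\mathcal{S}\rightarrow\mathrm{PG}(V)$. Collinearity is denoted by $\perp$ (every point collinear with itself), $X^\perp$ is the set of points collinear with all points of $X$, $\{X,Y\}^\perp := (X\cup Y)^\perp$, and $\langle\cdot\rangle$ denotes generation in $\mathcal{S}$ (or span in $\mathrm{PG}(V)$ for subsets of $\mathrm{PG}(V)$). Two singular subspaces $X,Y$ are opposite if $X^\perp\cap Y = Y^\perp\cap X=\emptyset$. A generator is a maximal singular subspace; a sub-generator is a singular subspace of codimension $1$ in some (hence every) generator containing it. An embedding $\varepsilon:\mathcal{S}\rightarrow\mathrm{PG}(V)$ is tight if $\langle\varepsilon(M\cup M')\rangle = \mathrm{PG}(V)$ for at least one pair of generators $M, M'$. For an embedding $\varepsilon$, $\perp_\varepsilon$ denotes orthogonality with respect to the unique quasi-polarity $\pi_\varepsilon$ of $\mathrm{PG}(V)$ for which all points of $\varepsilon(\mathcal{S})$ are absolute and $x\perp y \iff \varepsilon(x)\perp_\varepsilon\varepsilon(y)$. A subspace $X$ of $\mathcal{S}$ is optimally embeddable if $\langle \varepsilon(X), \varepsilon(X)^{\perp_\varepsilon}\rangle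 = \varepsilon(X\cap X^\perp)^{\perp_\varepsilon}$ for some (equivalently, every) embedding $\varepsilon$ of $\mathcal{S}$. A pair $\{N,N'\}$ of sub-generators is $\perp$-minimal if either $\{N,N'\}^\perp$ is a singular subspace or $\{N,N'\}^\perp = \langle N\cap N', \{a,b\}^{\perp\perp}\rangle$ for every (equivalently, at least one) choice of opposite (non-collinear) points $a,b\in\{N,N'\}^\perp$. *)

(* Defs.v *)
From mathcomp Require Import all_boot all_order all_algebra.
From mathcomp Require Import boolp classical_sets functions cardinality.

Set Implicit Arguments.
Unset Strict Implicit.
Unset Printing Implicit Defensive.

Import GRing.Theory.
Local Open Scope ring_scope.
Local Open Scope classical_set_scope.
Local Open Scope card_scope.

Record geometry := Geometry {
  pt :> Type;
  line : set (set pt) }.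

Definition orth (T : Type) (R : T -> T -> Prop) (X : set T) : set T :=
  [set y | forall x, X x -> R x y].

Section Geometry.
Variable G : geometry.
Implicit Types (X Y H M N : set G) (l : set G) (a b p q : G).

Definition collinear p q := p = q \/ exists2 l, line l & l p /\ l q.

Definition perp X : set G := orth collinear X.

Definition subspace X :=
  forall l, line l -> forall p q, p <> q -> l p -> l q -> X p -> X q -> l `<=` X.

Definition gen X : set G := smallest subspace X.

Definition singular X := subspace X /\ X `<=` perp X.

(* Codimension 1: [M] is spanned by [H] and one further point. *)
Definition hyperplane_of H M :=
  subspace H /\ exists2 p, (M `\` H) p & M = gen (p |` H).

Definition generator M :=
  singular M /\ forall M', singular M' -> M `<=` M' -> M' = M.

Definition sub_generator N :=
  singular N /\ exists2 M, generator M & hyperplane_of N M.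

Definition opposite X Y := perp X `&` Y = set0 /\ perp Y `&` X = set0.

(* The rank is the length of a longest chain of singular subspaces; chains may
   start with the empty subspace, so points have rank 1 and lines rank 2. *)
Definition rank_ge (n : nat) :=
  exists X : nat -> set G,
    (forall i, (i <= n)%N -> singular (X i)) /\
    (forall i, (i < n)%N -> X i `<` X i.+1).

(* The Buekenhout-Shult axioms. *)
Definition polar_space :=
  (forall l, line l -> `I_2 #<= l) /\
  (forall p l, line l ->
     (exists! q, l q /\ collinear p q) \/ (forall q, l q -> collinear p q)).

Definition non_degenerate := perp setT = set0.

Definition thick_lined := forall l, line l -> `I_3 #<= l.

Definition perp_minimal N N' :=
  singular (perp (N `|` N')) \/
  (forall a b, perp (N `|` N') a -> perp (N `|` N') b -> ~ collinear a b ->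
     perp (N `|` N') = gen ((N `&` N') `|` perp (perp [set a; b]))).

(* A map [pi] from points to hyperplanes is encoded as the relation
   [pi p q <-> q \in pi p]; [pi p] may also be the whole space. *)
Definition quasi_polarity (pi : G -> set G) :=
  (forall p, hyperplane_of (pi p) setT \/ pi p = setT) /\
  (forall p q, pi p q <-> pi q p).

End Geometry.

Section ProjectiveGeometry.
Variables (K : unitRingType) (V : lmodType K).

Record pgpoint := PGPoint {
  pgset :> set V;
  pgsetP : exists2 v : V, v != 0 & pgset = range (fun k : K => k *: v) }.

Definition pgjoin (x y : pgpoint) : set pgpoint :=
  [set z : pgpoint | pgset z `<=` [set u + v | u in pgset x & v in pgset y]].

Definition PG : geometry :=
  @Geometry pgpoint [set l | exists x y, x <> y /\ l = pgjoin x y].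

End ProjectiveGeometry.

(* Full projective embeddings. [GRing.field_axiom] says that nonzero elements
   are units; as [unitRingType] is not commutative, the scalars form an
   arbitrary division ring. *)
Record embedding (S : geometry) := Embedding {
  emb_ring : unitRingType;
  emb_ringP : GRing.field_axiom emb_ring;
  emb_space : lmodType emb_ring;
  emb_map :> S -> PG emb_space;
  emb_inj : injective emb_map;
  emb_full : forall l : set S, line l -> line (emb_map @` l);
  emb_span : gen (range emb_map) = setT }.

Section Embeddings.
Variable S : geometry.

Definition embeddable := inhabited (embedding S).

Definition tight (e : embedding S) :=
  exists M M' : set S,
    [/\ generator M, generator M' & gen (e @` (M `|` M')) = setT].

Definition admits_tight_embedding := exists e : embedding S, tight e.

(* For an embedded non-degenerate polar space of rank at least 2 there is
   exactly one such [pi]. *)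
Definition quasi_polarity_of (e : embedding S)
    (pi : PG (emb_space e) -> set (PG (emb_space e))) :=
  [/\ quasi_polarity pi,
      forall x : S, pi (e x) (e x) &
      forall x y : S, collinear x y <-> pi (e x) (e y)].

Definition optimally_embeddable (X : set S) :=
  exists (e : embedding S) (pi : PG (emb_space e) -> set (PG (emb_space e))),
    quasi_polarity_of pi /\
    gen (e @` X `|` orth pi (e @` X)) = orth pi (e @` (X `&` perp X)).

End Embeddings.

(* Main.v *)
(** Work with vectors: let [Q] be the set of vectors representing points of
    the embedded polar space and [P] collinearity. If x is collinear with two
    points of a line of PG(V), then it is collinear with every point of the polar
    space on that line.

    A tight embedding splits V as U + U' with U, U' the spans of two disjoint
    generators. Fix non-collinear points u0 of U and u1 of U', and let H, H1 be
    the hyperplanes u1^perp of U and u0^perp of U'. Collinearity between U and U'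
    is described by a coefficient [b y z] in K, linear in z. If the line u0u1
    of PG(V) contains a third point of the polar space, scale u0 so that u0 + u1
    represents it: comparing the lines through that point shows that b is additive
    in y and that k |-> b (k y) x, for b y x = 1, is an additive map s with
    s (m (k s(k))) = k s(k) s(m), and any such s is an involutive
    antiautomorphism. If no such line has a third point, b is
    bilinear and K is commutative. In both cases b extends to a reflexive
    sesquilinear form on V, which gives the quasi-polarity; the required
    sub-generators are H and H1, with {H, H1}^perp the points of the line u0u1.

    Conversely, given N, N' and non-collinear a, b in {N, N'}^perp,
    optimality gives V = <N, N', a, b> + D with D the subspace orthogonal to N,
    N', a and b. For a point n + n' + k a + l b + d, successive projections from
    <N, a> and <N', b> give a point k' a + l' b + d of {N, N'}^perp, which lies in
    {a, b}^perp^perp by minimality; hence d is orthogonal to a, b and {a, b}^perp,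
    which generate, and d is in the radical of the quasi-polarity. The quotient
    by the radical is a tight embedding with generators <N, a> and <N', b>. *)
From HB Require Import structures.
Require Import Defs.
From mathcomp Require Import all_boot all_order all_algebra.
From mathcomp Require Import boolp classical_sets functions cardinality.

Set Implicit Arguments.
Unset Strict Implicit.
Unset Printing Implicit Defensive.

Import GRing.Theory.
Local Open Scope ring_scope.
Local Open Scope classical_set_scope.
Local Open Scope card_scope.

(** * A decision procedure for equalities in abelian groups *)

(** [optimally_embeddable] asks for an explicit quasi-polarity, and a tight embedding comes with
    none, so in the forward direction the form has to be made from collinearity alone. Relations are
    obtained by adding or subtracting representatives of collinear points, which stays inside the
    polar space. Within the span of u0 and H this gives linearity of the coefficient in z, but
    additivity in y compares hyperplanes attached to different points u1 + y and leaves every single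
    singular subspace; a third point u0 + u1 supplies the extra points needed, and the absence of
    all third points forces symmetry instead. With a third point, the geometry controls s only on
    norms [k * s k]. Linearizing makes s involutive and compatible with inverses; Hua's identity
    then gives [s (a * b * a) = s a * s b * s a], and the defect [s (m * k) - s k * s m] is shown to
    vanish. In the converse direction the given embedding may have a nonzero radical that contains
    no point of the polar space, which is why the tight embedding is found in a quotient. *)

Inductive zexpr := ZVar of nat | ZZero | ZAdd of zexpr & zexpr | ZOpp of zexpr.

Fixpoint zeval (V : zmodType) (env : seq V) e : V :=
  match e with
  | ZVar i => env`_i
  | ZZero => 0
  | ZAdd a b => zeval env a + zeval env b
  | ZOpp a => - zeval env a
  end.

Fixpoint zcoef e (i : nat) : int :=
  match e with
  | ZVar j => if i == j then 1 else 0
  | ZZero => 0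
  | ZAdd a b => zcoef a i + zcoef b i
  | ZOpp a => - zcoef a i
  end.

Lemma zeval_coef (V : zmodType) (env : seq V) e :
  zeval env e = \sum_(i < size env) env`_i *~ zcoef e i.
Proof.
elim: e => [j||a IHa b IHb|a IHa] /=.
- case: (ltnP j (size env)) => jn.
    rewrite (bigD1 (Ordinal jn)) //= eqxx mulr1z big1 ?addr0 // => i ij.
    by rewrite ifN ?mulr0z //; apply: contraNN ij => /eqP ij; apply/eqP/val_inj.
  rewrite nth_default // big1 // => i _; rewrite ifN ?mulr0z //.
  by rewrite neq_ltn (leq_trans (ltn_ord i) jn).
- by rewrite big1 // => i _; rewrite mulr0z.
- by rewrite IHa IHb -big_split; apply: eq_bigr => i _; rewrite mulrzDr.
- by rewrite IHa -sumrN; apply: eq_bigr => i _; rewrite mulrNz.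
Qed.

(** Reflection: comparing integer coefficients is a computation, so [vm_compute] can discharge the
    hypothesis. *)
Lemma zeval_eq (V : zmodType) (env : seq V) a b :
  all (fun i => zcoef a i == zcoef b i) (iota 0 (size env)) ->
  zeval env a = zeval env b.
Proof.
move=> /allP ab; rewrite !zeval_coef; apply: eq_bigr => i _; congr (_ *~ _).
by apply/eqP/ab; rewrite mem_iota add0n leq0n ltn_ord.
Qed.

(* Atoms are compared up to conversion because the same operation may occur
   with different inheritance paths for its structure. *)
Ltac zlookup x l :=
  match l with
  | ?y :: _ => let _ := match goal with _ => unify x y end in constr:(0%N)
  | _ :: ?r => let n := zlookup x r in constr:(n.+1)
  end.
Ltac zinsert x l :=
  match l with
  | _ => let _ := zlookup x l in l
  | _ => constr:(x :: l)
  end.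
Ltac zatoms t l :=
  lazymatch t with
  | GRing.add ?a ?b => let l := zatoms a l in zatoms b l
  | GRing.opp ?a => zatoms a l
  | GRing.zero => l
  | ?a => zinsert a l
  end.
Ltac zreify t l :=
  lazymatch t with
  | GRing.add ?a ?b =>
      let a := zreify a l in let b := zreify b l in constr:(ZAdd a b)
  | GRing.opp ?a => let a := zreify a l in constr:(ZOpp a)
  | GRing.zero => constr:(ZZero)
  | ?a => let n := zlookup a l in constr:(ZVar n)
  end.
Ltac abelian :=
  lazymatch goal with
  | |- @eq ?T ?a ?b =>
      let l := zatoms a (@nil T) in
      let l := zatoms b l in
      let ea := zreify a l in
      let eb := zreify b l in
      change (zeval l ea = zeval l eb); apply: zeval_eq; vm_compute; reflexivity
  end.

(** Lets [abelian] use one hypothesis c = d: the remaining goal is a pure identity. *)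
Lemma eq_of_sub_eq (V : zmodType) (a b c d : V) : c = d -> a - b = c - d -> a = b.
Proof. by move=> ->; rewrite subrr => /eqP; rewrite subr_eq0 => /eqP. Qed.

(** After expansion the left-associated monomials serve as atoms, so noncommutativity does no
    harm. *)
Ltac abelian_ring :=
  rewrite ?(mulrDl, mulrDr, mulrN, mulNr, mulrA, mulr1, mul1r, mulr0, mul0r);
  abelian.

(** * Division rings *)

Section DivisionRing.
Variable K : unitRingType.
Hypothesis KF : GRing.field_axiom K.
Implicit Types x y k m : K.

Lemma div_unit x : x <> 0 -> x \is a GRing.unit.
Proof. by move=> /eqP /KF. Qed.

Lemma div_mul0 x y : x * y = 0 -> x = 0 \/ y = 0.
Proof.
case: (pselect (x = 0)) => [|/div_unit xU]; [by left | move=> xy; right].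
by apply: (mulrI xU); rewrite mulr0.
Qed.

Lemma div_inv_neq0 x : x <> 0 -> x^-1 <> 0.
Proof. by move=> x0 xV; apply: x0; rewrite -(invrK x) xV invr0. Qed.

Lemma div_scaleVK (V : lmodType K) x (v : V) : x <> 0 -> x *: (x^-1 *: v) = v.
Proof. by move=> /div_unit xU; rewrite scalerA mulrV // scale1r. Qed.

(** * Additive maps of a division ring that reverse products with norms *)

Section NormedAntiautomorphism.
Variable s : K -> K.
Hypothesis sD : forall x y, s (x + y) = s x + s y.
Hypothesis s1 : s 1 = 1.
Hypothesis s_norm : forall m k, s (m * (k * s k)) = k * s k * s m.

Let s0 : s 0 = 0.
Proof. by apply: (addrI (s 0)); rewrite -sD !addr0. Qed.

Let sN x : s (- x) = - s x.
Proof. by apply: (addrI (s x)); rewrite -sD !subrr. Qed.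

(** Linearization of [s_norm] in k: expand at k + l and cancel the pure terms. *)
Let s_polar m k l : s (m * (k * s l + l * s k)) = (k * s l + l * s k) * s m.
Proof.
have := s_norm m (k + l); have := s_norm m k; have := s_norm m l.
rewrite !sD !(mulrDl, mulrDr) !sD => -> -> H.
by apply: (eq_of_sub_eq H); abelian.
Qed.

Let s_trace m k : s (m * (k + s k)) = (k + s k) * s m.
Proof. by have := s_polar m k 1; rewrite s1 mulr1 mul1r. Qed.

Lemma normed_involutive k : s (s k) = k.
Proof.
have := s_trace 1 k; rewrite s1 mul1r mulr1 sD => H.
by apply: (addrI (s k)); rewrite H addrC.
Qed.

Let s_eq0 k : s k = 0 -> k = 0.
Proof. by move=> sk; rewrite -(normed_involutive k) sk s0. Qed.

(** With involutivity, [s_norm] at m = k^-1 reads k = k * s k * s k^-1. *)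
Let sV k : s k^-1 = (s k)^-1.
Proof.
case: (pselect (k = 0)) => [->|k0]; first by rewrite !(invr0, s0).
have kU := div_unit k0; have := s_norm k^-1 k.
rewrite mulrA mulVr // mul1r normed_involutive -mulrA -{1}(mulr1 k).
by move=> /(mulrI kU) H; rewrite -[RHS]mulr1 H mulKr //; apply/div_unit => /s_eq0.
Qed.

(** Hua's identity: it expresses a b a through sums and inverses, both of which s respects; applying
    s to it yields [s_triple]. *)
Let hua (a b : K) : a <> 0 -> b <> 0 -> b^-1 - a <> 0 ->
  (a^-1 + (b^-1 - a)^-1)^-1 = a - a * b * a.
Proof.
move=> a0 b0 c0; have [aU bU] := (div_unit a0, div_unit b0).
have cU := div_unit c0; set c := b^-1 - a in c0 cU *.
have -> : a^-1 + c^-1 = a^-1 * b^-1 * c^-1.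
  have -> : b^-1 = c + a by rewrite subrK.
  by rewrite mulrDr mulVr // mulrDl mulrK // mul1r.
rewrite !invrM ?(unitrMr, unitrV) // !invrK.
by rewrite /c mulrBl mulKr // mulrA.
Qed.

Let s_triple (a b : K) : s (a * b * a) = s a * s b * s a.
Proof.
case: (pselect (a = 0)) => [->|a0]; first by rewrite !mulr0 s0 mulr0.
case: (pselect (b = 0)) => [->|b0]; first by rewrite !(mulr0, mul0r, s0).
have [aU bU] := (div_unit a0, div_unit b0).
(* Here Hua's identity would invert 0; but then a = b^-1 and a b a = b^-1, so [sV] suffices. *)
case: (pselect (b^-1 - a = 0)) => [ab|c0].
  have {ab} <- : b^-1 = a by apply/eqP; rewrite -subr_eq0 ab.
  by rewrite mulVr // mul1r sV mulVr ?mul1r //; apply/div_unit => /s_eq0.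
have sa0 : s a <> 0 by move=> /s_eq0.
have sb0 : s b <> 0 by move=> /s_eq0.
have sc0 : (s b)^-1 - s a <> 0 by rewrite -sV -sN -sD => /s_eq0.
have: s (a - a * b * a) = s a - s a * s b * s a.
  by rewrite -!hua // sV sD !sV sD sV sN.
by rewrite sD sN => /addrI/oppr_inj.
Qed.

Section Defect.
(* The defect of anti-multiplicativity. *)
Variable d : K -> K -> K.
Hypothesis d_def : forall m k, d m k = s (m * k) - s k * s m.

Let dDr m k l : d m (k + l) = d m k + d m l.
Proof. by rewrite !d_def mulrDr !sD mulrDl; abelian. Qed.
Let d1r m : d m 1 = 0. Proof. by rewrite d_def s1 mulr1 mul1r subrr. Qed.

Let dE m k : s (m * k) = d m k + s k * s m.
Proof. by rewrite d_def subrK. Qed.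

(** By [s_trace] the defect of m against k + s k is zero. *)
Let d_sr m k : d m (s k) = - d m k.
Proof.
apply/eqP; rewrite -addr_eq0 addrC -dDr; apply/eqP.
by rewrite d_def s_trace sD normed_involutive; abelian_ring.
Qed.

Let d_anti k l : d l k = - d k l.
Proof.
have : d k (s l) + d l (s k) = 0.
  rewrite !d_def !normed_involutive.
  have := s_polar 1 k l; rewrite mul1r s1 mulr1 sD => H.
  by apply: (eq_of_sub_eq H); abelian.
by rewrite !d_sr => /eqP; rewrite addr_eq0 opprK => /eqP ->.
Qed.

Let d_sl m k : d (s m) k = - d m k.
Proof. by rewrite d_anti d_sr opprK [LHS]d_anti. Qed.

Let d_fixed m k : s (d m k) = d m k.
Proof.
rewrite {1}d_def sD sN normed_involutive dE !normed_involutive d_sr d_sl [d k m]d_anti.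
by abelian.
Qed.

(** [s_norm] in terms of the defect; [d_mull] is the same translation of [s_triple]. *)
Let d_mulr k x : d k (x * k) = k * d k x.
Proof.
rewrite d_anti [d k x]d_anti mulrN; congr (- _).
have := s_norm x k; rewrite mulrA dE d_sr dE normed_involutive => H.
by apply: (eq_of_sub_eq (esym H)); abelian_ring.
Qed.

Let d_mull k x : d k (k * x) = s k * d k x.
Proof.
have := s_triple k x; rewrite dE dE mulrDr => H.
rewrite [LHS]d_anti.
by apply: (eq_of_sub_eq (esym H)); abelian_ring.
Qed.

(** Two evaluations of [d k (s (k * x))]: by [d_sr], and by expanding [s (k * x)] into its defect
    and its antimultiplicative part. *)
Let d_comm k x : k * d k x = d k x * s k.
Proof.
have kd : d k (d k x) = k * d k x - d k x * s k.
  by rewrite {1}d_def -d_mulr d_fixed d_mulr d_fixed.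
have := d_sr k (k * x); rewrite dE dDr d_mull kd => H.
have : d k (s x * s k) = - (s k * d k x).
  rewrite -[LHS]opprK -d_sl d_mulr d_sl d_sr; abelian_ring.
by move=> H2; rewrite H2 in H; apply: (eq_of_sub_eq H); abelian.
Qed.

(** Suppose D = d k m is nonzero, hence invertible. By [mD] every m1 with this same defect satisfies
    m1 D = k m1^2 - m1^2 k. The steps below force s m = m, so that [d_sr] gives 2 D = 0; as D is
    also twice a commutator, it vanishes. *)
Lemma defect_eq0 k m : d k m = 0.
Proof.
apply: contrapT => D0; have DU := div_unit D0.
have mD m1 : d k m1 = d k m -> m1 * d k m = k * (m1 * m1) - m1 * m1 * k.
  move=> Em; have m1D : m1 * d k m = d k m * s m1.
    by have := d_comm m1 k; rewrite d_anti Em mulrN mulNr => /oppr_inj.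
  have : d (k * m1) m1 = m1 * d k m.
    by rewrite d_anti d_mulr d_anti Em mulrN opprK.
  move=> E; have := d_comm (k * m1) m1; rewrite E dE Em.
  have kD : k * d k m = d k m * s k by apply: d_comm.
  have Em2 : m1 * d k m * (s m1 * s k) = m1 * m1 * k * d k m.
    by rewrite mulrA -(mulrA m1) -m1D mulrA -mulrA -kD mulrA.
  rewrite mulrDr Em2 => H.
  have : (k * m1 * m1 - m1 * m1 * k - m1 * d k m) * d k m = 0.
    by apply: (eq_of_sub_eq H); abelian_ring.
  by case/div_mul0 => // H2; apply: (eq_of_sub_eq (esym H2)); abelian_ring.
(* m + 1 has the same defect as m; subtracting the two instances of [mD] gives D = 2 (k m - m k). *)
have Em1 : d k (m + 1) = d k m by rewrite dDr d1r addr0.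
have D2 : d k m = (k * m - m * k) + (k * m - m * k).
  by apply: (eq_of_sub_eq (mD _ Em1)); rewrite [(m + 1) * d k m]mulrDl (mD m erefl); abelian_ring.
(* Substituting that value of D back into [mD] shows that m commutes with the commutator, hence with
   D; comparison with m D = D (s m) then gives s m = m. *)
have mk : m * (k * m - m * k) = (k * m - m * k) * m.
  have := mD _ erefl; rewrite {1}D2 => H.
  by apply: (eq_of_sub_eq H); abelian_ring.
have mDD : m * d k m = d k m * m by rewrite D2 [RHS]mulrDl [LHS]mulrDr mk.
have sm : s m = m.
  apply: (mulrI DU); rewrite -mDD.
  by have := d_comm m k; rewrite d_anti mulrN mulNr => /oppr_inj.
have DD : (1 + 1) * d k m = 0.
  by rewrite mulrDl mul1r -{2}sm d_sr subrr.
case/div_mul0: DD => // two0; apply: D0.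
by rewrite D2 -[_ - _]mul1r -mulrDl two0 mul0r.
Qed.

End Defect.

Lemma normed_antimorphism m k : s (m * k) = s k * s m.
Proof.
by apply/eqP; rewrite -subr_eq0; apply/eqP/(@defect_eq0 (fun m k => s (m * k) - s k * s m)).
Qed.

End NormedAntiautomorphism.
End DivisionRing.

(** * Embedded polar spaces in terms of vectors *)

(* [Q] holds of the vectors representing points of an embedded polar space (and
   of 0) and [P] is collinearity of the points they represent. *)
Record polar_set (K : unitRingType) (V : lmodType K) (Q : set V)
    (P : V -> V -> Prop) : Prop := PolarSet {
  ps_scale : forall k v, Q v -> Q (k *: v);
  ps_perp0 : forall v, P v 0;
  ps_sym : forall v w, P v w -> P w v;
  ps_perpZ : forall k v w, P v w -> P v (k *: w);
  ps_refl : forall v, Q v -> P v v;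
  ps_add : forall v w, Q v -> Q w -> P v w -> Q (v + w);
  ps_line : forall x v w, Q x -> Q v -> Q w -> P v w -> P x v -> P x w ->
    P x (v + w);
  ps_meet : forall x v w, Q x -> Q v -> Q w -> P v w -> ~ P x v ->
    exists k, P x (w + k *: v);
  ps_nondeg : forall x, Q x -> (forall y, Q y -> P x y) -> x = 0 }.

Section PolarSet.
Variables (K : unitRingType) (V : lmodType K) (Q : set V) (P : V -> V -> Prop).
Hypothesis KF : GRing.field_axiom K.
Hypothesis PS : polar_set Q P.
Implicit Types (v w x y z : V) (k l m c : K).

Lemma ps_opp v : Q v -> Q (- v).
Proof. by move=> /(ps_scale PS (-1)); rewrite scaleN1r. Qed.

Lemma ps_perpN x v : P x v -> P x (- v).
Proof. by move=> /(ps_perpZ PS (-1)); rewrite scaleN1r. Qed.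

Lemma ps_perpZ_inv k x v : k <> 0 -> P x (k *: v) -> P x v.
Proof.
move=> /(div_unit KF) kU /(ps_perpZ PS k^-1).
by rewrite scalerA mulVr // scale1r.
Qed.

(* The two points on the lines xv and xw collinear with v + w would span,
   together with x, a plane of pairwise collinear points. *)
Lemma ps_perpD x v w : Q x -> Q v -> Q w -> Q (v + w) ->
  P x v -> P x w -> P x (v + w).
Proof.
move=> Qx Qv Qw Qvw xv xw; apply: contrapT => xvw.
have wx : ~ P (v + w) x by move=> /(ps_sym PS).
have [k q1] := ps_meet PS Qvw Qx Qv xv wx.
have [l q2] := ps_meet PS Qvw Qx Qw xw wx.
have Qkx m := ps_scale PS m Qx.
have Pkx m u : P x u -> P u (m *: x) by move=> /(ps_sym PS); apply: (ps_perpZ PS).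
have Qq1 : Q (v + k *: x) by apply: (ps_add PS) => //; apply: Pkx.
have Qq2' : Q (w - k *: x).
  rewrite -scaleNr; apply: (ps_add PS) => //; exact: Pkx.
have q12 : P (v + w) (w - k *: x).
  have -> : w - k *: x = (v + w) + - (v + k *: x) by abelian.
  apply: (ps_line PS) => //; first exact: ps_opp.
  - exact: ps_perpN.
  - exact: (ps_refl PS).
  - exact: ps_perpN.
have Qq2 : Q (w + l *: x) by apply: (ps_add PS) => //; apply: Pkx.
have xx := ps_refl PS Qx.
have xq2 : P x (w - k *: x).
  rewrite -scaleNr; by apply: (ps_line PS) => //; [apply: Pkx|apply: (ps_perpZ PS)].
have xq2l : P x (w + l *: x).
  by apply: (ps_line PS) => //; [apply: Pkx|apply: (ps_perpZ PS)].
have q1q2 : P (v + k *: x) (w - k *: x).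
  have -> : v + k *: x = (v + w) + - (w - k *: x) by abelian.
  apply: (ps_sym PS); apply: (ps_line PS) => //; first exact: ps_opp.
  - exact: ps_perpN.
  - exact: (ps_sym PS).
  - exact/ps_perpN/(ps_refl PS).
have vq2 : P v (w - k *: x).
  have -> : v = (v + k *: x) + (- k) *: x by rewrite scaleNr; abelian.
  apply: (ps_sym PS); apply: (ps_line PS) => //.
  - apply: (ps_perpZ PS); apply: (ps_sym PS); apply: (ps_line PS) => //.
      exact: Pkx.
    exact: (ps_perpZ PS).
  - exact: (ps_sym PS).
  - exact: Pkx.
apply: xvw; apply: (ps_line PS) => //.
have -> : w = (w - k *: x) + k *: x by abelian.
by apply: (ps_line PS) => //; [apply: Pkx | apply: Pkx].
Qed.

Lemma ps_perpB x v w : Q x -> Q v -> Q w -> Q (v - w) ->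
  P x v -> P x w -> P x (v - w).
Proof.
by move=> Qx Qv /ps_opp Qw Qvw xv /ps_perpN; apply: ps_perpD.
Qed.

Lemma ps_sub v w : Q v -> Q w -> P v w -> Q (v - w).
Proof. by move=> Qv /ps_opp Qw /ps_perpN; apply: (ps_add PS). Qed.

Lemma ps_perp0l v : P 0 v.
Proof. exact/(ps_sym PS)/(ps_perp0 PS). Qed.

Lemma ps_perpZl k v w : P v w -> P (k *: v) w.
Proof. by move=> /(ps_sym PS)/(ps_perpZ PS k)/(ps_sym PS). Qed.

Lemma ps_perpDl x v w : Q x -> Q v -> Q w -> Q (v + w) ->
  P v x -> P w x -> P (v + w) x.
Proof.
by move=> Qx Qv Qw Qvw /(ps_sym PS) ? /(ps_sym PS) ?; apply/(ps_sym PS)/ps_perpD.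
Qed.

Lemma ps_perpBl x v w : Q x -> Q v -> Q w -> Q (v - w) ->
  P v x -> P w x -> P (v - w) x.
Proof.
by move=> Qx Qv Qw Qvw /(ps_sym PS) ? /(ps_sym PS) ?; apply/(ps_sym PS)/ps_perpB.
Qed.

End PolarSet.

(** * The sesquilinear form of a frame *)

Section Frame.
Variables (K : unitRingType) (V : lmodType K) (Q : set V) (P : V -> V -> Prop).
Hypothesis KF : GRing.field_axiom K.
Hypothesis PS : polar_set Q P.
Implicit Types (v w x y z : V) (k l m c : K) (H : set V).

(* The non-collinear points u0, u1 and the opposite singular subspaces H, H1 of
   {u0, u1}^perp; all the lemmas below are symmetric in H and H1. *)
Record frame_side u0 u1 H H1 : Prop := FrameSide {
  fr_add : forall v w, H v -> H w -> H (v + w);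
  fr_scale : forall k v, H v -> H (k *: v);
  fr_Q : forall v, H v -> Q v;
  fr_perp : forall v w, H v -> H w -> P v w;
  fr_perp0 : forall v, H v -> P u0 v;
  fr_perp1 : forall v, H v -> P u1 v;
  fr_nondeg : forall v, H v -> (forall w, H1 w -> P v w) -> v = 0 }.

Record frame_pair u0 u1 : Prop := FramePair {
  fr_Q0 : Q u0;
  fr_Q1 : Q u1;
  fr_opp : ~ P u0 u1 }.

(* [b y z *: u0 + z] is the point of the line u0z collinear with u1 + y. *)
Definition frame_coef u0 u1 y z : K :=
  xget 0 [set k | P (k *: u0 + z) (u1 + y)].

Section FrameLemmas.
Variables u0 u1 : V.
Hypothesis U : frame_pair u0 u1.
Local Notation side := (frame_side u0 u1).
Local Notation b := (frame_coef u0 u1).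

Lemma side_Q0 H H1 k z : side H H1 -> H z -> Q (k *: u0 + z).
Proof.
move=> F Hz; apply: (ps_add PS).
- exact/(ps_scale PS)/(fr_Q0 U).
- exact: (fr_Q F).
- exact/(ps_perpZl PS)/(fr_perp0 F).
Qed.

Lemma side_Q1 H H1 k y : side H H1 -> H y -> Q (k *: u1 + y).
Proof.
move=> F Hy; apply: (ps_add PS).
- exact/(ps_scale PS)/(fr_Q1 U).
- exact: (fr_Q F).
- exact/(ps_perpZl PS)/(fr_perp1 F).
Qed.

Lemma side_Q1' H H1 y : side H H1 -> H y -> Q (u1 + y).
Proof. by move=> F Hy; rewrite -[u1]scale1r; apply: (side_Q1 1 F). Qed.

Lemma side_perp0 H H1 k l y z : side H H1 -> H y -> H z ->
  P (k *: u0 + y) (l *: u0 + z).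
Proof.
move=> F Hy Hz; have Q0 := fr_Q0 U.
apply: (ps_perpDl PS); [exact: (side_Q0 _ F)|exact: (ps_scale PS)|
  exact: (fr_Q F)|exact: (side_Q0 _ F)|apply: (ps_perpZl PS)|].
- apply: (ps_perpD PS) => //; [exact: (ps_scale PS)|exact: (fr_Q F)|
    exact: (side_Q0 _ F)|exact/(ps_perpZ PS)/(ps_refl PS)|exact: (fr_perp0 F)].
- apply: (ps_perpD PS); [exact: (fr_Q F)|exact: (ps_scale PS)|
    exact: (fr_Q F)|exact: (side_Q0 _ F)| |exact: (fr_perp F)].
  by apply/(ps_perpZ PS)/(ps_sym PS)/(fr_perp0 F).
Qed.

Lemma side_opp H H1 y : side H H1 -> H y -> ~ P u0 (u1 + y).
Proof.
move=> F Hy Pu; apply: (fr_opp U); rewrite -[u1](addrK y).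
apply: (ps_perpB PS) => //.
- exact: (fr_Q0 U).
- exact: (side_Q1' F).
- exact: (fr_Q F).
- by rewrite addrK; apply: (fr_Q1 U).
- exact: (fr_perp0 F).
Qed.

Lemma side_zero H H1 y : side H H1 -> H y -> H 0.
Proof. by move=> F /(fr_scale F 0); rewrite scale0r. Qed.

Lemma side_oppr H H1 y : side H H1 -> H y -> H (- y).
Proof. by move=> F /(fr_scale F (-1)); rewrite scaleN1r. Qed.

Lemma multiple_opp k w : ~ P u0 w -> P (k *: u0) w -> k = 0.
Proof.
move=> uw Pk; apply: contrapT => k0; apply: uw.
by apply/(ps_sym PS)/(ps_perpZ_inv KF PS k0)/(ps_sym PS).
Qed.

(** One-or-all axiom on the line through u0 and z: u1 + y is not collinear with u0, so a solution
    exists and the default 0 of [frame_coef] is not reached. *)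
Lemma coef_perp H H1 y z : side H H1 -> side H1 H -> H1 y -> H z ->
  P (b y z *: u0 + z) (u1 + y).
Proof.
move=> F F1 Hy Hz; have Qy := side_Q1' F1 Hy.
have [k Pk] : exists k, P (u1 + y) (z + k *: u0).
  apply: (ps_meet PS) => //; [exact: (fr_Q0 U) | exact: (fr_Q F) | |].
    exact: (fr_perp0 F).
  by move=> /(ps_sym PS); apply: (side_opp F1 Hy).
apply: (@xgetPex _ 0 [set k | P (k *: u0 + z) (u1 + y)]).
by exists k => /=; rewrite addrC; apply: (ps_sym PS).
Qed.

Lemma coef_uniq H H1 y z k : side H H1 -> side H1 H -> H1 y -> H z ->
  P (k *: u0 + z) (u1 + y) -> b y z = k.
Proof.
move=> F F1 Hy Hz Pk; have Pb := coef_perp F F1 Hy Hz.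
apply/eqP; rewrite -subr_eq0; apply/eqP.
apply: (@multiple_opp _ (u1 + y)); first exact: (side_opp F1).
have -> : (b y z - k) *: u0 = (b y z *: u0 + z) - (k *: u0 + z).
  by rewrite scalerBl; abelian.
apply: (ps_perpBl PS) => //; [exact: (side_Q1' F1)|exact: (side_Q0 _ F)|
  exact: (side_Q0 _ F)|].
have -> : b y z *: u0 + z - (k *: u0 + z) = (b y z - k) *: u0.
  by rewrite scalerBl; abelian.
exact/(ps_scale PS)/(fr_Q0 U).
Qed.

Lemma coefZ H H1 y z k : side H H1 -> side H1 H -> H1 y -> H z ->
  b y (k *: z) = k * b y z.
Proof.
move=> F F1 Hy Hz; apply: (coef_uniq F F1) => //; first exact: (fr_scale F).
by rewrite -scalerA -scalerDr; apply/(ps_perpZl PS)/(coef_perp F F1).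
Qed.

Lemma coefDr H H1 y z z' : side H H1 -> side H1 H -> H1 y -> H z -> H z' ->
  b y (z + z') = b y z + b y z'.
Proof.
move=> F F1 Hy Hz Hz'; apply: (coef_uniq F F1) => //; first exact: (fr_add F).
rewrite scalerDl addrACA; apply: (ps_perpDl PS).
- exact: (side_Q1' F1).
- exact: (side_Q0 _ F).
- exact: (side_Q0 _ F).
- by rewrite addrACA -scalerDl; apply/(side_Q0 _ F)/(fr_add F).
- exact: (coef_perp F F1).
- exact: (coef_perp F F1).
Qed.

Lemma coefN H H1 y z : side H H1 -> side H1 H -> H1 y -> H z ->
  b y (- z) = - b y z.
Proof. by move=> *; rewrite -scaleN1r (@coefZ H H1) // mulN1r. Qed.

(** Together with [coef0_perp]: since u1 is collinear with z, the vanishing of [b y z] is exactly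
    collinearity of y and z. *)
Lemma coef_eq0 H H1 y z : side H H1 -> side H1 H -> H1 y -> H z ->
  P y z -> b y z = 0.
Proof.
move=> F F1 Hy Hz yz; apply: (coef_uniq F F1) => //; rewrite scale0r add0r.
apply/(ps_sym PS)/(ps_perpDl PS) => //.
- exact: (fr_Q F).
- exact: (fr_Q1 U).
- exact: (fr_Q F1).
- exact: (side_Q1' F1).
- exact: (fr_perp1 F).
Qed.

Lemma coef0_perp H H1 y z : side H H1 -> side H1 H -> H1 y -> H z ->
  b y z = 0 -> P y z.
Proof.
move=> F F1 Hy Hz b0; have := coef_perp F F1 Hy Hz; rewrite b0 scale0r add0r.
move=> Pz; rewrite -[y](addKr u1) addrC; apply: (ps_perpBl PS).
- exact: (fr_Q F).
- exact: (side_Q1' F1).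
- exact: (fr_Q1 U).
- by rewrite addrAC subrr add0r; apply: (fr_Q F1).
- exact: (ps_sym PS).
- exact: (fr_perp1 F).
Qed.

Lemma coef0l H H1 z : side H H1 -> side H1 H -> H1 0 -> H z -> b 0 z = 0.
Proof. by move=> F F1 H0 Hz; apply: (coef_eq0 F F1) => //; apply: (ps_perp0l PS). Qed.

Lemma coefD_perp H H1 y y' z : side H H1 -> side H1 H -> H1 y -> H1 y' ->
  H z -> P y' z -> b (y + y') z = b y z.
Proof.
move=> F F1 Hy Hy' Hz yz; apply: (coef_uniq F F1) => //.
  exact: (fr_add F1).
rewrite addrA; apply: (ps_perpD PS).
- exact: (side_Q0 _ F).
- exact: (side_Q1' F1).
- exact: (fr_Q F1).
- by rewrite -addrA; apply/(side_Q1' F1)/(fr_add F1).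
- exact: (coef_perp F F1).
- apply: (ps_perpDl PS).
  + exact: (fr_Q F1).
  + exact/(ps_scale PS)/(fr_Q0 U).
  + exact: (fr_Q F).
  + exact: (side_Q0 _ F).
  + exact/(ps_perpZl PS)/(fr_perp0 F1).
  + exact: (ps_sym PS).
Qed.

(** One-or-all axiom on the line through u1 and y. It reaches every value by scaling the first
    argument, in which no linearity is known yet. *)
Lemma coef_solve H H1 y z c : side H H1 -> side H1 H -> H1 y -> H z ->
  ~ P y z -> exists l, b (l *: y) z = c.
Proof.
move=> F F1 Hy Hz yz; have Qx := side_Q0 c F Hz.
have Pyx : ~ P (c *: u0 + z) y.
  move=> Px; apply: yz; apply: (ps_sym PS).
  rewrite -[z](addKr (c *: u0)) addrC; apply: (ps_perpBl PS) => //.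
  - exact: (fr_Q F1).
  - exact/(ps_scale PS)/(fr_Q0 U).
  - by rewrite addrAC subrr add0r; apply: (fr_Q F).
  - exact/(ps_perpZl PS)/(fr_perp0 F1).
have Pyu : P y u1 by apply/(ps_sym PS)/(fr_perp1 F1).
have [l Pl] := ps_meet PS Qx (fr_Q F1 Hy) (fr_Q1 U) Pyu Pyx.
by exists l; apply: (coef_uniq F F1) => //; apply: (fr_scale F1).
Qed.

End FrameLemmas.

Lemma frame_pair_sym u0 u1 : frame_pair u0 u1 -> frame_pair u1 u0.
Proof.
by move=> U; split; [exact: (fr_Q1 U)|exact: (fr_Q0 U)|move=> /(ps_sym PS)/(fr_opp U)].
Qed.

Lemma frame_side_sym u0 u1 H H1 : frame_side u0 u1 H H1 -> frame_side u1 u0 H H1.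
Proof. by case. Qed.

(** * Consequences of a third point u0 + u1 on the line u0u1 *)

Section ThirdPoint.
Variables u0 u1 : V.
Hypothesis U : frame_pair u0 u1.
Hypothesis Q01 : Q (u0 + u1).
Local Notation side := (frame_side u0 u1).
Local Notation b := (frame_coef u0 u1).

(** The displayed vector t is read in two ways. As u0 + u1 + (y + h') plus the collinear vector k u0
    + h, it is a point, collinear with the first summand. Regrouped as u1 + h, plus e u0 + (y + h'),
    plus a multiple of u0, it is collinear with u0 + h' because [b h h' = 1]. The difference of u0 +
    u1 + (y + h') and u0 + h' is u1 + y. *)
Let third_perp H H1 h h' y : side H H1 -> side H1 H -> H h -> H1 h' -> H1 y ->
  b h h' = 1 ->
  Q (u1 + (y + h') + ((1 + b (y + h') h) *: u0 + h)) /\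
  P (u1 + (y + h') + ((1 + b (y + h') h) *: u0 + h)) (u1 + y).
Proof.
move=> F F1 Hh Hh' Hy bhh; have Hyh := fr_add F1 Hy Hh'.
set k := b (y + h') h; set t := _ + (_ *: u0 + h).
have [Q0 Q1] := (fr_Q0 U, fr_Q1 U).
have QA := side_Q1' U F1 Hyh.
have QB := side_Q0 U k F Hh.
have BA : P (k *: u0 + h) (u1 + (y + h')) by apply: (coef_perp U F F1).
pose t1 := u0 + u1 + (y + h').
have Qt1 : Q t1.
  apply: (ps_add PS) => //; first exact: (fr_Q F1).
  by apply: (ps_perpDl PS) => //; [exact: (fr_Q F1)|exact: (fr_perp0 F1)|exact: (fr_perp1 F1)].
have t1E : t1 = u1 + (y + h') + u0 by rewrite /t1; abelian.
have Bt1 : P (k *: u0 + h) t1.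
  rewrite t1E; apply: (ps_perpD PS) => //; first by rewrite -t1E.
  by have := side_perp0 U k 1 F Hh (side_zero F Hh); rewrite scale1r addr0.
have tE : t = t1 + (k *: u0 + h).
  by rewrite /t t1E scalerDl scale1r; abelian.
have Qt : Q t by rewrite tE; apply: (ps_add PS) => //; apply: (ps_sym PS).
have tt1 : P t1 t.
  by rewrite tE; apply: (ps_perpD PS); rewrite -?tE //; [exact: (ps_refl PS)|exact: (ps_sym PS)].
have QC : Q (u0 + h') by rewrite -[u0]scale1r; apply: (side_Q0 U 1 F1).
have Ct : P (u0 + h') t.
  pose e := b h (y + h'); pose D := e *: u0 + (y + h').
  have QD : Q D by apply: (side_Q0 U _ F1).
  have Q1h := side_Q1' U F Hh.
  have D1h : P D (u1 + h) by apply: (coef_perp U F1 F).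
  have QD1 : Q (u1 + h + D) by apply: (ps_add PS) => //; apply: (ps_sym PS).
  have tE2 : t = u1 + h + D + (1 + k - e) *: u0.
    by rewrite /t /D !scalerBl; abelian.
  have CD l z : H1 z -> P (u0 + h') (l *: u0 + z).
    by move=> Hz; have := side_perp0 U 1 l F1 Hh' Hz; rewrite scale1r.
  rewrite tE2; apply: (ps_perpD PS); rewrite -?tE2 //; first exact: (ps_scale PS).
    apply: (ps_perpD PS) => //; last exact: CD.
    by have := coef_perp U F1 F Hh Hh'; rewrite bhh scale1r.
  by have := CD (1 + k - e) 0 (side_zero F1 Hy); rewrite addr0.
split=> //; have -> : u1 + y = t1 - (u0 + h') by rewrite /t1; abelian.
apply: (ps_perpB PS) => //; try exact: (ps_sym PS).
have -> : t1 - (u0 + h') = u1 + y by rewrite /t1; abelian.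
exact: (side_Q1' U F1).
Qed.

(** Remove u1 + (y + h') from the point of [third_perp]: what is left is collinear with u1 + y, so
    its u0-coefficient must be [b y h]. *)
Lemma third_coef H H1 h h' y : side H H1 -> side H1 H -> H h -> H1 h' ->
  H1 y -> b h h' = 1 -> b y h = 1 + b (y + h') h.
Proof.
move=> F F1 Hh Hh' Hy bhh; have [Qt Pt] := third_perp F F1 Hh Hh' Hy bhh.
have Hyh := fr_add F1 Hy Hh'.
apply: (coef_uniq U F F1) => //; set k := 1 + _ in Pt *.
have -> : k *: u0 + h = u1 + (y + h') + (k *: u0 + h) - (u1 + (y + h')) by abelian.
apply: (ps_perpBl PS) => //; [exact: (side_Q1' U F1)|exact: (side_Q1' U F1)| |].
  rewrite [X in Q X](_ : _ = k *: u0 + h); last by abelian.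
  exact: (side_Q0 U _ F).
have := @side_perp0 _ _ (frame_pair_sym U) _ _ 1 1 (y + h') y (frame_side_sym F1) Hyh Hy.
by rewrite !scale1r.
Qed.

Lemma third_coefN H H1 h h' : side H H1 -> side H1 H -> H h -> H1 h' ->
  b h h' = 1 -> b h' h = - 1.
Proof.
move=> F F1 Hh Hh' bhh; have H0 := side_zero F1 Hh'.
have := third_coef F F1 Hh Hh' H0 bhh; rewrite (coef0l U F F1) // add0r.
by move=> /eqP; rewrite eq_sym addrC addr_eq0 => /eqP.
Qed.

(** At y = 0 the u0-component in [third_perp] cancels, leaving the point u1 + h' + h, collinear with
    u1. *)
Lemma third_sum H H1 h h' : side H H1 -> side H1 H -> H h -> H1 h' ->
  b h h' = 1 -> Q (h + h').
Proof.
move=> F F1 Hh Hh' bhh; have H0 := side_zero F1 Hh'.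
have [] := third_perp F F1 Hh Hh' H0 bhh.
rewrite !addr0 add0r (third_coefN F F1) // subrr scale0r add0r => Qt Pt.
have -> : h + h' = u1 + h' + h - u1 by abelian.
by apply: (ps_sub PS) => //; apply: (fr_Q1 U).
Qed.

(** As h + h' is a point, so is r = u1 + m (h + h'). With e = b (m h') h, the vectors e u0 + h and h
    + h' are collinear with r, hence so is their difference, which carries the coefficient -e at
    h'. *)
Lemma third_coefM H H1 h h' m : side H H1 -> side H1 H -> H h -> H1 h' ->
  b h h' = 1 -> b (m *: h) h' = - b (m *: h') h.
Proof.
move=> F F1 Hh Hh' bhh; have Qz := third_sum F F1 Hh Hh' bhh.
have [Hm Hm'] := (fr_scale F m Hh, fr_scale F1 m Hh').
have [Q0 Q1] := (fr_Q0 U, fr_Q1 U).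
have P1z : P u1 (h + h').
  by apply: (ps_perpD PS) => //; [exact: (fr_Q F)|exact: (fr_Q F1)|exact: (fr_perp1 F)|exact: (fr_perp1 F1)].
have Qr : Q (u1 + m *: (h + h')).
  by apply: (ps_add PS) => //; [exact: (ps_scale PS)|exact: (ps_perpZ PS)].
have zr : P (h + h') (u1 + m *: (h + h')).
  apply: (ps_perpD PS) => //; first exact: (ps_scale PS).
    exact: (ps_sym PS).
  exact/(ps_perpZ PS)/(ps_refl PS).
set e := b (m *: h') h.
have er : P (e *: u0 + h) (u1 + m *: (h + h')).
  have -> : u1 + m *: (h + h') = u1 + m *: h' + m *: h.
    by rewrite scalerDr; abelian.
  apply: (ps_perpD PS); [exact: (side_Q0 U _ F)|exact: (side_Q1' U F1)|
    exact: (fr_Q F)| |exact: (coef_perp U F F1)|].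
    by rewrite -addrA -scalerDr addrC [h' + h]addrC addrC.
  rewrite -[m *: h]add0r -[0](scale0r u0); exact: (side_perp0 U _ _ F).
have Qe := side_Q0 U (- e) F1 Hh'.
have er' : P ((- e) *: u0 + h') (u1 + m *: (h + h')).
  have E : (- e) *: u0 + h' = h + h' - (e *: u0 + h).
    by rewrite scaleNr; abelian.
  rewrite E; apply: (ps_perpBl PS) => //; last by rewrite -E.
  exact: (side_Q0 U _ F).
apply: (coef_uniq U F1 F) => //.
have E : u1 + m *: h = u1 + m *: (h + h') - m *: h'.
  by rewrite scalerDr; abelian.
rewrite E; apply: (ps_perpB PS) => //; [exact: (fr_Q F1)| |].
  by rewrite -E; apply: (side_Q1' U F).
rewrite -[m *: h']add0r -[0](scale0r u0); exact: (side_perp0 U _ _ F1).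
Qed.

(** If y' and z are not collinear, scale z to l z with [b (l *: z) y' = 1]; [third_coef] and
    [third_coefN] then compute the effect of adding y', and l cancels. *)
Lemma coefDl H H1 y y' z : side H H1 -> side H1 H -> H1 y -> H1 y' -> H z ->
  b (y + y') z = b y z + b y' z.
Proof.
move=> F F1 Hy Hy' Hz; case: (pselect (P y' z)) => yz.
  by rewrite (coefD_perp U F F1) // [b y' z](coef_eq0 U F F1) // addr0.
have zy : ~ P z y' by move=> /(ps_sym PS).
have [l bl] := coef_solve U 1 F1 F Hz Hy' zy.
have lU : l \is a GRing.unit.
  apply: (div_unit KF) => l0; move: bl; rewrite l0 scale0r (coef0l U F1 F) //.
    by move=> /esym/eqP; rewrite oner_eq0.
  exact: (side_zero F Hz).
have Hlz := fr_scale F l Hz.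
have := third_coefN F F1 Hlz Hy' bl; have := third_coef F F1 Hlz Hy' Hy bl.
rewrite !(coefZ U _ F F1) //; last exact: (fr_add F1).
move=> E1 E2; apply: (mulrI lU); rewrite mulrDr E1 E2; abelian.
Qed.

End ThirdPoint.
Lemma frame_pairZ u0 u1 c : c <> 0 -> frame_pair u0 u1 -> frame_pair (c *: u0) u1.
Proof.
move=> c0 U; split; [exact/(ps_scale PS)/(fr_Q0 U)|exact: (fr_Q1 U)|].
by move=> /(ps_sym PS)/(ps_perpZ_inv KF PS c0)/(ps_sym PS)/(fr_opp U).
Qed.

Lemma frame_sideZ u0 u1 H H1 c :
  frame_side u0 u1 H H1 -> frame_side (c *: u0) u1 H H1.
Proof.
by case=> FD FZ FQ FP F0 F1 FN; split=> // v Hv; apply/(ps_perpZl PS)/F0.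
Qed.

Section Rescale.
Variables (u0 u1 : V) (H H1 : set V).
Hypothesis U : frame_pair u0 u1.
Hypothesis F : frame_side u0 u1 H H1.
Hypothesis F1 : frame_side u0 u1 H1 H.
Local Notation b := (frame_coef u0 u1).

(** Carries the results about the third point u0 + u1 over to any point c u0 + u1, which is the
    third point of the frame rescaled by c. *)
Lemma coef_rescale c y z : c <> 0 -> H1 y -> H z ->
  b y z = frame_coef (c *: u0) u1 y z * c.
Proof.
move=> c0 Hy Hz; apply: (coef_uniq U F F1) => //; rewrite -scalerA.
exact: (coef_perp (frame_pairZ c0 U) (frame_sideZ c F) (frame_sideZ c F1)).
Qed.
End Rescale.

(** * The antiautomorphism attached to a normalized pair *)

Section Normed.
Variables (u0 u1 : V).
Hypothesis U : frame_pair u0 u1.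
Hypothesis Q01 : Q (u0 + u1).
Local Notation side := (frame_side u0 u1).
Local Notation b := (frame_coef u0 u1).

Lemma point_coef H H1 h h' c : side H H1 -> side H1 H -> H h -> H1 h' ->
  c <> 0 -> Q (c *: u0 + u1) -> b h h' = c ->
  b h' h = - c /\ forall m, b (m *: h) h' = - b (m *: h') h.
Proof.
move=> F F1 Hh Hh' c0 Qc bhh; have cU := div_unit KF c0.
have [Fc F1c] := (frame_sideZ c F, frame_sideZ c F1).
have Uc := frame_pairZ c0 U.
have bc1 : frame_coef (c *: u0) u1 h h' = 1.
  by apply: (mulIr cU); rewrite -(coef_rescale U F1 F) // mul1r.
split; first by rewrite (coef_rescale U F F1 c0) // (third_coefN Uc Qc Fc F1c) // mulN1r.
move=> m; rewrite (coef_rescale U F1 F c0) //; last exact: (fr_scale F).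
rewrite (coef_rescale U F F1 c0) //; last exact: (fr_scale F1).
by rewrite (third_coefM Uc Qc m Fc F1c) // mulNr.
Qed.

Section Pair.
Variables (H H1 : set V).
Hypothesis F : side H H1.
Hypothesis F1 : side H1 H.
Variables x y : V.
Hypothesis Hx : H x.
Hypothesis Hy : H1 y.
Hypothesis byx : b y x = 1.
Let s k := b (k *: y) x.

Let Hky k : H1 (k *: y). Proof. exact: (fr_scale F1). Qed.
Let Hkx k : H (k *: x). Proof. exact: (fr_scale F). Qed.

Lemma pair_add k l : s (k + l) = s k + s l.
Proof. by rewrite /s scalerDl (coefDl U Q01 F F1). Qed.

Lemma pair_one : s 1 = 1.
Proof. by rewrite /s scale1r. Qed.

Let nperp : ~ P x y.
Proof.
move=> /(ps_sym PS) /(coef_eq0 U F F1 Hy Hx); rewrite byx => /eqP.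
by rewrite oner_eq0.
Qed.

Let s0 : s 0 = 0.
Proof. by rewrite /s scale0r (coef0l U F F1) //; apply: (side_zero F1 Hy). Qed.

Let sN k : s (- k) = - s k.
Proof. by apply: (addrI (s k)); rewrite -pair_add !subrr s0. Qed.

Let HxN : H (- x). Proof. exact: (side_oppr F). Qed.

(** The third-point lemmas want coefficient 1 in the other order of arguments; by [third_coefN] the
    switch costs a sign, so -x takes the place of x. *)
Let neg_coef : b (- x) y = 1.
Proof.
have [l bl] := coef_solve U 1 F1 F Hx Hy nperp.
have := third_coefN U Q01 F F1 (Hkx l) Hy bl.
by rewrite (coefZ U _ F F1) // byx mulr1 => lE; move: bl; rewrite lE scaleN1r.
Qed.

Lemma pair_opp m : b (m *: x) y = - s m.
Proof.
have := third_coefM U Q01 (- m) F F1 HxN Hy neg_coef.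
rewrite scalerN scaleNr opprK => ->; rewrite (coefN U F F1) // opprK.
exact: sN.
Qed.

Lemma pair_point c : c <> 0 -> Q (c *: u0 + u1) -> s c = c.
Proof.
move=> c0 Qc; have [l bl] := coef_solve U c F1 F Hx Hy nperp.
have [bN _] := point_coef F F1 (Hkx l) Hy c0 Qc bl.
have lE : l = - c by rewrite -bN (coefZ U _ F F1) // byx mulr1.
by have := pair_opp l; rewrite bl lE sN opprK.
Qed.

Lemma pair_pointM c m : c <> 0 -> Q (c *: u0 + u1) -> s (m * c) = c * s m.
Proof.
move=> c0 Qc; have bc : b (- c *: x) y = c.
  by rewrite pair_opp sN opprK pair_point.
have [_ /(_ m)] := point_coef F F1 (Hkx (- c)) Hy c0 Qc bc.
by rewrite scalerA (coefZ U _ F F1) // mulrN pair_opp sN mulNr !opprK.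
Qed.

(** Start from the point u1 + k (y - x), add the collinear vector (k s k) u0 + k x, and remove k y.
    With norms known to be points, [pair_pointM] becomes the hypothesis [s_norm] of the division
    ring section. *)
Lemma pair_norm_point k : Q ((k * s k) *: u0 + u1).
Proof.
have [Q0 Q1] := (fr_Q0 U, fr_Q1 U); set c := k * s k.
have Qz := third_sum U Q01 F F1 HxN Hy neg_coef.
have P1z : P u1 (- x + y).
  by apply: (ps_perpD PS) => //; [exact: (fr_Q F)|exact: (fr_Q F1)|exact: (fr_perp1 F)|exact: (fr_perp1 F1)].
pose t := u1 + k *: (- x + y).
have Qt : Q t by apply: (ps_add PS) => //; [exact: (ps_scale PS)|exact: (ps_perpZ PS)].
have tE : t = u1 + k *: y - k *: x by rewrite /t scalerDr scalerN; abelian.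
have QB := side_Q0 U c F (Hkx k).
have Bt : P (c *: u0 + k *: x) t.
  rewrite tE; apply: (ps_perpB PS) => //.
  - exact: (side_Q1' U F1).
  - exact: (fr_Q F).
  - by rewrite -tE.
  - have := coef_perp U F F1 (Hky k) (Hkx k).
    by rewrite (coefZ U _ F F1).
  - by have := side_perp0 U c 0 F (Hkx k) (Hkx k); rewrite scale0r add0r.
have Qr : Q (u1 + k *: y + c *: u0).
  have -> : u1 + k *: y + c *: u0 = t + (c *: u0 + k *: x) by rewrite tE; abelian.
  by apply: (ps_add PS) => //; apply: (ps_sym PS).
have -> : c *: u0 + u1 = u1 + k *: y + c *: u0 - k *: y by abelian.
apply: (ps_sub PS) => //; first exact: (fr_Q F1).
apply: (ps_perpDl PS) => //; [exact: (fr_Q F1)|exact: (side_Q1' U F1)|exact: (ps_scale PS)| |].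
  have := side_perp0 (frame_pair_sym U) 1 0 (frame_side_sym F1) (Hky k) (Hky k).
  by rewrite scale1r scale0r add0r.
exact/(ps_perpZl PS)/(fr_perp0 F1).
Qed.

Let s_norm m k : s (m * (k * s k)) = k * s k * s m.
Proof.
case: (pselect (k * s k = 0)) => [->|c0]; first by rewrite mulr0 mul0r s0.
exact/pair_pointM/pair_norm_point.
Qed.

Lemma pair_antimorphism m k : s (m * k) = s k * s m.
Proof. exact: (normed_antimorphism KF pair_add pair_one s_norm). Qed.

Lemma pair_involutive k : s (s k) = k.
Proof. exact: (normed_involutive pair_add pair_one s_norm). Qed.

End Pair.

(** x - x' is collinear with y, hence with every multiple of y. *)
Lemma coef_proportional H H1 x x' y k : side H H1 -> side H1 H ->
  H x -> H x' -> H1 y -> b y x = b y x' -> b (k *: y) x = b (k *: y) x'.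
Proof.
move=> F F1 Hx Hx' Hy bE; have Hk := fr_scale F1 k Hy.
have HN := side_oppr F Hx'; have Hz : H (x - x') by apply: (fr_add F).
have : P y (x - x').
  apply: (coef0_perp U F F1) => //.
  by rewrite (coefDr U F F1) // (coefN U F F1) // bE subrr.
move=> /(ps_perpZl PS k) /(coef_eq0 U F F1 Hk Hz).
rewrite (coefDr U F F1) // (coefN U F F1) // => /eqP.
by rewrite subr_eq0 => /eqP.
Qed.

Section PairEq.
Variables (H H1 : set V).
Hypothesis F : side H H1.
Hypothesis F1 : side H1 H.

(** [pair_opp] moves the scalar from y to x, where [coef_proportional] applies with the two sides
    exchanged. *)
Let pair_same_x x y y' k : H x -> H1 y -> H1 y' -> b y x = 1 -> b y' x = 1 ->
  b (k *: y) x = b (k *: y') x.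
Proof.
move=> Hx Hy Hy' byx by'x; apply: oppr_inj.
rewrite -(pair_opp F F1 Hx Hy byx) -(pair_opp F F1 Hx Hy' by'x).
apply: (coef_proportional k F1 F) => //; rewrite -[x]scale1r.
by rewrite (pair_opp F F1 Hx Hy byx) (pair_opp F F1 Hx Hy' by'x) !scale1r byx by'x.
Qed.

Let pair_eq_aux x1 y1 x2 y2 k : H x1 -> H1 y1 -> H x2 -> H1 y2 ->
  b y1 x1 = 1 -> b y2 x2 = 1 -> b y2 x1 <> 0 -> b (k *: y1) x1 = b (k *: y2) x2.
Proof.
move=> Hx1 Hy1 Hx2 Hy2 b1 b2 q0; set q := b y2 x1 in q0.
have qU := div_unit KF q0.
have bE m : b (m *: y2) x1 = q * b (m *: y2) x2.
  rewrite -(coefZ U _ F F1) //; last exact: (fr_scale F1).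
  apply: (coef_proportional m F F1) => //; first exact: (fr_scale F).
  by rewrite (coefZ U _ F F1) // b2 mulr1.
(* n is the image of q^-1 under the involution of the pair (x2, y2); hence (x1, n y2) is again
   normalized, and it shares x1 with the first pair. *)
pose n := b (q^-1 *: y2) x2.
have bn : b (n *: y2) x2 = q^-1 by rewrite (pair_involutive F F1 Hx2 Hy2 b2).
rewrite (@pair_same_x x1 y1 (n *: y2)) //; [|exact: (fr_scale F1)|].
  rewrite scalerA bE (pair_antimorphism F F1 Hx2 Hy2 b2) bn mulrA mulrV //.
  by rewrite mul1r.
by rewrite bE bn mulrV.
Qed.

(** This lets one map s serve all of H and H1. If both mixed coefficients vanish, x1 + x2 is
    normalized against y1 and against y2, and mediates between the pairs. *)
Lemma pair_eq x1 y1 x2 y2 k : H x1 -> H1 y1 -> H x2 -> H1 y2 ->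
  b y1 x1 = 1 -> b y2 x2 = 1 -> b (k *: y1) x1 = b (k *: y2) x2.
Proof.
move=> Hx1 Hy1 Hx2 Hy2 b1 b2.
case: (pselect (b y2 x1 = 0)) => [b21|]; last exact: pair_eq_aux.
case: (pselect (b y1 x2 = 0)) => [b12|b12]; last exact/esym/pair_eq_aux.
have Hx := fr_add F Hx1 Hx2.
have b1x : b y1 (x1 + x2) = 1 by rewrite (coefDr U F F1) // b1 b12 addr0.
have b2x : b y2 (x1 + x2) = 1 by rewrite (coefDr U F F1) // b2 b21 add0r.
transitivity (b (k *: y1) (x1 + x2)).
  by apply: (coef_proportional k F F1) => //; rewrite b1.
rewrite (@pair_same_x (x1 + x2) y1 y2) //.
by apply: (coef_proportional k F F1) => //; rewrite b2.
Qed.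

End PairEq.
End Normed.

(* The data from which the form is built: [frame_coef] on [H1 * H] is
   sesquilinear with respect to the antiautomorphism [s], and [r] is [s] up to
   a central sign. *)
Record frame_form u0 u1 H H1 (s r : K -> K) : Prop := FrameForm {
  ff_sD : forall k l, s (k + l) = s k + s l;
  ff_s1 : s 1 = 1;
  ff_rD : forall k l, r (k + l) = r k + r l;
  ff_rs : forall k l, r (k * s l) = l * r k;
  ff_rr : forall k l, r (k * r l) = l * s k;
  ff_coef : forall h h', H h -> H1 h' ->
    frame_coef u0 u1 h h' = r (frame_coef u0 u1 h' h);
  ff_coef' : forall h h', H h -> H1 h' ->
    frame_coef u0 u1 h' h = r (frame_coef u0 u1 h h');
  ff_point : forall c, Q (c *: u0 + u1) -> c + r c = 0 }.

(** * The two sources of a [frame_form]: skew-hermitian and symmetric *)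

Section FormExistence.
Variables (u0 u1 : V) (H H1 : set V).
Hypothesis U : frame_pair u0 u1.
Hypothesis F : frame_side u0 u1 H H1.
Hypothesis F1 : frame_side u0 u1 H1 H.
Variable h0 : V.
Hypothesis Hh0 : H h0.
Hypothesis h0_neq0 : h0 <> 0.
Local Notation b := (frame_coef u0 u1).

Let normalize h h' : H h -> H1 h' -> b h' h <> 0 ->
  H ((b h' h)^-1 *: h) /\ b h' ((b h' h)^-1 *: h) = 1.
Proof.
move=> Hh Hh' b0; have bU := div_unit KF b0.
by split; [exact: (fr_scale F)|rewrite (coefZ U _ F F1) // mulVr].
Qed.

Let normalized : exists x y, [/\ H x, H1 y & b y x = 1].
Proof.
have [y Hy yh0] : exists2 y, H1 y & ~ P y h0.
  apply: contrapT => ny; apply: h0_neq0; apply: (fr_nondeg F) => // w Hw.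
  by apply: contrapT => h0w; apply: ny; exists w => // /(ps_sym PS).
have b0 : b y h0 <> 0 by move=> /(coef0_perp U F F1 Hy Hh0).
by have [Hx byx] := normalize Hh0 Hy b0; exists ((b y h0)^-1 *: h0), y.
Qed.

Lemma third_point_form : Q (u0 + u1) -> exists s r, frame_form u0 u1 H H1 s r.
Proof.
move=> Q01; have [x [y [Hx Hy byx]]] := normalized; pose s k := b (k *: y) x.
have sD k l : s (k + l) = s k + s l by apply: (pair_add U Q01 F F1).
have s1 : s 1 = 1 by apply: (pair_one byx).
have sM k l : s (k * l) = s l * s k by apply: (pair_antimorphism U Q01 F F1).
have sK k : s (s k) = k by apply: (pair_involutive U Q01 F F1).
have s0 : s 0 = 0 by apply: (addrI (s 0)); rewrite -sD !addr0.
have sN k : s (- k) = - s k by apply: (addrI (s k)); rewrite -sD !subrr.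
have bE h h' : H h -> H1 h' -> b h h' = - s (b h' h).
  move=> Hh Hh'; case: (pselect (b h' h = 0)) => [b'0|q0].
    rewrite b'0 s0 oppr0; apply: (coef_eq0 U F1 F) => //.
    exact/(ps_sym PS)/(coef0_perp U F F1).
  have [Hz bz] := normalize Hh Hh' q0; move: Hz bz; set q := b h' h in q0 * => Hz bz.
  (* h is q times a vector normalized against h', so [pair_opp] evaluates the coefficient and
     [pair_eq] identifies the involution with s. *)
  rewrite -[h in LHS](div_scaleVK KF h q0).
  by rewrite (pair_opp U Q01 F F1 Hz Hh' bz) (pair_eq U Q01 F F1 _ Hz Hh' Hx Hy bz byx).
exists s, (fun k => - s k); split=> //.
- by move=> k l; rewrite sD opprD.
- by move=> k l; rewrite sM sK mulrN.
- by move=> k l; rewrite mulrN sN sM sK opprK.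
- by move=> h h' Hh Hh'; rewrite [in RHS]bE // sN sK opprK.
- move=> c Qc; case: (pselect (c = 0)) => [->|c0]; first by rewrite s0 subrr.
  by rewrite /s (pair_point U Q01 F F1 Hx Hy byx c0 Qc) subrr.
Qed.

Lemma no_third_point_form :
  (forall c h d h', H h -> H1 h' -> Q (c *: u0 + h + (d *: u1 + h')) ->
    P (c *: u0 + h) (d *: u1 + h')) ->
  exists s r, frame_form u0 u1 H H1 s r.
Proof.
move=> noQ; have [x [y [Hx Hy byx]]] := normalized.
(* u1 + h and b h h' u0 + h' are collinear, so their sum is a point; regrouped as (b h h' u0 + h) +
   (u1 + h'), it falls under [noQ]. *)
have bE h h' : H h -> H1 h' -> b h h' = b h' h.
  move=> Hh Hh'; apply/esym; apply: (coef_uniq U F F1) => //.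
  have := @noQ (b h h') h 1 h' Hh Hh'; rewrite scale1r; apply.
  have -> : b h h' *: u0 + h + (u1 + h') = u1 + h + (b h h' *: u0 + h') by abelian.
  apply: (ps_add PS); [exact: (side_Q1' U F)|exact: (side_Q0 U _ F1)|].
  exact/(ps_sym PS)/(coef_perp U F1 F).
(* The coefficient of k y and l x, computed in both orders by symmetry, is k l and l k. *)
have KC k l : k * l = l * k.
  have Hky := fr_scale F1 k Hy; have Hlx := fr_scale F l Hx.
  have : b (l *: x) (k *: y) = k * l.
    by rewrite (coefZ U _ F1 F) // bE // (coefZ U _ F F1) // byx mulr1.
  by rewrite bE // (coefZ U _ F F1) // -bE // (coefZ U _ F1 F) // bE // byx mulr1.
exists id, id; split=> // [h h' Hh Hh'|c Qc]; first exact/esym/bE.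
have H0 := side_zero F Hx; have H10 := side_zero F1 Hy.
have := noQ c 0 1 0 H0 H10; rewrite !addr0 scale1r => /(_ Qc).
by move=> /(multiple_opp (fr_opp U)) ->; rewrite addr0.
Qed.

End FormExistence.

(** * The form in coordinates, and its agreement with collinearity *)

Section Form.
Variables (u0 u1 : V) (H H1 : set V) (s r : K -> K).
Hypothesis U : frame_pair u0 u1.
Hypothesis F : frame_side u0 u1 H H1.
Hypothesis F1 : frame_side u0 u1 H1 H.
Hypothesis FF : frame_form u0 u1 H H1 s r.
Local Notation b := (frame_coef u0 u1).

(** A relation makes d u0 + p equal to -(e u1 + p'), a vector collinear with the whole of both
    spans. So d = e = 0, as u0 and u1 are not collinear, and p, p' vanish by [fr_nondeg]. *)
Lemma frame_free d p e p' : H p -> H1 p' -> d *: u0 + p + (e *: u1 + p') = 0 ->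
  [/\ d = 0, p = 0, e = 0 & p' = 0].
Proof.
move=> Hp Hp' /eqP; rewrite addr_eq0 => /eqP E.
have [H0 H10] := (side_zero F Hp, side_zero F1 Hp').
have perp1 l z : H1 z -> P (d *: u0 + p) (l *: u1 + z).
  move=> Hz; rewrite E; apply/(ps_sym PS)/(ps_perpN PS).
  exact: (side_perp0 (frame_pair_sym U) _ _ (frame_side_sym F1)).
have perp0 l z : H z -> P (l *: u0 + z) (e *: u1 + p').
  move=> Hz; rewrite -[e *: u1 + p']opprK -E; apply/(ps_perpN PS).
  exact: (side_perp0 U _ _ F).
have d0 : d = 0.
  apply: (multiple_opp (fr_opp U)); rewrite -[d *: u0](addrK p).
  apply: (ps_perpBl PS) => //.
  - exact: (fr_Q1 U).
  - exact: (side_Q0 U _ F).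
  - exact: (fr_Q F).
  - by rewrite addrK; apply/(ps_scale PS)/(fr_Q0 U).
  - by have := perp1 1 0 H10; rewrite scale1r addr0.
  - exact/(ps_sym PS)/(fr_perp1 F).
have e0 : e = 0.
  apply: (multiple_opp (fr_opp (frame_pair_sym U))); rewrite -[e *: u1](addrK p').
  apply: (ps_perpBl PS) => //.
  - exact: (fr_Q0 U).
  - exact: (side_Q1 U _ F1).
  - exact: (fr_Q F1).
  - by rewrite addrK; apply/(ps_scale PS)/(fr_Q1 U).
  - by have := perp0 1 0 H0; rewrite scale1r addr0 => /(ps_sym PS).
  - exact/(ps_sym PS)/(fr_perp0 F1).
have p0 : p = 0.
  apply: (fr_nondeg F) => // w Hw; have := perp1 0 w Hw.
  by rewrite d0 !scale0r !add0r.
by split=> //; move: E; rewrite d0 e0 p0 !scale0r !add0r => /esym/eqP; rewrite oppr_eq0 => /eqP.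
Qed.

Section Perp.
Variables (c : K) (h h' : V).
Hypothesis Hh : H h.
Hypothesis Hh' : H1 h'.
Let x := c *: u0 + h + (u1 + h').
Hypothesis Qx : Q x.

Let xE : x = u1 + h + (c *: u0 + h').
Proof. by rewrite /x; abelian. Qed.

Let Qu := fr_Q0 U.

Let perp_coef p : H p -> P x (b h' p *: u0 + p).
Proof.
move=> Hp; apply/(ps_sym PS)/(ps_perpD PS) => //.
- exact: (side_Q0 U _ F).
- exact: (side_Q0 U _ F).
- exact: (side_Q1' U F1).
- exact: (side_perp0 U _ _ F).
- exact: (coef_perp U F F1).
Qed.

Let perp_coef' p' : H1 p' -> P x (b h p' *: u0 + p').
Proof.
move=> Hp; rewrite xE; apply/(ps_sym PS)/(ps_perpD PS); rewrite -?xE //.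
- exact: (side_Q0 U _ F1).
- exact: (side_Q1' U F).
- exact: (side_Q0 U _ F1).
- exact: (coef_perp U F1 F).
- exact: (side_perp0 U _ _ F1).
Qed.

Let not_perp_u0 : ~ P u0 x.
Proof.
move=> Pu; apply: (side_opp U F1 Hh').
rewrite -[u1 + h'](addrK (c *: u0 + h)) [u1 + h' + _]addrC; apply: (ps_perpB PS) => //.
- exact: (side_Q0 U _ F).
- rewrite [X in Q X](_ : _ = u1 + h'); last by abelian.
  exact: (side_Q1' U F1).
- by have := side_perp0 U 1 c F (side_zero F Hh) Hh; rewrite scale1r addr0.
Qed.

Let multiple_u0 k : P x (k *: u0) -> k = 0.
Proof. by move=> /(ps_sym PS); apply: multiple_opp. Qed.

(** Removing B u0 + h and then h' from x leaves the point (c - B) u0 + u1 of the line u0u1, to which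
    [ff_point] applies. *)
Let isotropic : r c = b h' h + b h h' - c.
Proof.
pose B := b h' h; have QB := side_Q0 U B F Hh.
have E1 : u1 + h' + (c - B) *: u0 = x - (B *: u0 + h).
  by rewrite /x scalerBl; abelian.
have Q1 : Q (u1 + h' + (c - B) *: u0).
  by rewrite E1; apply: (ps_sub PS) => //; apply: perp_coef.
have Q2 : Q ((c - B) *: u0 + u1).
  have -> : (c - B) *: u0 + u1 = u1 + h' + (c - B) *: u0 - h' by abelian.
  apply: (ps_sub PS) => //; first exact: (fr_Q F1).
  apply: (ps_perpDl PS) => //; [exact: (fr_Q F1)|exact: (side_Q1' U F1)|exact: (ps_scale PS)| |].
    have := side_perp0 (frame_pair_sym U) 1 0 (frame_side_sym F1) Hh' Hh'.
    by rewrite scale1r scale0r add0r.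
  exact/(ps_perpZl PS)/(fr_perp0 F1).
have E := ff_point FF Q2; have := ff_rD FF (c - B) B.
rewrite subrK => ->; rewrite -(ff_coef FF Hh Hh').
by apply: (eq_of_sub_eq E); rewrite /B; abelian.
Qed.

(** x is collinear with b h' p u0 + p and with b h p' u0 + p'. Their sum has the right components p
    and p'; a further multiple of u0 is collinear with x only if it is 0. *)
Let perp_form0 d p p' : H p -> H1 p' -> Q (d *: u0 + p + p') ->
  P x (d *: u0 + p + p') <-> d = b h' p + b h p'.
Proof.
move=> Hp Hp' Qt; set E := b h' p + b h p'; have Qp := side_Q0 U d F Hp.
have P0 z : H z \/ H1 z -> P u0 z by case=> [/(fr_perp0 F)|/(fr_perp0 F1)].
have Q0 k := ps_scale PS k Qu.
have P0t : P u0 (d *: u0 + p + p').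
  apply: (ps_perpD PS) => //; [exact: (fr_Q F1)| |by apply: P0; right].
  by have := side_perp0 U 1 d F (side_zero F Hp) Hp; rewrite scale1r addr0.
have tE k : d *: u0 + p + p' = k *: u0 + p + p' + (d - k) *: u0.
  by rewrite scalerBl; abelian.
have Qt' k : Q (k *: u0 + p + p').
  rewrite [X in Q X](_ : _ = d *: u0 + p + p' - (d - k) *: u0); last first.
    by rewrite (tE k) addrK.
  by apply: (ps_sub PS) => //; apply/(ps_perpZ PS)/(ps_sym PS).
have PE : P x (E *: u0 + p + p').
  have E2 : E *: u0 + p + p' = b h' p *: u0 + p + (b h p' *: u0 + p').
    by rewrite scalerDl; abelian.
  rewrite E2; apply: (ps_perpD PS); rewrite -?E2 //.
  - exact: (side_Q0 U _ F).
  - exact: (side_Q0 U _ F1).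
  - exact: perp_coef.
  - exact: perp_coef'.
split=> [Pt|->] //; apply/eqP; rewrite -subr_eq0; apply/eqP/multiple_u0.
have -> : (d - E) *: u0 = d *: u0 + p + p' - (E *: u0 + p + p').
  by rewrite (tE E); abelian.
apply: (ps_perpB PS) => //.
by rewrite [X in Q X](_ : _ = (d - E) *: u0) // (tE E); abelian.
Qed.

(** The argument of [perp_form0] applied to the difference of the given vector and x, using that x
    is collinear with itself; [isotropic] brings in r c. *)
Let perp_form1 d p p' : H p -> H1 p' -> Q (d *: u0 + p + (u1 + p')) ->
  P x (d *: u0 + p + (u1 + p')) <-> d + r c - b h' p - b h p' = 0.
Proof.
move=> Hp Hp' Qt; have [HN HN'] := (side_oppr F Hh, side_oppr F1 Hh').
have [Hz Hz'] := (fr_add F Hp HN, fr_add F1 Hp' HN').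
set e := b h' (p - h); set e' := b h (p' - h').
have Pz : P x (e *: u0 + (p - h)) by apply: perp_coef.
have Pz' : P x (e' *: u0 + (p' - h')) by apply: perp_coef'.
have Qz := side_Q0 U e F Hz; have Qz' k := side_Q0 U k F1 Hz'.
have -> : d + r c - b h' p - b h p' = d - c - e - e'.
  rewrite isotropic /e /e' (coefDr U F F1) // (coefDr U F1 F) //.
  by rewrite (coefN U F F1) // (coefN U F1 F) //; abelian.
set k := d - c - e - e'; set t := d *: u0 + p + _ in Qt *.
have QA : Q (x + (e *: u0 + (p - h))) by apply: (ps_add PS).
have PA : P x (x + (e *: u0 + (p - h))).
  by apply: (ps_perpD PS) => //; apply: (ps_refl PS).
have tE : t = x + (e *: u0 + (p - h)) + ((e' + k) *: u0 + (p' - h')).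
  by rewrite /t /x /k !(scalerDl, scaleNr); abelian.
clearbody k; split=> [Pt|k0]; last first.
  by rewrite tE; apply: (ps_perpD PS); rewrite -?tE // k0 addr0.
apply: multiple_u0.
have E : k *: u0 = (e' + k) *: u0 + (p' - h') - (e' *: u0 + (p' - h')).
  by rewrite scalerDl; abelian.
rewrite E; apply: (ps_perpB PS); rewrite -?E //; first exact: (ps_scale PS).
have E2 : (e' + k) *: u0 + (p' - h') = t - (x + (e *: u0 + (p - h))).
  by rewrite tE; abelian.
by rewrite E2; apply: (ps_perpB PS); rewrite -?E2.
Qed.

Lemma perp_form d p e p' : H p -> H1 p' -> Q (d *: u0 + p + (e *: u1 + p')) ->
  P x (d *: u0 + p + (e *: u1 + p')) <->
  d + e * r c - b h' p - b h p' = 0.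
Proof.
move=> Hp Hp' Qt; case: (pselect (e = 0)) => [e0|e0].
  move: Qt; rewrite e0 scale0r add0r mul0r addr0 => Qt.
  rewrite perp_form0 //; split=> [->|E]; first by abelian.
  by apply: (eq_of_sub_eq E); abelian.
have eU := div_unit KF e0; have [Hq Hq'] := (fr_scale F e^-1 Hp, fr_scale F1 e^-1 Hp').
have tE : e^-1 *: (d *: u0 + p + (e *: u1 + p')) =
    (e^-1 * d) *: u0 + e^-1 *: p + (u1 + e^-1 *: p').
  by rewrite !scalerDr !scalerA mulVr // scale1r.
have := @perp_form1 (e^-1 * d) _ _ Hq Hq'; rewrite -tE => /(_ (ps_scale PS _ Qt)) {}tE.
have -> : d + e * r c - b h' p - b h p' =
    e * (e^-1 * d + r c - b h' (e^-1 *: p) - b h (e^-1 *: p')).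
  rewrite (coefZ U _ F F1) // (coefZ U _ F1 F) //.
  by rewrite !(mulrDr, mulrN) !(mulrA e) mulrV // !mul1r.
split=> [Pt|E]; first by rewrite (proj1 tE) ?mulr0 //; apply: (ps_perpZ PS).
apply: (ps_perpZ_inv KF PS (k := e^-1)); first exact: div_inv_neq0.
by apply/tE/(mulrI eU); rewrite E mulr0.
Qed.

End Perp.

Hypothesis span : forall v, exists d p e p',
  [/\ H p, H1 p' & v = d *: u0 + p + (e *: u1 + p')].

Lemma reflexive_form : exists f : V -> V -> K,
  [/\ forall x v w, f x (v + w) = f x v + f x w,
     forall x k v, f x (k *: v) = k * f x v,
     forall v w, f v w = 0 -> f w v = 0 &
     forall v w, Q v -> Q w -> (P v w <-> f v w = 0)].
Proof.
have /choice[co coP] : forall v, exists q : K * V * (K * V),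
    [/\ H q.1.2, H1 q.2.2 & v = q.1.1 *: u0 + q.1.2 + (q.2.1 *: u1 + q.2.2)].
  by move=> v; have [d [p [e [p' vP]]]] := span v; exists ((d, p), (e, p')).
have coE d p e p' : H p -> H1 p' ->
    co (d *: u0 + p + (e *: u1 + p')) = ((d, p), (e, p')).
  move=> Hp Hp'; have := coP (d *: u0 + p + (e *: u1 + p')).
  case: (co _) => [[d2 p2] [e2 p2']] /= [H2 H2' E].
  have [] := @frame_free (d2 - d) (p2 - p) (e2 - e) (p2' - p').
  - by apply: (fr_add F) => //; apply: (side_oppr F).
  - by apply: (fr_add F1) => //; apply: (side_oppr F1).
  - by apply: (eq_of_sub_eq (esym E)); rewrite !scalerBl; abelian.
  by do 4! [move=> /eqP; rewrite subr_eq0 => /eqP ->].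
(* Linear in w, and equal to the expression in [perp_form] when the u1-coordinate a of v is 1. *)
pose f v w := let: ((c, h), (a, h')) := co v in let: ((d, p), (e, p')) := co w in
  d * s a + e * r c - b h' p - b h p'.
have fD x v w : f x (v + w) = f x v + f x w.
  rewrite /f; case: (co x) (coP x) => [[c h] [a h']] /= [Hh Hh' _].
  have [Hv Hv' Ev] := coP v; have [Hw Hw' Ew] := coP w.
  have -> : co (v + w) = (((co v).1.1 + (co w).1.1, (co v).1.2 + (co w).1.2),
      ((co v).2.1 + (co w).2.1, (co v).2.2 + (co w).2.2)).
    rewrite -coE; [congr co|exact: (fr_add F)|exact: (fr_add F1)].
    by rewrite {1}Ev {1}Ew !scalerDl; abelian.
  case: (co v) Hv Hv' {Ev} => [[d p] [e p']] /= Hv Hv'.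
  case: (co w) Hw Hw' {Ew} => [[d2 p2] [e2 p2']] /= Hw Hw'.
  by rewrite (coefDr U F F1) // (coefDr U F1 F) //; abelian_ring.
have fZ x k v : f x (k *: v) = k * f x v.
  rewrite /f; case: (co x) (coP x) => [[c h] [a h']] /= [Hh Hh' _].
  have [Hv Hv' Ev] := coP v.
  have -> : co (k *: v) = ((k * (co v).1.1, k *: (co v).1.2),
      (k * (co v).2.1, k *: (co v).2.2)).
    rewrite -coE; [congr co|exact: (fr_scale F)|exact: (fr_scale F1)].
    by rewrite {1}Ev !scalerDr !scalerA.
  case: (co v) Hv Hv' {Ev} => [[d p] [e p']] /= Hv Hv'.
  by rewrite (coefZ U _ F F1) // (coefZ U _ F1 F) //; abelian_ring.
have r0 : r 0 = 0 by apply: (addrI (r 0)); rewrite -(ff_rD FF) !addr0.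
have rN k : r (- k) = - r k.
  by apply: (addrI (r k)); rewrite -(ff_rD FF) !subrr.
have s0 : s 0 = 0 by apply: (addrI (s 0)); rewrite -(ff_sD FF) !addr0.
have f_refl v w : f w v = r (f v w).
  rewrite /f; case: (co v) (coP v) => [[c h] [a h']] /= [Hh Hh' _].
  case: (co w) (coP w) => [[d p] [e p']] /= [Hp Hp' _].
  rewrite !(ff_rD FF) !rN (ff_rs FF) (ff_rr FF).
  by rewrite -(ff_coef FF Hp Hh') -(ff_coef' FF Hh Hp'); abelian.
have f_sym v w : f v w = 0 -> f w v = 0 by rewrite [f w v]f_refl => ->.
have f_scale k v w : k <> 0 -> f (k *: v) w = 0 -> f v w = 0.
  move=> k0 /f_sym; rewrite fZ => /(div_mul0 KF) [//|].
  exact: f_sym.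
(* Dividing v by its u1-coordinate makes [perp_form] applicable. *)
have main v w : Q v -> Q w -> (co v).2.1 <> 0 -> (P v w <-> f v w = 0).
  move=> Qv Qw a0; have aU := div_unit KF a0.
  have [Hv Hv' Ev] := coP v; have [Hw Hw' Ew] := coP w.
  move: a0 aU Hv Hv' Ev; case E: (co v) => [[c h] [a h']] /= a0 aU Hh Hh' Ev.
  have vE : a^-1 *: v = (a^-1 * c) *: u0 + a^-1 *: h + (u1 + a^-1 *: h').
    by rewrite Ev !scalerDr !scalerA mulVr // scale1r.
  have Qx := ps_scale PS a^-1 Qv; rewrite vE in Qx.
  have [Hx Hx'] := (fr_scale F a^-1 Hh, fr_scale F1 a^-1 Hh').
  move: Hw Hw' Ew; case Eq: (co w) => [[d p] [e p']] /= Hp Hp' Ew.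
  have Qw' := Qw; rewrite Ew in Qw'.
  have := perp_form Hx Hx' Qx Hp Hp' Qw'; rewrite -Ew -vE.
  have <- : f (a^-1 *: v) w = d + e * r (a^-1 * c) - b (a^-1 *: h') p - b (a^-1 *: h) p'.
    by rewrite /f vE -[u1 in u1 + _ *: h']scale1r coE // Eq (ff_s1 FF) mulr1.
  have a'0 : a^-1 <> 0 by apply: div_inv_neq0.
  move=> PE; split=> [/(ps_perpZl PS a^-1)/PE/(f_scale _ _ _ a'0) //|fvw].
  apply/(ps_sym PS)/(ps_perpZ_inv KF PS a'0)/(ps_sym PS)/PE/f_sym.
  by rewrite fZ f_sym ?mulr0.
exists f; split=> // v w Qv Qw.
case: (pselect ((co v).2.1 = 0)) => [a0|]; last exact: main.
case: (pselect ((co w).2.1 = 0)) => [e0|e0]; last first.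
  by split=> [/(ps_sym PS)/main|/f_sym/main] H0; [apply/f_sym/H0|apply/(ps_sym PS)/H0].
have [Hv Hv' Ev] := coP v; have [Hw Hw' Ew] := coP w.
move: a0 Hv Hv' Ev; case E: (co v) => [[c h] [a h']] /= a0 Hh Hh' Ev.
move: e0 Hw Hw' Ew; case Eq: (co w) => [[d p] [e p']] /= e0 Hp Hp' Ew.
have Q0 k := ps_scale PS k (fr_Q0 U).
have strip k z z' v1 : H z -> H1 z' -> Q v1 -> v1 = k *: u0 + z + (0 *: u1 + z') ->
    P u0 v1 /\ Q (z + z').
  move=> Hz Hz' Qv1 v1E; have v1E' : v1 = k *: u0 + z + z' by rewrite v1E scale0r add0r.
  have P0 : P u0 v1.
    rewrite v1E'; apply: (ps_perpD PS); rewrite -?v1E' //.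
    - exact: (fr_Q0 U).
    - exact: (side_Q0 U _ F).
    - exact: (fr_Q F1).
    - by have := side_perp0 U 1 k F (side_zero F Hz) Hz; rewrite scale1r addr0.
    - exact: (fr_perp0 F1).
  split=> //; have -> : z + z' = v1 - k *: u0 by rewrite v1E'; abelian.
  by apply: (ps_sub PS) => //; apply/(ps_perpZ PS)/(ps_sym PS).
rewrite a0 in Ev; rewrite e0 in Ew.
have [Pv Qz] := strip _ _ _ _ Hh Hh' Qv Ev.
have [Pw Qy] := strip _ _ _ _ Hp Hp' Qw Ew.
have P1 z z' : H z -> H1 z' -> Q (z + z') -> P u1 (z + z').
  by move=> Hz Hz' Qzz; apply: (ps_perpD PS) => //; [exact: (fr_Q1 U)|exact: (fr_Q F)|
    exact: (fr_Q F1)|exact: (fr_perp1 F)|exact: (fr_perp1 F1)].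
have Qr : Q (u1 + (h + h')).
  by apply: (ps_add PS) => //; [exact: (fr_Q1 U)|exact: P1].
have rE : u1 + (h + h') = 0 *: u0 + h + (u1 + h') by rewrite scale0r; abelian.
have yE : p + p' = 0 *: u0 + p + (0 *: u1 + p') by rewrite !scale0r; abelian.
have Qr' := Qr; rewrite rE in Qr'; have Qy' := Qy; rewrite yE in Qy'.
have := perp_form Hh Hh' Qr' Hp Hp' Qy'; rewrite -rE -yE mul0r addr0 => PE.
have -> : f v w = 0 + - b h' p - b h p'.
  by rewrite /f E Eq a0 e0 s0 mulr0 mul0r addr0.
rewrite -PE.
have vE : v = h + h' + c *: u0 by rewrite Ev scale0r; abelian.
have wE : w = p + p' + d *: u0 by rewrite Ew scale0r; abelian.
have zE : h + h' = v - c *: u0 by rewrite vE addrK.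
have yE' : p + p' = w - d *: u0 by rewrite wE addrK.
have P0 z k v1 : P u0 v1 -> v1 = z + k *: u0 -> Q z -> Q v1 -> P u0 z.
  move=> Pu v1E Qz1 Qv1; have zE' : z = v1 - k *: u0 by rewrite v1E addrK.
  rewrite zE'; apply: (ps_perpB PS); rewrite -?zE' //; first exact: (fr_Q0 U).
  exact/(ps_perpZ PS)/(ps_refl PS)/(fr_Q0 U).
have P0z := P0 _ _ _ Pv vE Qz Qv; have P0y := P0 _ _ _ Pw wE Qy Qw.
have step1 : P v w <-> P (h + h') w.
  split=> Pvw.
    rewrite zE; apply: (ps_perpBl PS); rewrite -?zE //; exact: (ps_perpZl PS).
  by rewrite vE; apply: (ps_perpDl PS); rewrite -?vE //; apply: (ps_perpZl PS).
have step2 : P (h + h') w <-> P (h + h') (p + p').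
  split=> Pvw.
    rewrite yE'; apply: (ps_perpB PS); rewrite -?yE' //.
    exact/(ps_perpZ PS)/(ps_sym PS).
  by rewrite wE; apply: (ps_perpD PS); rewrite -?wE //; apply/(ps_perpZ PS)/(ps_sym PS).
rewrite step1 step2; have P1y := P1 _ _ Hp Hp' Qy; have Q1 := fr_Q1 U.
split=> Pzy; first by apply: (ps_perpDl PS).
have zE2 : h + h' = u1 + (h + h') - u1 by abelian.
by rewrite zE2; apply: (ps_perpBl PS); rewrite -?zE2.
Qed.

End Form.
End Frame.

(** * Points and subspaces of PG(V) *)

Section PGPoints.
Variables (K : unitRingType) (V : lmodType K).
Hypothesis KF : GRing.field_axiom K.
Implicit Types (p q : pgpoint V) (u v w : V) (k : K).

Definition vsubspace (U : set V) :=
  [/\ U 0, forall v w, U v -> U w -> U (v + w) & forall k v, U v -> U (k *: v)].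

Lemma vsub0 U : vsubspace U -> U 0. Proof. by case. Qed.
Lemma vsubD U v w : vsubspace U -> U v -> U w -> U (v + w).
Proof. by case=> _ UD _; apply: UD. Qed.
Lemma vsubZ U k v : vsubspace U -> U v -> U (k *: v).
Proof. by case=> _ _; apply. Qed.
Lemma vsubN U v : vsubspace U -> U v -> U (- v).
Proof. by rewrite -scaleN1r => US; apply: vsubZ. Qed.
Lemma vsubB U v w : vsubspace U -> U v -> U w -> U (v - w).
Proof. by move=> US Uv /(vsubN US); apply: vsubD. Qed.

Definition pgof v (v0 : v != 0) : pgpoint V :=
  @PGPoint K V (range (fun k : K => k *: v)) (ex_intro2 _ _ v v0 erefl).

Lemma pgof_self v (v0 : v != 0) : pgset (pgof v0) v.
Proof. by exists 1; rewrite ?scale1r. Qed.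

Lemma pg_vsubspace p : vsubspace (pgset p).
Proof.
case: p => X [v v0 /= ->]; split.
- by exists 0; rewrite ?scale0r.
- by move=> _ _ [k _ <-] [l _ <-]; exists (k + l); rewrite ?scalerDl.
- by move=> l _ [k _ <-]; exists (l * k); rewrite ?scalerA.
Qed.

Lemma pg_vector p : exists2 v, v <> 0 & pgset p v.
Proof.
by case: p => X [v v0 /= ->]; exists v; [exact/eqP|exists 1; rewrite ?scale1r].
Qed.

Lemma pg_multiple p v w : v <> 0 -> pgset p v -> pgset p w -> exists k, w = k *: v.
Proof.
case: p => X [u u0 /= ->] v0 [k _ kv] [l _ <-]; exists (l * k^-1).
rewrite -kv scalerA mulrVK //; apply: (div_unit KF) => k0.
by apply: v0; rewrite -kv k0 scale0r.
Qed.

Lemma pg_inj p q : pgset p = pgset q -> p = q.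
Proof.
case: p q => [X Xp] [Y Yp] /= XY; move: Xp Yp; rewrite XY => Xp Yp.
by congr PGPoint; apply: Prop_irrelevance.
Qed.

Lemma pg_sub p v (U : set V) : vsubspace U -> v <> 0 -> pgset p v -> U v -> pgset p `<=` U.
Proof.
by move=> US v0 pv Uv w /(pg_multiple v0 pv) [k ->]; apply: vsubZ.
Qed.

Lemma pg_eq p q v : v <> 0 -> pgset p v -> pgset q v -> p = q.
Proof.
move=> v0 pv qv; apply: pg_inj; apply/seteqP; split.
  exact: (pg_sub (pg_vsubspace q) v0).
exact: (pg_sub (pg_vsubspace p) v0).
Qed.

Lemma pgof_sub v (v0 : v != 0) (U : set V) : vsubspace U -> U v -> pgset (pgof v0) `<=` U.
Proof. by move=> US Uv; apply: (pg_sub US (elimN eqP v0) (pgof_self v0)). Qed.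

Definition vjoin (A B : set V) : set V := [set u + v | u in A & v in B].

Lemma vjoin_vsubspace A B : vsubspace A -> vsubspace B -> vsubspace (vjoin A B).
Proof.
move=> AS BS; split.
- by exists 0; [exact: vsub0|exists 0; rewrite ?addr0 //; exact: vsub0].
- move=> _ _ [a Aa [b Bb <-]] [a' Aa' [b' Bb' <-]].
  by exists (a + a'); [exact: vsubD|exists (b + b'); [exact: vsubD|rewrite addrACA]].
- move=> k _ [a Aa [b Bb <-]].
  by exists (k *: a); [exact: vsubZ|exists (k *: b); [exact: vsubZ|rewrite scalerDr]].
Qed.

Lemma vjoinl A B v : vsubspace B -> A v -> vjoin A B v.
Proof. by move=> BS Av; exists v => //; exists 0; [exact: vsub0|rewrite addr0]. Qed.

Lemma vjoinr A B v : vsubspace A -> B v -> vjoin A B v.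
Proof. by move=> AS Bv; exists 0; [exact: vsub0|exists v; rewrite ?add0r]. Qed.

Lemma vjoin_sub A B U : vsubspace U -> A `<=` U -> B `<=` U -> vjoin A B `<=` U.
Proof. by move=> US AU BU _ [a /AU Ua [b /BU Ub <-]]; apply: vsubD. Qed.

(** Steinitz exchange: v and w are not proportional, so eliminating between their components
    recovers p and q. *)
Lemma pgjoin_exchange p q x y v w (U : set V) : x <> y -> pgjoin p q x ->
  pgjoin p q y -> pgset x v -> pgset y w -> v <> 0 -> w <> 0 -> vsubspace U -> U v -> U w ->
  vjoin (pgset p) (pgset q) `<=` U.
Proof.
move=> xy px py xv yw v0 w0 US Uv Uw.
have nprop k : w = k *: v -> False.
  move=> wE; apply: xy; apply: (pg_eq w0) => //.
  by rewrite wE; apply: vsubZ => //; exact: pg_vsubspace.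
have [a1 pa1 [b1 qb1 vE]] := px _ xv; have [a2 pa2 [b2 qb2 wE]] := py _ yw.
case: (pselect (a1 = 0)) => a10.
  have b10 : b1 <> 0 by move=> b10; apply: v0; rewrite -vE a10 b10 addr0.
  have qU : pgset q `<=` U.
    by apply: (pg_sub US b10) => //; move: Uv; rewrite -vE a10 add0r.
  have a20 : a2 <> 0.
    move=> a20; have [k kE] := pg_multiple b10 qb1 qb2; apply: (nprop k).
    by rewrite -wE -vE a10 a20 !add0r.
  apply: vjoin_sub => //; apply: (pg_sub US a20) => //.
  by have -> : a2 = w - b2; [rewrite -wE addrK|apply: vsubB => //; apply: qU].
have [k kE] := pg_multiple a10 pa1 pa2.
have cE : w - k *: v = b2 - k *: b1.
  by rewrite -wE -vE kE scalerDr; abelian.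
have c0 : b2 - k *: b1 <> 0.
  by rewrite -cE => /eqP; rewrite subr_eq0 => /eqP/nprop.
have qc : pgset q (b2 - k *: b1).
  by apply: vsubB => //; [|apply: vsubZ => //]; exact: pg_vsubspace.
have qU : pgset q `<=` U.
  apply: (pg_sub US c0) => //; rewrite -cE.
  by apply: vsubB => //; apply: vsubZ.
apply: vjoin_sub => //; apply: (pg_sub US a10) => //.
by have -> : a1 = v - b1; [rewrite -vE addrK|apply: vsubB => //; apply: qU].
Qed.

Lemma subspace_of_vsubspace (U : set V) : vsubspace U ->
  @subspace (PG V) [set p : pgpoint V | pgset p `<=` U].
Proof.
move=> US l [a [b [ab ->]]] p q pq lp lq /= pU qU r lr.
have [v v0 pv] := pg_vector p; have [w w0 qw] := pg_vector q.
move=> u /lr; apply: (pgjoin_exchange pq lp lq pv qw) => //.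
  exact: pU.
exact: qU.
Qed.

Lemma vsubspace_of_subspace (Y : set (pgpoint V)) : @subspace (PG V) Y ->
  vsubspace [set v | v = 0 \/ exists2 p, Y p & pgset p v].
Proof.
move=> YS; split; first by left.
- move=> v w [->|[p Yp pv]]; first by rewrite add0r.
  case=> [->|[q Yq qw]]; first by rewrite addr0; right; exists p.
  case: (pselect (v + w = 0)) => [->|/eqP vw0]; [by left | right].
  case: (pselect (p = q)) => [pq|pq].
    by exists p => //; apply: vsubD (pg_vsubspace p) _ _ => //; rewrite pq.
  exists (pgof vw0); last exact: pgof_self.
  have lpq : @line (PG V) (pgjoin p q) by exists p, q.
  have [pS qS] := (pg_vsubspace p, pg_vsubspace q).
  apply: (YS _ lpq p q pq) => //.
  + by move=> u; apply: vjoinl.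
  + by move=> u; apply: vjoinr.
  + apply: (@pgof_sub _ vw0 (vjoin (pgset p) (pgset q))).
      exact: vjoin_vsubspace.
    by exists v => //; exists w.
- move=> k v [->|[p Yp pv]]; first by left; rewrite scaler0.
  by right; exists p => //; apply: vsubZ => //; exact: pg_vsubspace.
Qed.

Lemma gen_sub_vsubspace (A : set (pgpoint V)) (U : set V) : vsubspace U ->
  (forall p, A p -> pgset p `<=` U) ->
  forall p, @gen (PG V) A p -> pgset p `<=` U.
Proof.
move=> US AU p /(_ [set p : pgpoint V | pgset p `<=` U]); apply; split=> //.
exact: subspace_of_vsubspace.
Qed.

(** Subspaces of PG(V) come from vector subspaces, so generation of the whole space can be tested on
    the latter. *)
Lemma gen_full (A : set (pgpoint V)) :
  (forall U : set V, vsubspace U -> (forall p, A p -> pgset p `<=` U) -> forall v, U v) ->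
  @gen (PG V) A = setT.
Proof.
move=> full; apply/seteqP; split=> // p _ Y [/= YS AY].
have := full _ (vsubspace_of_subspace YS) _.
have [v v0 pv] := pg_vector p => /(_ _ v) []; last 1 first.
- by case=> // q Yq qv; rewrite (pg_eq v0 pv qv).
- by move=> q Aq u qu; right; exists q => //; apply: AY.
- by move=> /v0.
Qed.

End PGPoints.

(** * The vectors of an embedded polar space *)

Section EmbeddedPolarSpace.
Variable S : geometry.
Hypothesis S_polar : polar_space S.
Hypothesis S_nondeg : non_degenerate S.
Variable e : embedding S.
Let K := emb_ring e.
Let V := emb_space e.
Let KF : GRing.field_axiom K := @emb_ringP S e.
Implicit Types (x y z : S) (u v w : V) (k : K) (X M N : set S) (U : set V).

Definition evec x : set V := pgset (emb_map e x).

Definition emb_vec : set V := [set v | exists x, evec x v].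

(** The zero vector counts as collinear with everything, since sums of representatives may
    vanish. *)
Definition emb_perp v w :=
  [\/ v = 0, w = 0 | exists x y, [/\ evec x v, evec y w & collinear x y]].

Lemma evec_vsubspace x : vsubspace (evec x).
Proof. exact: pg_vsubspace. Qed.

Lemma evec_vector x : exists2 v, v <> 0 & evec x v.
Proof. exact: pg_vector. Qed.

Lemma evec_eq x y v : v <> 0 -> evec x v -> evec y v -> x = y.
Proof. by move=> v0 xv yv; apply: (@emb_inj _ e); apply: (pg_eq KF v0 xv yv). Qed.

Lemma evec_sub x v U : vsubspace U -> v <> 0 -> evec x v -> U v -> evec x `<=` U.
Proof. exact: (pg_sub KF). Qed.

Lemma evec_multiple x v w : v <> 0 -> evec x v -> evec x w -> exists k, w = k *: v.
Proof. exact: (pg_multiple KF). Qed.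

Lemma collinear_sym x y : collinear x y -> collinear y x.
Proof.
by case=> [->|[l Ll [lx ly]]]; [left | right; exists l].
Qed.

Lemma collinear_line x y : collinear x y -> x <> y -> exists2 l, line l & l x /\ l y.
Proof. by case. Qed.

Lemma line_point l x y v w : line l -> l x -> l y -> evec x v -> evec y w ->
  v + w <> 0 -> exists2 z, l z & evec z (v + w).
Proof.
move=> Ll lx ly xv yw /eqP vw0; have [a [b [ab lE]]] := emb_full e Ll.
have lex x' : l x' -> pgjoin a b (emb_map e x').
  by move=> lx'; rewrite -[pgjoin a b]lE; exists x'.
have JS := vjoin_vsubspace (pg_vsubspace a) (pg_vsubspace b).
have : (emb_map e @` l) (pgof vw0).
  rewrite lE; apply: (@pgof_sub _ _ KF _ vw0 (vjoin (pgset a) (pgset b))) => //.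
  by apply: vsubD => //; [apply: (lex _ lx)|apply: (lex _ ly)].
by case=> z lz ez; exists z => //; rewrite /evec ez; apply: pgof_self.
Qed.

Lemma line_span l x y z v w U : line l -> l x -> l y -> l z -> x <> y ->
  evec x v -> evec y w -> v <> 0 -> w <> 0 -> vsubspace U -> U v -> U w ->
  evec z `<=` U.
Proof.
move=> Ll lx ly lz xy xv yw v0 w0 US Uv Uw; have [a [b [ab lE]]] := emb_full e Ll.
have lex x' : l x' -> pgjoin a b (emb_map e x').
  by move=> lx'; rewrite -[pgjoin a b]lE; exists x'.
move=> u zu; have exy : emb_map e x <> emb_map e y by move=> /(@emb_inj _ e).
by apply: (pgjoin_exchange KF exy (lex _ lx) (lex _ ly) xv yw v0 w0 US Uv Uw); apply: lex zu.
Qed.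

Lemma line_all x l y z : line l -> l y -> l z -> y <> z -> collinear x y ->
  collinear x z -> forall q, l q -> collinear x q.
Proof.
move=> Ll ly lz yz xy xz; case: (proj2 S_polar x l Ll) => // -[q [_ qu]].
by case: yz; rewrite -(qu y) // (qu z).
Qed.

Lemma line_meet x l : line l -> exists2 q, l q & collinear x q.
Proof.
move=> Ll; case: (proj2 S_polar x l Ll) => [[q [[lq xq] _]]|xl]; first by exists q.
(* When x is collinear with all of l, a point of l is still required; fullness of the embedding
   provides one. *)
have [a [b [ab lE]]] := emb_full e Ll.
have : (emb_map e @` l) a by rewrite lE => v; apply/vjoinl/pg_vsubspace.
by case=> q lq _; exists q => //; apply: xl.
Qed.

Lemma emb_perpE x y v w : v <> 0 -> w <> 0 -> evec x v -> evec y w ->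
  emb_perp v w -> collinear x y.
Proof.
move=> v0 w0 xv yw [//|//|[x' [y' [xv' yw' xy]]]].
by rewrite (evec_eq v0 xv xv') (evec_eq w0 yw yw').
Qed.

Lemma emb_perpI x y v w : evec x v -> evec y w -> collinear x y -> emb_perp v w.
Proof. by move=> xv yw xy; apply: Or33; exists x, y. Qed.

Lemma emb_polar_set : polar_set emb_vec emb_perp.
Proof.
have lineP v w : v <> 0 -> w <> 0 -> emb_perp v w -> exists x y,
    [/\ evec x v, evec y w & collinear x y].
  by move=> v0 w0 [].
split.
- by move=> k v [x xv]; exists x; apply: vsubZ => //; exact: evec_vsubspace.
- by move=> v; apply: Or32.
- move=> v w [->|->|[x [y [xv yw xy]]]]; [exact: Or32|exact: Or31|].
  by apply: Or33; exists y, x; split=> //; apply: collinear_sym.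
- move=> k v w [->|->|[x [y [xv yw xy]]]]; [exact: Or31|by apply: Or32; rewrite scaler0|].
  by apply: Or33; exists x, y; split=> //; apply: vsubZ => //; exact: evec_vsubspace.
- by move=> v [x xv]; apply: Or33; exists x, x; split=> //; left.
- move=> v w Qv Qw vw; case: (pselect (v = 0)) => [->|v0]; first by rewrite add0r.
  case: (pselect (w = 0)) => [->|w0]; first by rewrite addr0.
  have [x [y [xv yw xy]]] := lineP _ _ v0 w0 vw.
  case: (pselect (v + w = 0)) => [->|vw0].
    by exists x; apply: vsub0; exact: evec_vsubspace.
  case: (pselect (x = y)) => [xyE|xyN].
    by exists x; apply: vsubD; rewrite ?xyE //; [exact: evec_vsubspace|rewrite -xyE].
  have [l Ll [lx ly]] := collinear_line xy xyN.
  by have [z _ zvw] := line_point Ll lx ly xv yw vw0; exists z.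
- move=> a v w [p pa] Qv Qw vw av aw.
  case: (pselect (a = 0)) => [->|a0]; first exact: Or31.
  case: (pselect (v = 0)) => [->|v0]; first by rewrite add0r.
  case: (pselect (w = 0)) => [->|w0]; first by rewrite addr0.
  case: (pselect (v + w = 0)) => [->|vw0]; first exact: Or32.
  have [x [y [xv yw xy]]] := lineP _ _ v0 w0 vw.
  have px := emb_perpE a0 v0 pa xv av; have py := emb_perpE a0 w0 pa yw aw.
  case: (pselect (x = y)) => [xyE|xyN].
    apply: (emb_perpI pa _ px); apply: vsubD => //; first exact: evec_vsubspace.
    by rewrite xyE.
  have [l Ll [lx ly]] := collinear_line xy xyN.
  have [z lz zvw] := line_point Ll lx ly xv yw vw0.
  by apply: (emb_perpI pa zvw); apply: (line_all Ll lx ly xyN px py).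
- move=> a v w [p pa] Qv Qw vw av.
  case: (pselect (v = 0)) => [v0|v0]; first by case: av; rewrite v0; apply: Or32.
  case: (pselect (a = 0)) => [a0|a0]; first by case: av; rewrite a0; apply: Or31.
  case: (pselect (w = 0)) => [->|w0].
    by exists 0; rewrite scale0r addr0; apply: Or32.
  have [x [y [xv yw xy]]] := lineP _ _ v0 w0 vw.
  have px : ~ collinear p x by move=> px; apply: av; apply: (emb_perpI pa xv px).
  case: (pselect (x = y)) => [xyE|xyN].
    rewrite xyE in xv; have [k kE] := evec_multiple v0 xv yw.
    by exists (- k); rewrite kE scaleNr subrr; apply: Or32.
  have [l Ll [lx ly]] := collinear_line xy xyN.
  have [q lq pq] := line_meet p Ll; have [u u0 qu] := evec_vector q.
  pose U := vjoin (range (fun k : K => k *: v)) (range (fun k : K => k *: w)).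
  have /eqP v0' := v0; have /eqP w0' := w0.
  have [vS wS] := (pg_vsubspace (pgof v0'), pg_vsubspace (pgof w0')).
  have US : vsubspace U by apply: vjoin_vsubspace.
  have : U u.
    apply: (line_span Ll lx ly lq xyN xv yw v0 w0 US) => //.
      by apply: vjoinl => //; apply: (pgof_self v0').
    by apply: vjoinr => //; apply: (pgof_self w0').
  case=> _ [k _ <-] [_ [m _ <-] uE].
  (* Otherwise q would be x, which is not collinear with p. So u can be scaled to have coefficient 1
     at w. *)
  have m0 : m <> 0.
    move=> m0; have uE' : u = k *: v by rewrite -uE m0 scale0r addr0.
    apply: px; rewrite -(_ : q = x) //; apply: (evec_eq u0 qu); rewrite uE'.
    by apply: vsubZ => //; exact: evec_vsubspace.
  exists (m^-1 * k); apply: (emb_perpI pa _ pq).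
  have -> : w + (m^-1 * k) *: v = m^-1 *: u.
    by rewrite -uE scalerDr !scalerA mulVr ?scale1r 1?addrC //; apply: (div_unit KF).
  by apply: vsubZ => //; exact: evec_vsubspace.
- move=> v [x xv] vP; apply: contrapT => v0.
  have : perp (setT : set S) x.
    move=> y _; have [w w0 yw] := evec_vector y.
    apply: (emb_perpE w0 v0 yw xv).
    by case: (vP w); [exists y|exact: Or32|exact: Or31|move=> [p [q [pv qw pq]]];
      apply: (emb_perpI qw pv); apply: collinear_sym].
  by rewrite [perp _]S_nondeg.
Qed.

Let PS := emb_polar_set.

Definition vec_of X : set V := [set v | v = 0 \/ exists2 x, X x & evec x v].

Definition points_of U : set S := [set x | evec x `<=` U].

Definition isotropic U :=
  [/\ vsubspace U, U `<=` emb_vec & forall v w, U v -> U w -> emb_perp v w].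

Lemma vec_of_point X x v : v <> 0 -> evec x v -> vec_of X v -> X x.
Proof. by move=> v0 xv [//|[y Xy yv]]; rewrite (evec_eq v0 xv yv). Qed.

Lemma vec_ofI X x v : X x -> evec x v -> vec_of X v.
Proof. by move=> Xx xv; right; exists x. Qed.

Lemma evec_emb_vec x v : evec x v -> emb_vec v.
Proof. by exists x. Qed.

Lemma subspace_points_of U : vsubspace U -> subspace (points_of U).
Proof.
move=> US l Ll x y xy lx ly xU yU z lz.
have [v v0 xv] := evec_vector x; have [w w0 yw] := evec_vector y.
exact: (line_span Ll lx ly lz xy xv yw v0 w0 US (xU _ xv) (yU _ yw)).
Qed.

Lemma gen_points_of X U : vsubspace U -> X `<=` points_of U ->
  gen X `<=` points_of U.
Proof.
by move=> US XU x; apply; split=> //; apply: subspace_points_of.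
Qed.

Lemma vec_of_vsubspace X : subspace X ->
  (forall x y, X x -> X y -> collinear x y) -> vsubspace (vec_of X).
Proof.
move=> XS Xc; split; first by left.
- move=> v w [->|[x Xx xv]]; first by rewrite add0r.
  case=> [->|[y Xy yw]]; first by rewrite addr0; right; exists x.
  case: (pselect (v + w = 0)) => [->|vw0]; [by left|right].
  case: (pselect (x = y)) => [xyE|xyN].
    exists x => //; apply: vsubD => //; first exact: evec_vsubspace.
    by rewrite xyE.
  have [l Ll [lx ly]] := collinear_line (Xc _ _ Xx Xy) xyN.
  have [z lz zvw] := line_point Ll lx ly xv yw vw0.
  by exists z => //; apply: (XS _ Ll x y).
- move=> k v [->|[x Xx xv]]; first by rewrite scaler0; left.
  by right; exists x => //; apply: vsubZ => //; exact: evec_vsubspace.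
Qed.

Variable s0 : S.

Lemma emb_vec0 : emb_vec 0.
Proof. by exists s0; apply: vsub0; exact: evec_vsubspace. Qed.

Lemma vec_of_isotropic X : singular X -> isotropic (vec_of X).
Proof.
move=> [XS Xp]; have Xc x y : X x -> X y -> collinear x y.
  by move=> /Xp Xx Xy; apply/collinear_sym/Xx.
split; first exact: vec_of_vsubspace.
- by move=> v [->|[x _ xv]]; [exact: emb_vec0|exists x].
- move=> v w [->|[x Xx xv]]; first by move=> _; exact: Or31.
  case=> [->|[y Xy yw]]; first exact: Or32.
  exact: (emb_perpI xv yw (Xc _ _ Xx Xy)).
Qed.

Lemma singular_points_of U : isotropic U -> singular (points_of U).
Proof.
move=> [US UQ UP]; split; first exact: subspace_points_of.
move=> x xU y yU; have [v v0 xv] := evec_vector x; have [w w0 yw] := evec_vector y.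
exact: (emb_perpE w0 v0 yw xv (UP _ _ (yU _ yw) (xU _ xv))).
Qed.

Lemma vjoin_isotropic A B : isotropic A -> isotropic B ->
  (forall v w, A v -> B w -> emb_perp v w) -> isotropic (vjoin A B).
Proof.
move=> [AS AQ AP] [BS BQ BP] ABP; have JS := vjoin_vsubspace AS BS.
have JQ : vjoin A B `<=` emb_vec.
  move=> _ [a Aa [b Bb <-]]; apply: (ps_add PS); [exact: AQ|exact: BQ|exact: ABP].
split=> // v w Jv Jw.
have perpA a u : A a -> vjoin A B u -> emb_perp a u.
  move=> Aa Ju; case: (Ju) => a' Aa' [b' Bb' uE].
  rewrite -uE; apply: (ps_perpD PS); rewrite ?uE; do ?[exact: AQ|exact: BQ|exact: JQ].
    exact: AP.
  exact: ABP.
have perpB b u : B b -> vjoin A B u -> emb_perp b u.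
  move=> Bb Ju; case: (Ju) => a' Aa' [b' Bb' uE].
  rewrite -uE; apply: (ps_perpD PS); rewrite ?uE; do ?[exact: AQ|exact: BQ|exact: JQ].
    exact/(ps_sym PS)/ABP.
  exact: BP.
case: (Jv) => a Aa [b Bb vE]; rewrite -vE; apply: (ps_perpDl PS); rewrite ?vE;
  by [exact: JQ|exact: AQ|exact: BQ|exact: perpA|exact: perpB].
Qed.

Definition vspan1 v : set V := range (fun k : K => k *: v).

Lemma vspan1_self v : vspan1 v v.
Proof. by exists 1; rewrite ?scale1r. Qed.

Lemma vspan1_isotropic v : emb_vec v -> isotropic (vspan1 v).
Proof.
move=> Qv; split.
- split.
  + by exists 0; rewrite ?scale0r.
  + by move=> _ _ [k _ <-] [l _ <-]; exists (k + l); rewrite ?scalerDl.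
  + by move=> l _ [k _ <-]; exists (l * k); rewrite ?scalerA.
- by move=> _ [k _ <-]; apply: (ps_scale PS).
- move=> _ _ [k _ <-] [l _ <-].
  exact/(ps_perpZl PS)/(ps_perpZ PS)/(ps_refl PS).
Qed.

(** v and M together span an isotropic subspace, which by maximality is no larger than M. *)
Lemma generator_max M v : generator M -> emb_vec v ->
  (forall u, vec_of M u -> emb_perp v u) -> vec_of M v.
Proof.
move=> [Ms Mmax] Qv vM; case: (Qv) => x xv.
case: (pselect (v = 0)) => [v0|v0]; first by left.
have UI : isotropic (vjoin (vspan1 v) (vec_of M)).
  apply: vjoin_isotropic; [exact: vspan1_isotropic|exact: vec_of_isotropic|].
  by move=> _ w [k _ <-] Mw; apply/(ps_perpZl PS)/vM.
have [US _ _] := UI; have [LS _ _] := vspan1_isotropic Qv.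
have [MS _ _] := vec_of_isotropic Ms.
have ME := Mmax _ (singular_points_of UI) _.
right; exists x => //; rewrite -ME.
  by apply: (evec_sub US v0 xv); apply: vjoinl => //; apply: vspan1_self.
by move=> y My w yw; apply: vjoinr => //; apply: vec_ofI yw.
Qed.

Lemma generator_points_of U : isotropic U ->
  (forall v, emb_vec v -> (forall u, U u -> emb_perp v u) -> U v) ->
  generator (points_of U).
Proof.
move=> UI Umax; split; first exact: singular_points_of.
have [US UQ _] := UI.
move=> X Xs UX; apply/seteqP; split=> // x Xx v xv.
have [_ _ XP] := vec_of_isotropic Xs.
case: (pselect (v = 0)) => [->|v0]; first exact: vsub0.
apply: Umax; first by exists x.
move=> u Uu; apply: XP; first exact: vec_ofI xv.
case: (pselect (u = 0)) => [->|u0]; first by left.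
have [y yu] := UQ _ Uu; right; exists y => //.
by apply: UX; apply: (evec_sub US u0 yu).
Qed.

Lemma hyperplane_of_vec N M : singular M -> hyperplane_of N M ->
  exists v, [/\ vec_of M v, ~ vec_of N v & vec_of M = vjoin (vspan1 v) (vec_of N)].
Proof.
move=> Ms [NS [x [Mx Nx] ME]]; have [v v0 xv] := evec_vector x.
have NM : N `<=` M.
  by move=> y Ny; rewrite ME => Y [YS]; apply; right.
have Mv : vec_of M v by apply: vec_ofI xv.
have Mc y z : M y -> M z -> collinear y z.
  by move=> My Mz; apply: (proj2 Ms z Mz).
have NV : vsubspace (vec_of N).
  by apply: vec_of_vsubspace => // y z /NM My /NM Mz; apply: Mc.
have [LS _ _] := vspan1_isotropic (evec_emb_vec xv).
have [MS _ _] := vec_of_isotropic Ms.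
exists v; split=> //; first by move=> /(vec_of_point v0 xv).
apply/seteqP; split=> [u [->|[y My yu]]|].
- by apply: vsub0; apply: vjoin_vsubspace.
- have JS := vjoin_vsubspace LS NV.
  suff : points_of (vjoin (vspan1 v) (vec_of N)) y by apply.
  move: My; rewrite {1}ME; apply: gen_points_of => // z [->|Nz].
    by apply: (evec_sub JS v0 xv); apply: vjoinl => //; apply: vspan1_self.
  by move=> w zw; apply: vjoinr => //; apply: vec_ofI zw.
- apply: vjoin_sub => //; first by move=> _ [k _ <-]; apply: vsubZ.
  by move=> u [->|[y /NM My yu]]; [left|right; exists y].
Qed.

Lemma vec_of_points_of U : isotropic U -> vec_of (points_of U) = U.
Proof.
move=> [US UQ _]; apply/seteqP; split=> [v [->|[x xU xv]]|v Uv].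
- exact: vsub0.
- exact: xU.
- case: (pselect (v = 0)) => [->|v0]; first by left.
  have [x xv] := UQ _ Uv; right; exists x => //.
  exact: (evec_sub US v0 xv).
Qed.

Lemma points_of_vec_of X : subspace X ->
  (forall x y, X x -> X y -> collinear x y) -> points_of (vec_of X) = X.
Proof.
move=> XS Xc; apply/seteqP; split=> [x xX|x Xx v xv]; last exact: vec_ofI xv.
have [v v0 xv] := evec_vector x; exact: (vec_of_point v0 xv (xX _ xv)).
Qed.

Lemma points_of_hyperplane U v : isotropic U -> emb_vec v -> ~ U v ->
  (forall u, U u -> emb_perp v u) ->
  hyperplane_of (points_of U) (points_of (vjoin (vspan1 v) U)).
Proof.
move=> UI Qv Uv vU; have [US UQ UP] := UI; have [LS LQ LP] := vspan1_isotropic Qv.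
have JI : isotropic (vjoin (vspan1 v) U).
  apply: vjoin_isotropic => //.
  by move=> _ w [k _ <-] Uw; apply/(ps_perpZl PS)/vU.
have [JS JQ _] := JI.
have v0 : v <> 0 by move=> v0; apply: Uv; rewrite v0; apply: vsub0.
have Jv : vjoin (vspan1 v) U v by apply: vjoinl => //; apply: vspan1_self.
split; first exact: subspace_points_of.
have [x xv] := Qv; exists x.
  split; first exact: (evec_sub JS v0 xv).
  by move=> /(_ _ xv).
apply/seteqP; split=> [y yJ|y].
- move=> Y [YS XY]; have [w w0 yw] := evec_vector y.
  have Yx : Y x by apply: XY; left.
  have YU z : points_of U z -> Y z by move=> Uz; apply: XY; right.
  have [_ [k _ <-] [u Uu wE]] := yJ _ yw.
  case: (pselect (u = 0)) => [u0|u0].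
    have xw : evec x w.
      by rewrite -wE u0 addr0; apply: vsubZ => //; exact: evec_vsubspace.
    by rewrite (evec_eq w0 yw xw).
  have [z zu] := UQ _ Uu; have Uz : points_of U z by apply: (evec_sub US u0 zu).
  case: (pselect (k *: v = 0)) => [kv0|kv0].
    have zw : evec z w by rewrite -wE kv0 add0r.
    by rewrite (evec_eq w0 yw zw); apply: YU.
  have xz : x <> z by move=> xz; apply: Uv; apply: Uz; rewrite -xz.
  have [l Ll [lx lz]] := collinear_line (emb_perpE v0 u0 xv zu (vU _ Uu)) xz.
  have xkv : evec x (k *: v) by apply: vsubZ => //; exact: evec_vsubspace.
  have kvu0 : k *: v + u <> 0 by rewrite wE.
  have [q lq qw] := line_point Ll lx lz xkv zu kvu0.
  rewrite wE in qw; rewrite (evec_eq w0 yw qw).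
  by apply: (YS _ Ll x z) => //; apply: YU.
- apply: gen_points_of => // z [->|Uz]; first exact: (evec_sub JS v0 xv).
  by move=> w zw; apply: vjoinr => //; apply: Uz.
Qed.

End EmbeddedPolarSpace.

(** * Pairs of points from cardinality and rank *)

Lemma card_ge2I (T : Type) (A : set T) a b : a <> b -> A a -> A b -> `I_2 #<= A.
Proof.
move=> ab Aa Ab; pose f n := if n is 0 then a else b.
have fI : {in `I_2 &, injective f}.
  move=> [|[|m]] [|[|n]] //=; rewrite !inE //= => _ _ ?; by case: ab.
by rewrite -(card_le_eql (inj_card_eq fI)); apply: subset_card_le => _ [[|n] _ <-].
Qed.

Lemma card_ge2E (T : Type) (A : set T) :
  `I_2 #<= A -> exists a b, [/\ a <> b, A a & A b].
Proof.
move=> A2; apply: contrapT => nA.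
suff: `I_2 #<= `I_1 by rewrite card_le_II.
case: (pselect (exists a, A a)) => [[a Aa]|A0].
  apply: card_le_trans A2 _; rewrite -(card_le_eqr (@card_set1 _ a)).
  apply: subset_card_le => b Ab; apply: contrapT => ab; apply: nA.
  by exists a, b; split=> // E; apply: ab; rewrite E.
have E : A = set0 by apply/seteqP; split=> // x Ax; case: A0; exists x.
by move: A2; rewrite E card_le0 => /eqP/seteqP[/(_ 0%N) /(_ isT)].
Qed.

Lemma rank_ge2_line (S : geometry) : rank_ge S 2 ->
  exists l (p q : S), [/\ line l, p <> q, l p & l q].
Proof.
case=> X [Xs Xlt].
have X01 := Xlt 0%N isT; have [X12 X21] := Xlt 1%N isT.
have [p [X1p _]] : exists p, X 1%N p /\ ~ X 0%N p.
  by case: X01 => _ /existsNP[p /not_implyP]; exists p.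
have [q [X2q X1q]] : exists q, X 2%N q /\ ~ X 1%N q.
  by case/existsNP: X21 => q /not_implyP; exists q.
have pq : p <> q by move=> pq; apply: X1q; rewrite -pq.
have [_ X2p] := Xs 2%N isT.
case: (X2p q X2q p (X12 _ X1p)) => [//|[l Ll [lp lq]]].
by exists l, p, q.
Qed.

Section Span.
Variables (S : geometry) (e : embedding S).
Let KF := @emb_ringP S e.
Implicit Types (U : set (emb_space e)).

Lemma span_of_gen (X : set S) U : gen (emb_map e @` X) = setT -> vsubspace U ->
  (forall x, X x -> evec (e := e) x `<=` U) -> forall v, U v.
Proof.
move=> XT US XU v; case: (pselect (v = 0)) => [->|/eqP v0]; first exact: vsub0.
have : (setT : set (PG (emb_space e))) (pgof v0) by [].
rewrite -XT => /(gen_sub_vsubspace KF US); apply; last exact: pgof_self.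
by move=> _ [x Xx <-]; apply: XU.
Qed.

Lemma emb_vec_span U : vsubspace U -> @emb_vec _ e `<=` U -> forall v, U v.
Proof.
move=> US QU; apply: (@span_of_gen setT) => //; first exact: emb_span.
by move=> x _ v xv; apply: QU; exists x.
Qed.

End Span.

(** * Kernels of linear functionals as hyperplanes *)

Section Kernel.
Variables (K : unitRingType) (V : lmodType K).
Hypothesis KF : GRing.field_axiom K.
Variable g : V -> K.
Hypothesis gD : forall v w, g (v + w) = g v + g w.
Hypothesis gZ : forall k v, g (k *: v) = k * g v.

Lemma kernel_vsubspace : vsubspace [set v | g v = 0].
Proof.
split=> /=; first by rewrite -(scale0r (0 : V)) gZ mul0r.
- by move=> v w; rewrite gD => -> ->; rewrite addr0.
- by move=> k v; rewrite gZ => ->; rewrite mulr0.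
Qed.

Lemma kernel_hyperplane (H := [set p : pgpoint V | pgset p `<=` [set v | g v = 0]]) :
  @hyperplane_of (PG V) H setT \/ H = setT.
Proof.
case: (pselect (exists w, g w <> 0)) => [[w gw]|g0]; [left|right]; last first.
  apply/seteqP; split=> // p _ v _ /=; apply: contrapT => gv.
  by apply: g0; exists v.
have HS := subspace_of_vsubspace KF kernel_vsubspace; split; first exact: HS.
have w0 : w != 0.
  by apply/eqP => w0; apply: gw; rewrite w0; exact: vsub0 kernel_vsubspace.
exists (pgof w0); first by split=> // /(_ w (pgof_self w0)).
apply/esym/(gen_full KF) => U US UH v.
have Uw : U w by apply: (UH (pgof w0)); [left|exact: pgof_self].
pose k := g v * (g w)^-1.
have gk : g (v - k *: w) = 0.
  rewrite gD -scaleNr gZ mulNr /k mulrVK ?subrr //.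
  exact: (div_unit KF).
have -> : v = v - k *: w + k *: w by rewrite subrK.
apply: vsubD => //; last exact: vsubZ.
case: (pselect (v - k *: w = 0)) => [->|/eqP v0]; first exact: vsub0.
apply: (UH (pgof v0)); last exact: pgof_self.
by right; apply: (pgof_sub KF) => //; exact: kernel_vsubspace.
Qed.

End Kernel.

(** * Forward direction: the frame and the form of a tight embedding *)

Section TightForward.
Variable S : geometry.
Hypothesis S_polar : polar_space S.
Hypothesis S_nondeg : non_degenerate S.
Variable e : embedding S.
Let K := emb_ring e.
Let V := emb_space e.
Let KF : GRing.field_axiom K := @emb_ringP S e.
Implicit Types (x y z : S) (u v w : V) (k : K) (M N : set S).
Let PS := emb_polar_set S_polar S_nondeg e.
Let Q := @emb_vec S e.
Let P := @emb_perp S e.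

Variables (l0 : set S) (p0 q0 : S).
Hypothesis l0_line : line l0.
Hypothesis p0q0 : p0 <> q0.
Hypothesis l0p0 : l0 p0.
Hypothesis l0q0 : l0 q0.

(** Otherwise the point x of v would be collinear with itself only. But some point of the line l0 is
    collinear with x, hence is x, and then all of l0 reduces to x. *)
Lemma generator_not_point M v : generator M -> Q v ->
  vec_of (e := e) M `<=` vspan1 v -> v <> 0 -> False.
Proof.
move=> GM [x xv] Mv v0.
have only y : collinear x y -> y = x.
  move=> xy; have [w w0 yw] := evec_vector e y.
  have Mw : vec_of M w.
    apply: (generator_max S_polar S_nondeg p0 GM); first by exists y.
    move=> u /Mv[k _ <-]; apply/(ps_perpZ PS)/(emb_perpI yw xv).
    exact: collinear_sym.
  have [k _ kE] := Mv _ Mw; apply: (evec_eq w0 yw).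
  by rewrite -kE; apply: vsubZ => //; exact: evec_vsubspace.
have [q l0q xq] := line_meet S_polar e x l0_line.
rewrite (only _ xq) in l0q; apply: p0q0.
have l0x y : l0 y -> y = x by move=> l0y; apply: only; right; exists l0.
by rewrite (l0x _ l0p0) (l0x _ l0q0).
Qed.

Lemma generator_isotropic M : generator M -> isotropic (vec_of (e := e) M).
Proof. by move=> GM; apply: (vec_of_isotropic e p0 (proj1 GM)). Qed.

Lemma generator_nontrivial M : generator M -> exists v, vec_of (e := e) M v /\ v <> 0.
Proof.
move=> GM; apply: contrapT => nM.
have M0 v : vec_of M v -> v = 0 by move=> Mv; apply: contrapT => v0; apply: nM; exists v.
have [v v0 pv] := evec_vector e p0; apply: v0; apply: (M0).
apply: (generator_max S_polar S_nondeg p0 GM); first by exists p0.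
by move=> u /M0 ->; apply: (ps_perp0 PS).
Qed.

Lemma generator_split M w u v : generator M -> Q w -> vec_of M u -> ~ P w u ->
  vec_of M v -> exists k h, [/\ vec_of M h, P w h & v = k *: u + h].
Proof.
move=> GM Qw Mu wu Mv; have [MS MQ MP] := generator_isotropic GM.
have [k wk] := ps_meet PS Qw (MQ _ Mu) (MQ _ Mv) (MP _ _ Mu Mv) wu.
exists (- k), (v + k *: u); split=> //.
  by apply: vsubD => //; apply: vsubZ.
by rewrite scaleNr; abelian.
Qed.

Section TightPair.
Variables M M' : set S.
Hypothesis GM : generator M.
Hypothesis GM' : generator M'.
Hypothesis MM' : gen (emb_map e @` (M `|` M')) = setT.

Let MI := generator_isotropic GM.
Let MI' := generator_isotropic GM'.

Lemma tight_span v : vjoin (vec_of M) (vec_of M') v.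
Proof.
have [MS _ _] := MI; have [MS' _ _] := MI'.
apply: (span_of_gen MM'); first exact: vjoin_vsubspace.
move=> x [Mx|Mx] u xu; [apply: vjoinl => //|apply: vjoinr => //]; exact: vec_ofI xu.
Qed.

Lemma tight_disjoint v : vec_of M v -> vec_of M' v -> v = 0.
Proof.
move=> Mv M'v; have [MS MQ MP] := MI; have [MS' MQ' MP'] := MI'.
apply: (ps_nondeg PS); first exact: MQ.
move=> y Qy; have [m Mm [m' Mm' yE]] := tight_span y.
rewrite -yE; apply: (ps_perpD PS); rewrite ?yE //.
- exact: MQ.
- exact: MQ.
- exact: MQ'.
- exact: MP.
- exact: MP'.
Qed.

Section TightFrame.
Variables u0 u1 : V.
Hypothesis Mu0 : vec_of M u0.
Hypothesis Mu1 : vec_of M' u1.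
Hypothesis u01 : ~ P u0 u1.

Let H : set V := [set v | vec_of M v /\ P u1 v].
Let H1 : set V := [set v | vec_of M' v /\ P u0 v].

Let u10 : ~ P u1 u0. Proof. by move=> /(ps_sym PS). Qed.
Let Qu0 : Q u0. Proof. by have [_ MQ _] := MI; apply: MQ. Qed.
Let Qu1 : Q u1. Proof. by have [_ MQ _] := MI'; apply: MQ. Qed.

Lemma tight_frame_pair : frame_pair Q P u0 u1.
Proof. by split. Qed.

(** Stated for an arbitrary ordered pair of generators, so that it yields both sides of the frame.
    For the last clause: v is collinear with w' and B, which span M0', so it lies in M0' by
    maximality and in M0 by assumption. *)
Let side_of M0 M0' w w' : generator M0 -> generator M0' -> vec_of M0 w ->
  vec_of M0' w' -> ~ P w w' ->
  (forall v, vec_of M0 v -> vec_of M0' v -> v = 0) ->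
  let A := [set v | vec_of M0 v /\ P w' v] in
  let B := [set v | vec_of M0' v /\ P w v] in
  [/\ forall v w, A v -> A w -> A (v + w), forall k v, A v -> A (k *: v),
   forall v w, A v -> A w -> P v w, forall v, A v -> P w v &
   forall v, A v -> (forall u, B u -> P v u) -> v = 0].
Proof.
move=> G0 G0' Mw Mw' ww' M00 A B.
have [S0 Q0 P0] := generator_isotropic G0.
have [S0' Q0' P0'] := generator_isotropic G0'; split.
- move=> v x [Mv wv] [Mx wx]; have Mvx := vsubD S0 Mv Mx; split=> //.
  by apply: (ps_perpD PS) => //; [exact: Q0'|exact: Q0|exact: Q0|exact: Q0].
- by move=> k v [Mv wv]; split; [exact: vsubZ|exact: (ps_perpZ PS)].
- by move=> v x [Mv _] [Mx _]; apply: P0.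
- by move=> v [Mv _]; apply: P0.
- move=> v [Mv wv] vB; apply: M00 => //.
  apply: (generator_max S_polar S_nondeg p0 G0'); first exact: Q0.
  move=> x Mx; have [k [h [Mh wh xE]]] := generator_split G0' (Q0 _ Mw) Mw' ww' Mx.
  rewrite xE; apply: (ps_perpD PS); rewrite -?xE.
  + exact: Q0.
  + by apply: (ps_scale PS); apply: Q0'.
  + exact: Q0'.
  + exact: Q0'.
  + by apply: (ps_perpZ PS); apply: (ps_sym PS).
  + by apply: vB; split.
Qed.

Lemma tight_frame_side : frame_side Q P u0 u1 H H1.
Proof.
have [_ MQ _] := MI.
have [A1 A2 A3 A4 A5] := side_of GM GM' Mu0 Mu1 u01 tight_disjoint.
by split=> //; [move=> v [/MQ]|move=> v []].
Qed.

Lemma tight_frame_side1 : frame_side Q P u0 u1 H1 H.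
Proof.
have [_ MQ _] := MI'.
have M00 v : vec_of M' v -> vec_of M v -> v = 0 by move=> *; apply: tight_disjoint.
have [A1 A2 A3 A4 A5] := side_of GM' GM Mu1 Mu0 u10 M00.
by split=> //; [move=> v [/MQ]|move=> v []].
Qed.

Lemma tight_frame_span v : exists d p k p',
  [/\ H p, H1 p' & v = d *: u0 + p + (k *: u1 + p')].
Proof.
have [m Mm [m' Mm' vE]] := tight_span v.
have [d [p [Mp u1p mE]]] := generator_split GM Qu1 Mu0 u10 Mm.
have [k [p' [Mp' u0p mE']]] := generator_split GM' Qu0 Mu1 u01 Mm'.
by exists d, p, k, p'; rewrite -vE mE mE'.
Qed.

Lemma tight_frame_nontrivial : exists2 h, H h & h <> 0.
Proof.
apply: contrapT => nH.
have u00 : u0 <> 0 by move=> u00; apply: u01; rewrite u00; apply: ps_perp0l PS _.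
apply: (@generator_not_point M u0) => // v Mv.
have [d [p [Mp u1p ->]]] := generator_split GM Qu1 Mu0 u10 Mv.
have -> : p = 0 by apply: contrapT => p0'; apply: nH; exists p.
by exists d; rewrite ?addr0.
Qed.

Lemma tight_frame_generator : vec_of M = vjoin (vspan1 u0) H.
Proof.
have [MS _ _] := MI; apply/seteqP; split=> [v Mv|v].
  have [d [p [Mp u1p ->]]] := generator_split GM Qu1 Mu0 u10 Mv.
  by exists (d *: u0); [exists d|exists p].
by case=> _ [d _ <-] [p [Mp _] <-]; apply: vsubD => //; apply: vsubZ.
Qed.

End TightFrame.
End TightPair.

Lemma tight_form M M' : generator M -> generator M' ->
  gen (emb_map e @` (M `|` M')) = setT ->
  exists u0 u1, [/\ vec_of M u0, vec_of M' u1, ~ P u0 u1 & exists f : V -> V -> K,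
  [/\ forall u v w, f u (v + w) = f u v + f u w,
     forall u k v, f u (k *: v) = k * f u v,
     forall v w, f v w = 0 -> f w v = 0 &
     forall v w, Q v -> Q w -> (P v w <-> f v w = 0)]].
Proof.
move=> GM GM' MM'.
have [MS MQ MP] := generator_isotropic GM.
have [MS' MQ' MP'] := generator_isotropic GM'.
case: (pselect (exists u0 u1, [/\ vec_of (e := e) M u0, vec_of (e := e) M' u1, ~ P u0 u1 & Q (u0 + u1)])).
  move=> [u0 [u1 [Mu0 Mu1 u01 Q01]]]; exists u0, u1; split=> //.
  have U := tight_frame_pair GM GM' Mu0 Mu1 u01.
  have F := tight_frame_side GM GM' MM' Mu0 Mu1 u01.
  have F1 := tight_frame_side1 GM GM' MM' Mu0 Mu1 u01.
  have [h Hh h0] := tight_frame_nontrivial GM GM' Mu0 Mu1 u01.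
  have [s [r FF]] := third_point_form KF PS U F F1 Hh h0 Q01.
  exact: (reflexive_form KF PS U F F1 FF (tight_frame_span GM GM' MM' Mu0 Mu1 u01)).
move=> noQ.
(* Any non-collinear pair will do now, as [noQ] speaks of all vectors of M and M'. *)
have [u1 [Mu1 u10]] := generator_nontrivial GM'.
have [u0 Mu0 u01] : exists2 u0, vec_of (e := e) M u0 & ~ P u0 u1.
  apply: contrapT => nu; apply: u10; apply: (tight_disjoint GM GM' MM') => //.
  apply: (generator_max S_polar S_nondeg p0 GM); first exact: MQ'.
  by move=> u Mu; apply: contrapT => Pu; apply: nu; exists u => // /(ps_sym PS).
exists u0, u1; split=> //.
have U := tight_frame_pair GM GM' Mu0 Mu1 u01.
have F := tight_frame_side GM GM' MM' Mu0 Mu1 u01.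
have F1 := tight_frame_side1 GM GM' MM' Mu0 Mu1 u01.
have [h Hh h0] := tight_frame_nontrivial GM GM' Mu0 Mu1 u01.
have [|s [r FF]] := no_third_point_form KF PS U F F1 Hh h0.
  move=> c h1 d h1' [Mh1 _] [Mh1' _] Qs; apply: contrapT => np; apply: noQ.
  exists (c *: u0 + h1), (d *: u1 + h1'); split=> //.
    by apply: vsubD => //; apply: vsubZ.
  by apply: vsubD => //; apply: vsubZ.
exact: (reflexive_form KF PS U F F1 FF (tight_frame_span GM GM' MM' Mu0 Mu1 u01)).
Qed.

(** * Forward direction: the properties of the pair of sub-generators *)

Section TightStatement.
Variables M M' : set S.
Hypothesis GM : generator M.
Hypothesis GM' : generator M'.
Hypothesis MM' : gen (emb_map e @` (M `|` M')) = setT.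
Variables (u0 u1 : V) (f : V -> V -> K).
Hypothesis Mu0 : vec_of M u0.
Hypothesis Mu1 : vec_of M' u1.
Hypothesis u01 : ~ P u0 u1.
Hypothesis fD : forall u v w, f u (v + w) = f u v + f u w.
Hypothesis fZ : forall u k v, f u (k *: v) = k * f u v.
Hypothesis f_sym : forall v w, f v w = 0 -> f w v = 0.
Hypothesis fP : forall v w, Q v -> Q w -> (P v w <-> f v w = 0).

Let H : set V := [set v | vec_of M v /\ P u1 v].
Let H1 : set V := [set v | vec_of M' v /\ P u0 v].
Let U := tight_frame_pair GM GM' Mu0 Mu1 u01.
Let F : frame_side Q P u0 u1 H H1 := tight_frame_side GM GM' MM' Mu0 Mu1 u01.
Let F1 : frame_side Q P u0 u1 H1 H := tight_frame_side1 GM GM' MM' Mu0 Mu1 u01.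
Let span v : exists d p k p', [/\ H p, H1 p' & v = d *: u0 + p + (k *: u1 + p')] :=
  tight_frame_span GM GM' MM' Mu0 Mu1 u01 v.
Let L : set V := vjoin (vspan1 u0) (vspan1 u1).
Let N := points_of (e := e) H.
Let N' := points_of (e := e) H1.

Let Qu0 : Q u0 := fr_Q0 U.
Let Qu1 : Q u1 := fr_Q1 U.

Let H0 : H 0.
Proof. by have [MS _ _] := generator_isotropic GM; split; [exact: vsub0|exact: ps_perp0 PS _]. Qed.
Let H10 : H1 0.
Proof. by have [MS _ _] := generator_isotropic GM'; split; [exact: vsub0|exact: ps_perp0 PS _]. Qed.

Let HI : isotropic (e := e) H.
Proof.
split; [split; [exact: H0|exact: (fr_add F)|exact: (fr_scale F)]|exact: (fr_Q F)|exact: (fr_perp F)].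
Qed.
Let HI1 : isotropic (e := e) H1.
Proof.
split; [split; [exact: H10|exact: (fr_add F1)|exact: (fr_scale F1)]|exact: (fr_Q F1)|exact: (fr_perp F1)].
Qed.

Let HS : vsubspace H. Proof. by case: HI. Qed.
Let HS1 : vsubspace H1. Proof. by case: HI1. Qed.
Let LS0 : vsubspace (vspan1 u0). Proof. by have [] := vspan1_isotropic S_polar S_nondeg Qu0. Qed.
Let LS1 : vsubspace (vspan1 u1). Proof. by have [] := vspan1_isotropic S_polar S_nondeg Qu1. Qed.
Let LS : vsubspace L. Proof. exact: vjoin_vsubspace. Qed.

Definition form_perp (p q : pgpoint V) :=
  forall v w, pgset p v -> pgset q w -> f v w = 0.

Lemma form_perpE p q v w : v <> 0 -> w <> 0 -> pgset p v -> pgset q w ->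
  f v w = 0 -> form_perp p q.
Proof.
move=> v0 w0 pv qw fvw v' w' /(pg_multiple KF v0 pv)[k ->] /(pg_multiple KF w0 qw)[l ->].
by rewrite fZ [f (k *: v) w]f_sym ?mulr0 // fZ f_sym ?mulr0.
Qed.

Lemma form_quasi_polarity : @quasi_polarity_of S e form_perp.
Proof.
split.
- split=> [p|p q]; last first.
    by split=> pq v w pv qw; apply/f_sym/pq.
  have [v v0 pv] := pg_vector p.
  have -> : form_perp p = [set q | pgset q `<=` [set w | f v w = 0]].
    apply/seteqP; split=> [q pq w qw|q qK]; first exact: pq.
    have [w w0 qw] := pg_vector q.
    exact: (form_perpE v0 w0 pv qw (qK _ qw)).
  exact: (kernel_hyperplane KF (fD v) (fZ v)).
- move=> x v w xv xw; apply/fP; [by exists x|by exists x|].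
  by apply: (emb_perpI xv xw); left.
- move=> x y; have [v v0 xv] := evec_vector e x; have [w w0 yw] := evec_vector e y.
  have Qv : Q v by exists x.
  have Qw : Q w by exists y.
  split=> [xy|xy].
    by apply: (form_perpE v0 w0 xv yw); apply/fP => //; apply: (emb_perpI xv yw).
  by apply: (emb_perpE v0 w0 xv yw); apply/fP => //; apply: xy.
Qed.

Let in_perp X x v : evec x v -> v <> 0 ->
  perp X x <-> forall w, vec_of X w -> P v w.
Proof.
move=> xv v0; split=> [xX w [->|[y Xy yw]]|vX y Xy]; first exact: ps_perp0 PS _.
  by apply: (emb_perpI xv yw); apply: collinear_sym; apply: xX.
have [w w0 yw] := evec_vector e y.
by apply/collinear_sym/(emb_perpE v0 w0 xv yw)/vX; right; exists y.
Qed.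

Let sub_gen M0 w A : generator M0 -> isotropic (e := e) A -> Q w -> ~ A w ->
  (forall u, A u -> P w u) -> vec_of M0 = vjoin (vspan1 w) A ->
  sub_generator (points_of (e := e) A).
Proof.
move=> GM0 AI Qw Aw wA ME; split; first exact: singular_points_of.
exists M0 => //; have -> : M0 = points_of (vjoin (vspan1 w) A).
  rewrite -ME points_of_vec_of //; first by case: GM0 => -[].
  by move=> x y Mx My; have [[_ Mp] _] := GM0; apply: (Mp y My).
exact: points_of_hyperplane.
Qed.

Let sub_generators : sub_generator N /\ sub_generator N'.
Proof.
have u10 : ~ P u1 u0 by move=> /(ps_sym PS).
have nH : ~ H u0 by move=> [].
have nH1 : ~ H1 u1 by move=> [].
have ME := tight_frame_generator GM GM' Mu0 Mu1 u01.
have ME' := tight_frame_generator GM' GM Mu1 Mu0 u10.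
by split; [exact: (sub_gen GM HI Qu0 nH (fr_perp0 F) ME)
  |exact: (sub_gen GM' HI1 Qu1 nH1 (fr_perp1 F1) ME')].
Qed.

Let vN : vec_of N = H. Proof. exact: vec_of_points_of. Qed.
Let vN' : vec_of N' = H1. Proof. exact: vec_of_points_of. Qed.

Let opposite_N : opposite N N'.
Proof.
split; apply/seteqP; split=> // x [xN xN'].
- have [v v0 xv] := evec_vector e x; apply: (v0).
  have Hv : H1 v by apply: xN'.
  apply: (fr_nondeg F1) => // w Hw.
  by apply: (proj1 (in_perp N xv v0) xN); rewrite vN.
- have [v v0 xv] := evec_vector e x; apply: (v0).
  have Hv : H v by apply: xN'.
  apply: (fr_nondeg F) => // w Hw.
  by apply: (proj1 (in_perp N' xv v0) xN); rewrite vN'.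
Qed.

Let disjoint_N x : N x -> N' x -> False.
Proof.
move=> Nx N'x; have [v v0 xv] := evec_vector e x; apply: (v0).
apply: (fr_nondeg F); first exact: Nx.
by move=> w Hw; apply: (fr_perp F1) => //; apply: N'x.
Qed.

(* The point <d u0 + p + (k u1 + p')> is collinear with H1 iff p is. *)
Let perp_N x : perp (N `|` N') x <-> evec x `<=` L.
Proof.
have [v v0 xv] := evec_vector e x; have Qv : Q v by exists x.
have PH w : perp (N `|` N') x -> H w \/ H1 w -> P v w.
  move=> xN Hw; apply: (proj1 (in_perp (N `|` N') xv v0) xN).
  have [] : vec_of N w \/ vec_of N' w by rewrite vN vN'.
    by case=> [->|[y Ny yw]]; [left|right; exists y => //; left].
  by case=> [->|[y Ny yw]]; [left|right; exists y => //; right].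
split=> [xN|xL].
- apply: (evec_sub LS v0 xv).
  have [d [p [k [p' [Hp Hp' vE]]]]] := span v.
  have p0' : p = 0.
    apply: (fr_nondeg F) => // w Hw; apply/fP; [exact: (fr_Q F)|exact: (fr_Q F1)|].
    have : f w v = 0 by apply/f_sym/fP => //; [exact: (fr_Q F1)|apply: PH => //; right].
    rewrite vE !fD !fZ.
    have -> : f w u0 = 0 by apply/f_sym/fP => //; [exact: (fr_Q F1)|exact: (fr_perp0 F1)].
    have -> : f w u1 = 0 by apply/f_sym/fP => //; [exact: (fr_Q F1)|exact: (fr_perp1 F1)].
    have -> : f w p' = 0 by apply/fP; [exact: (fr_Q F1)|exact: (fr_Q F1)|exact: (fr_perp F1)].
    by rewrite !mulr0 !addr0 add0r => /f_sym.
  have p0'' : p' = 0.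
    apply: (fr_nondeg F1) => // w Hw; apply/fP; [exact: (fr_Q F1)|exact: (fr_Q F)|].
    have : f w v = 0 by apply/f_sym/fP => //; [exact: (fr_Q F)|apply: PH => //; left].
    rewrite vE !fD !fZ.
    have -> : f w u0 = 0 by apply/f_sym/fP => //; [exact: (fr_Q F)|exact: (fr_perp0 F)].
    have -> : f w u1 = 0 by apply/f_sym/fP => //; [exact: (fr_Q F)|exact: (fr_perp1 F)].
    have -> : f w p = 0 by apply/fP; [exact: (fr_Q F)|exact: (fr_Q F)|exact: (fr_perp F)].
    by rewrite !mulr0 !add0r => /f_sym.
  rewrite vE p0' p0'' !addr0; exists (d *: u0); first by exists d.
  by exists (k *: u1) => //; exists k.
- apply/(in_perp (N `|` N') xv v0) => w Nw.
  have Hw : H w \/ H1 w.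
    case: Nw => [->|[y [Ny|Ny] yw]]; [by left; exact: H0|left; exact: Ny|right; exact: Ny].
  have Qw : Q w by case: Hw => [/(fr_Q F)|/(fr_Q F1)].
  apply/fP => //; have [_ [k _ <-] [_ [l _ <-] <-]] := xL _ xv.
  apply: f_sym; rewrite fD !fZ.
  have -> : f w u0 = 0.
    by apply/f_sym/fP => //; case: Hw => [/(fr_perp0 F)|/(fr_perp0 F1)].
  have -> : f w u1 = 0.
    by apply/f_sym/fP => //; case: Hw => [/(fr_perp1 F)|/(fr_perp1 F1)].
  by rewrite !mulr0 addr0.
Qed.

Let u0_neq0 : u0 <> 0.
Proof. by move=> u00; apply: u01; rewrite u00; apply: ps_perp0l PS _. Qed.
Let u1_neq0 : u1 <> 0.
Proof. by move=> u00; apply: u01; rewrite u00; apply: ps_perp0 PS _. Qed.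

(** N and N' lie in {a, b}^perp, so {a, b}^perp^perp lies in {N, N'}^perp. Conversely, by exchange,
    a and b span the line L, so whatever is collinear with both is orthogonal to all of L. *)
Let perp_minimal_N : perp_minimal N N'.
Proof.
right=> a b aN bN ab.
have perpab : perp (N `|` N') `<=` perp (perp [set a; b]).
  move=> y yN z zab; have [w w0 zw] := evec_vector e z.
  have [v v0 yv] := evec_vector e y; have Qw : Q w by exists z.
  have Qv : Q v by exists y.
  apply: (emb_perpE w0 v0 zw yv); apply/fP => //.
  have [va va0 av] := evec_vector e a; have [vb vb0 bv] := evec_vector e b.
  have KS := kernel_vsubspace (fD w) (fZ w).
  have wa : f w va = 0.
    apply/fP => //; first by exists a.
    by apply: (emb_perpI zw av); apply/collinear_sym/zab; left.
  have wb : f w vb = 0.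
    apply/fP => //; first by exists b.
    by apply: (emb_perpI zw bv); apply/collinear_sym/zab; right.
  have /eqP u0' := u0_neq0; have /eqP u1' := u1_neq0.
  have eab : emb_map e a <> emb_map e b.
    by move=> /(@emb_inj _ e) abE; apply: ab; rewrite abE; left.
  have aL : pgjoin (pgof u0') (pgof u1') (emb_map e a) by apply/perp_N.
  have bL : pgjoin (pgof u0') (pgof u1') (emb_map e b) by apply/perp_N.
  apply: (pgjoin_exchange KF eab aL bL av bv va0 vb0 KS wa wb).
  by have := proj1 (perp_N y) yN; apply.
apply/seteqP; split=> [y /perpab yab Y [_]|]; first by apply; right.
move=> y /(gen_points_of LS) yL; apply/perp_N; apply: yL => z [[Nz N'z]|zab].
  by have := disjoint_N Nz N'z.
apply/perp_N => n Nn; apply: zab => q [->|->]; apply: collinear_sym; [exact: aN|exact: bN].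
Qed.

Let points : exists x y, [/\ evec x u0, evec y u1 & x <> y].
Proof.
have [[x xu] [y yu]] := (Qu0, Qu1); exists x, y; split=> // xy.
by apply: u01; apply: (emb_perpI xu yu); rewrite xy; left.
Qed.

Let in_L0 : L u0. Proof. by apply: vjoinl => //; exact: vspan1_self. Qed.
Let in_L1 : L u1. Proof. by apply: vjoinr => //; exact: vspan1_self. Qed.

Let card_N : (`I_2 #<= perp (N `|` N')).
Proof.
have [x [y [xu yu xy]]] := points; apply: (card_ge2I xy); apply/perp_N.
  exact: (evec_sub LS u0_neq0 xu).
exact: (evec_sub LS u1_neq0 yu).
Qed.

(** No point of the span of N and N' lies on L, by independence of the frame; so the right-hand side
    is all of PG(V), and u0 and u1 complete the left-hand side to PG(V). *)
Let optimal_N : optimally_embeddable (gen (N `|` N')).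
Proof.
exists e, form_perp; split; first exact: form_quasi_polarity.
have JS : vsubspace (vjoin H H1) by apply: vjoin_vsubspace.
have XJ : gen (N `|` N') `<=` points_of (vjoin H H1).
  apply: (gen_points_of JS) => x [Nx|Nx] v xv.
    by apply: vjoinl => //; apply: Nx.
  by apply: vjoinr => //; apply: Nx.
have NX : N `|` N' `<=` gen (N `|` N') by move=> x Nx Y [_]; apply.
have [x [y [xu yu xy]]] := points.
have -> : gen (N `|` N') `&` perp (gen (N `|` N')) = set0.
  apply/seteqP; split=> // z [/XJ zJ zX]; have [v v0 zv] := evec_vector e z.
  have zN : perp (N `|` N') z by move=> n /NX; apply: zX.
  have [p Hp [p' Hp' vE]] := zJ _ zv.
  have [_ [k _ <-] [_ [l _ <-] vE']] := proj1 (perp_N z) zN _ zv.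
  have HNp := side_oppr F Hp; have HNp' := side_oppr F1 Hp'.
  have [|k0 _ l0' _] := frame_free KF PS U F F1 (d := k) (e := l) HNp HNp'.
    have -> : k *: u0 - p + (l *: u1 - p') = (k *: u0 + l *: u1) - (p + p').
      by abelian.
    by rewrite vE vE' subrr.
  by apply: v0; rewrite -vE' k0 l0' !scale0r addr0.
rewrite image_set0; transitivity (setT : set (PG V)); last first.
  by apply/seteqP; split=> // q _ z [].
apply: (gen_full KF) => W WS WX v.
have WN z n : (N `|` N') z -> evec z n -> W n.
  by move=> Nz zn; apply: (WX (emb_map e z)) => //; left; exists z => //; apply: NX.
have WH p : H p -> W p.
  move=> Hp; case: (pselect (p = 0)) => [->|p0']; first exact: vsub0.
  have [z zp] := fr_Q F Hp; apply: (WN z) => //; left.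
  exact: (evec_sub HS p0' zp).
have WH1 p : H1 p -> W p.
  move=> Hp; case: (pselect (p = 0)) => [->|p0']; first exact: vsub0.
  have [z zp] := fr_Q F1 Hp; apply: (WN z) => //; right.
  exact: (evec_sub HS1 p0' zp).
have Wu z u : u <> 0 -> evec z u -> Q u -> (forall p, H p \/ H1 p -> P u p) -> W u.
  move=> u0' zu Qu uH; apply: (WX (emb_map e z)) => //; right=> _ [y' /XJ y'J <-].
  move=> w1 w2 y'w1 zw2; have [k ->] := evec_multiple u0' zu zw2; rewrite fZ.
  have [p Hp [p' Hp' <-]] := y'J _ y'w1; rewrite f_sym ?mulr0 // fD.
  have -> : f u p = 0 by apply/fP => //; [exact: (fr_Q F)|apply: uH; left].
  have -> : f u p' = 0 by apply/fP => //; [exact: (fr_Q F1)|apply: uH; right].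
  by rewrite addr0.
have Wu0 : W u0.
  by apply: (Wu x) => // p [/(fr_perp0 F)|/(fr_perp0 F1)].
have Wu1 : W u1.
  by apply: (Wu y) => // p [/(fr_perp1 F)|/(fr_perp1 F1)].
have [d [p [k [p' [Hp Hp' ->]]]]] := span v.
apply: vsubD => //; apply: vsubD => //; do ?[exact: vsubZ|exact: WH|exact: WH1].
Qed.

Lemma tight_statement : exists N N' : set S,
    [/\ sub_generator N /\ sub_generator N',
        opposite N N',
        perp_minimal N N',
        `I_2 #<= perp (N `|` N') &
        optimally_embeddable (gen (N `|` N'))].
Proof. by exists N, N'. Qed.

End TightStatement.

End TightForward.

(** * Quotient spaces *)

(** Bundled with its proof, so that the quotient type and its module structure depend on one
    term. *)
Record vsub (K : unitRingType) (V : lmodType K) := VSub {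
  vsub_set :> set V;
  vsub_vsubspace : vsubspace vsub_set }.

Section Quotient.
Variables (K : unitRingType) (V : lmodType K) (R : vsub V).
Let RS := vsub_vsubspace R.
Implicit Types (u v w : V).

(** A representative of the coset of v. It depends on the coset alone because [xget] gives equal
    values on equal sets; v itself is a candidate, so the default is not reached. *)
Definition qrep v : V := xget 0 [set w | vsub_set R (v - w)].

Lemma qrepP v : vsub_set R (v - qrep v).
Proof.
apply: (@xgetPex _ 0 [set w | vsub_set R (v - w)]).
by exists v; rewrite /= subrr; apply: vsub0.
Qed.

Lemma qrep_eq v w : vsub_set R (v - w) -> qrep v = qrep w.
Proof.
move=> vw; congr (xget 0 _); apply/seteqP; split=> u /= Ru.
  have -> : w - u = (v - u) - (v - w) by abelian.
  exact: vsubB.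
have -> : v - u = (v - w) + (w - u) by abelian.
exact: vsubD.
Qed.

Lemma qrep_id v : qrep (qrep v) = qrep v.
Proof.
by apply/qrep_eq; rewrite -opprB; apply: vsubN => //; apply: qrepP.
Qed.

(** Cosets are encoded by their chosen representatives; the boolean condition makes this a subtype,
    which inherits the choice structure of V. *)
Record quot := Quot { qval : V; qval_rep : `[< qrep qval = qval >] }.

HB.instance Definition _ := [isSub for qval].
HB.instance Definition _ := [Choice of quot by <:].

Definition qproj v : quot := Quot (asboolT (qrep_id v)).

Lemma qprojK (x : quot) : qproj (qval x) = x.
Proof. by apply: val_inj => /=; case: x => v /= /asboolP. Qed.

Lemma qproj_eq v w : qproj v = qproj w <-> vsub_set R (v - w).
Proof.
split=> [/(congr1 qval) /= vw|/qrep_eq vw]; last exact: val_inj.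
have -> : v - w = (v - qrep v) - (w - qrep w) by rewrite vw; abelian.
by apply: vsubB => //; apply: qrepP.
Qed.

Let qadd (x y : quot) := qproj (qval x + qval y).
Let qopp (x : quot) := qproj (- qval x).
Let qscale k (x : quot) := qproj (k *: qval x).

Let qaddE v w : qadd (qproj v) (qproj w) = qproj (v + w).
Proof.
apply/qproj_eq => /=.
have -> : qrep v + qrep w - (v + w) = - ((v - qrep v) + (w - qrep w)) by abelian.
by apply: vsubN => //; apply: vsubD => //; apply: qrepP.
Qed.

Let qoppE v : qopp (qproj v) = qproj (- v).
Proof.
apply/qproj_eq => /=; have -> : - qrep v - - v = v - qrep v by abelian.
exact: qrepP.
Qed.

Let qscaleE k v : qscale k (qproj v) = qproj (k *: v).
Proof.
apply/qproj_eq => /=; rewrite -scalerBr; apply: vsubZ => //.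
by rewrite -opprB; apply: vsubN => //; apply: qrepP.
Qed.

Let qaddA : associative qadd.
Proof.
by move=> x y z; rewrite -(qprojK x) -(qprojK y) -(qprojK z) !qaddE addrA.
Qed.
Let qaddC : commutative qadd.
Proof. by move=> x y; rewrite -(qprojK x) -(qprojK y) !qaddE addrC. Qed.
Let qadd0 : left_id (qproj 0) qadd.
Proof. by move=> x; rewrite -(qprojK x) qaddE add0r. Qed.
Let qaddN : left_inverse (qproj 0) qopp qadd.
Proof. by move=> x; rewrite -(qprojK x) qoppE qaddE addNr. Qed.

HB.instance Definition _ := GRing.isZmodule.Build quot qaddA qaddC qadd0 qaddN.

Let qscaleA a b (x : quot) : qscale a (qscale b x) = qscale (a * b) x.
Proof. by rewrite -(qprojK x) !qscaleE scalerA. Qed.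
Let qscale1 : left_id 1 qscale.
Proof. by move=> x; rewrite -(qprojK x) qscaleE scale1r. Qed.
Let qscaleDr : right_distributive qscale +%R.
Proof.
move=> a x y; rewrite -(qprojK x) -(qprojK y); rewrite /GRing.add /= qaddE !qscaleE.
by rewrite qaddE scalerDr.
Qed.
Let qscaleDl (x : quot) : {morph qscale^~ x : a b / a + b}.
Proof.
move=> a b; rewrite -(qprojK x) !qscaleE [RHS]/GRing.add /= qaddE.
by rewrite scalerDl.
Qed.

HB.instance Definition _ :=
  GRing.Zmodule_isLmodule.Build K quot qscaleA qscale1 qscaleDr qscaleDl.

Lemma qprojD v w : qproj (v + w) = qproj v + qproj w.
Proof. by rewrite -qaddE. Qed.

Lemma qprojZ k v : qproj (k *: v) = k *: qproj v.
Proof. by rewrite -qscaleE. Qed.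

Lemma qproj0 : qproj 0 = 0. Proof. by []. Qed.

Lemma qproj_eq0 v : qproj v = 0 <-> vsub_set R v.
Proof. by rewrite -[X in _ <-> vsub_set R X]subr0; apply: qproj_eq. Qed.

End Quotient.

(** * Embeddings in a quotient by a subspace that separates the points *)

Section QuotientEmbedding.
Variable S : geometry.
Variable e : embedding S.
Let K := emb_ring e.
Let V := emb_space e.
Let KF : GRing.field_axiom K := @emb_ringP S e.
Variable R : vsub V.
Hypothesis R_vec : forall x v, evec x v -> vsub_set R v -> v = 0.
Hypothesis R_inj : forall x y (v w : V), evec x v -> evec y w -> v <> 0 ->
  vsub_set R (v - w) -> x = y.
Implicit Types (x y z : S) (u v w : V) (k : K).
Local Notation W := (quot R).

Lemma qemb_set x : exists2 q : W, q != 0 &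
  (@qproj _ _ R) @` evec x = range (fun k : K => k *: q).
Proof.
have [v v0 xv] := evec_vector e x; exists (qproj R v).
  by apply/eqP => /qproj_eq0/(R_vec xv).
apply/seteqP; split=> [_ [w xw <-]|_ [k _ <-]].
  by have [k ->] := evec_multiple v0 xv xw; exists k => //; rewrite qprojZ.
exists (k *: v); last exact: qprojZ.
by apply: vsubZ => //; exact: evec_vsubspace.
Qed.

Definition qemb_map x : PG W := PGPoint (qemb_set x).

Lemma qemb_inj : injective qemb_map.
Proof.
move=> x y /(congr1 (@pgset _ _)) /= xy; have [v v0 xv] := evec_vector e x.
have : (@qproj _ _ R @` evec x) (qproj R v) by exists v.
by rewrite xy => -[w yw /esym/qproj_eq]; apply: R_inj.
Qed.

Lemma qemb_vsubspace (U : set W) : vsubspace U ->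
  vsubspace [set v : V | U (qproj R v)].
Proof.
move=> US; split=> /= [|v w|k v].
- by rewrite qproj0; apply: vsub0.
- by rewrite qprojD; apply: vsubD.
- by rewrite qprojZ; apply: vsubZ.
Qed.

Lemma qemb_full (l : set S) : line l -> @line (PG W) (qemb_map @` l).
Proof.
move=> Ll; have [a [b [ab lE]]] := emb_full e Ll.
have el z : l z -> pgjoin a b (emb_map e z) by move=> lz; rewrite -[pgjoin a b]lE; exists z.
have [x lx xa] : (emb_map e @` l) a by rewrite lE => v; apply/vjoinl/pg_vsubspace.
have [y ly yb] : (emb_map e @` l) b by rewrite lE => v; apply/vjoinr/pg_vsubspace.
have xy : x <> y by move=> xy; apply: ab; rewrite -xa -yb xy.
exists (qemb_map x), (qemb_map y); split; first by move=> /qemb_inj.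
have [v v0 xv] := evec_vector e x; have [w w0 yw] := evec_vector e y.
apply/seteqP; split=> [_ [z lz <-]|q qxy].
  have JS := vjoin_vsubspace (pg_vsubspace (qemb_map x)) (pg_vsubspace (qemb_map y)).
  have := @line_span _ e l x y z v w _ Ll lx ly lz xy xv yw v0 w0 (qemb_vsubspace JS).
  move=> zJ _ [u zu <-]; apply: zJ zu.
    by apply: vjoinl; [exact: pg_vsubspace|exists v].
  by apply: vjoinr; [exact: pg_vsubspace|exists w].
have [t t0 qt] := pg_vector q.
have [_ [v1 xv1 <-] [_ [w1 yw1 <-] tE]] := qxy _ qt.
have vw0 : v1 + w1 <> 0.
  by move=> vw0; apply: t0; rewrite -tE -qprojD vw0 qproj0.
have [z lz zvw] := line_point Ll lx ly xv1 yw1 vw0; exists z => //.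
apply: (pg_eq KF t0) => //; exists (v1 + w1) => //; by rewrite qprojD.
Qed.

Lemma qemb_gen (X : set S) :
  (forall U : set V, vsubspace U -> vsub_set R `<=` U ->
    (forall x, X x -> evec x `<=` U) -> forall v, U v) ->
  @gen (PG W) (qemb_map @` X) = setT.
Proof.
move=> full; apply: (gen_full KF) => U US XU q.
rewrite -(qprojK q); apply: (full _ (qemb_vsubspace US)).
  by move=> v /qproj_eq0 /= ->; apply: vsub0.
by move=> x Xx v xv /=; apply: (XU (qemb_map x)); [exists x|exists v].
Qed.

Lemma qemb_span : @gen (PG W) (range qemb_map) = setT.
Proof.
apply: qemb_gen => U US _ XU; apply: (emb_vec_span US) => v [x xv].
exact: (XU x).
Qed.

Definition quotient_embedding : embedding S :=
  @Embedding S K KF W qemb_map qemb_inj qemb_full qemb_span.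

End QuotientEmbedding.

(** * Tight embeddings from sub-generators *)

Section Generation.
Variables (K : unitRingType) (V : lmodType K) (Q : set V) (P : V -> V -> Prop).
Hypothesis PS : polar_set Q P.

(** Y contains what is collinear with a or with b: a line through a and x meets b^perp within {a,
    b}^perp, and symmetrically. *)
Lemma generated_by_opposite a b z z' (Y : set V) : Q a -> Q b -> ~ P a b ->
  Q z -> Q z' -> P a z -> P b z -> P a z' -> P b z' -> ~ P z z' ->
  vsubspace Y -> Y a -> Y b -> (forall x, Q x -> P a x -> P b x -> Y x) ->
  Q `<=` Y.
Proof.
move=> Qa Qb ab Qz Qz' az bz az' bz' zz' YS Ya Yb Yab.
have ba : ~ P b a by move=> /(ps_sym PS).
have Ya_perp x : Q x -> P a x -> Y x.
  move=> Qx ax; have xa : P x a by apply: (ps_sym PS).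
  have [k bk] := ps_meet PS Qb Qa Qx ax ba.
  have Qka := ps_scale PS k Qa.
  have Qxa : Q (x + k *: a) by apply: (ps_add PS) => //; apply: (ps_perpZ PS).
  have -> : x = x + k *: a - k *: a by abelian.
  apply: vsubB => //; last exact: vsubZ.
  apply: Yab => //; apply: (ps_perpD PS) => //.
  exact/(ps_perpZ PS)/(ps_refl PS).
have Yb_perp x : Q x -> P b x -> Y x.
  move=> Qx bx; have xb : P x b by apply: (ps_sym PS).
  have [k ak] := ps_meet PS Qa Qb Qx bx ab.
  have Qkb := ps_scale PS k Qb.
  have Qxb : Q (x + k *: b) by apply: (ps_add PS) => //; apply: (ps_perpZ PS).
  have -> : x = x + k *: b - k *: b by abelian.
  apply: vsubB => //; last exact: vsubZ.
  apply: Yab => //; apply: (ps_perpD PS) => //.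
  exact/(ps_perpZ PS)/(ps_refl PS).
(* The line ac has a point p collinear with d. It lies in a^perp but not in b^perp, so the line
   through p and d has a point d + m p in b^perp; both p and d + m p are in Y. *)
have step d c : Q d -> Q c -> P a c -> P b c -> ~ P d c -> Y d.
  move=> Qd Qc ac bc dc; have ca : P c a by apply: (ps_sym PS).
  have [k dk] := ps_meet PS Qd Qc Qa ca dc.
  have Qkc := ps_scale PS k Qc.
  have Qp : Q (a + k *: c) by apply: (ps_add PS) => //; apply: (ps_perpZ PS).
  have Yp : Y (a + k *: c).
    apply: Ya_perp => //; apply: (ps_perpD PS) => //; first exact: (ps_refl PS).
    exact: (ps_perpZ PS).
  have bp : ~ P b (a + k *: c).
    move=> bp; apply: ba; have aE : a = a + k *: c - k *: c by abelian.
    by rewrite aE; apply: (ps_perpB PS); rewrite -?aE //; apply: (ps_perpZ PS).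
  have pd : P (a + k *: c) d by apply: (ps_sym PS).
  have [m bm] := ps_meet PS Qb Qp Qd pd bp; have Qmp := ps_scale PS m Qp.
  have -> : d = d + m *: (a + k *: c) - m *: (a + k *: c) by abelian.
  apply: vsubB => //; last exact: vsubZ.
  by apply: Yb_perp => //; apply: (ps_add PS) => //; apply: (ps_perpZ PS).
move=> d Qd; case: (pselect (P d z)) => dz; last exact: (step d z).
case: (pselect (P d z')) => dz'; last exact: (step d z').
have Qdz : Q (d + z) by apply: (ps_add PS).
have -> : d = d + z - z by abelian.
apply: vsubB => //; last exact: Ya_perp.
(* d is collinear with z and z', but d + z is not collinear with z'. *)
apply: (step (d + z) z') => // dzz'; apply: zz'.
have zE : z = d + z - d by abelian.
by rewrite zE; apply: (ps_perpBl PS); rewrite -?zE.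
Qed.

End Generation.

(** * Orthogonality of vectors under a given quasi-polarity *)

Section QuasiPolarity.
Variable S : geometry.
Hypothesis S_polar : polar_space S.
Variable e : embedding S.
Let K := emb_ring e.
Let V := emb_space e.
Let KF : GRing.field_axiom K := @emb_ringP S e.
Variable pi : PG V -> set (PG V).
Hypothesis pi_e : quasi_polarity_of pi.
Implicit Types (x y z : S) (u v w : V) (k : K).

(** The guards make 0 orthogonal to everything; quantifying over p and q avoids choosing the points
    spanned by v and w. *)
Definition vperp v w := forall p q : pgpoint V, v <> 0 -> w <> 0 ->
  pgset p v -> pgset q w -> pi p q.

Lemma vperp_sym v w : vperp v w -> vperp w v.
Proof.
case: pi_e => [[_ pi_sym] _ _] vw p q v0 w0 pv qw.
by apply/pi_sym; apply: vw.
Qed.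

Let vperp_point v p : v <> 0 -> pgset p v ->
  [set w | vperp v w] = [set w | w = 0 \/ exists2 q, pi p q & pgset q w].
Proof.
move=> v0 pv; apply/seteqP; split=> w /=.
  move=> vw; case: (pselect (w = 0)) => [|/eqP w0]; [by left|right].
  by exists (pgof w0); [apply: vw => //; [exact/eqP|exact: pgof_self]|exact: pgof_self].
move=> H p' q' _ w0 p'v q'w; rewrite (pg_eq KF v0 p'v pv).
by case: H => [//|[q pq qw]]; rewrite (pg_eq KF w0 q'w qw).
Qed.

Lemma vperp_vsubspace v : vsubspace [set w | vperp v w].
Proof.
case: (pselect (v = 0)) => [->|v0]; first by split=> //= *; move=> p q.
have /eqP v0' := v0; rewrite (vperp_point v0 (pgof_self v0')).
apply: vsubspace_of_subspace => //.
case: pi_e => [[/(_ (pgof v0')) [[//]|->] _] _ _]; by move=> l _ p q.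
Qed.

(** A single point r completes the hyperplane to the whole space, and the r-components of w1 and w2
    are proportional. *)
Lemma vperp_codim v w1 w2 : ~ vperp v w1 -> exists k, vperp v (w2 + k *: w1).
Proof.
move=> vw1; have v0 : v <> 0 by move=> v0; apply: vw1 => p q; rewrite v0.
have /eqP v0' := v0; set p := pgof v0'; have US := vperp_vsubspace v.
have vE := vperp_point v0 (pgof_self v0').
case: pi_e => [[/(_ p) [] piH _] _ _]; last first.
  case: vw1; change ([set w | vperp v w] w1); rewrite vE.
  case: (pselect (w1 = 0)) => [|/eqP w0]; [by left|right].
  by exists (pgof w0); [rewrite [pi _]piH|exact: pgof_self].
case: piH => _ [r _ rT].
pose J := vjoin (pgset r) [set w | vperp v w].
have rS := pg_vsubspace r; have JS : vsubspace J by apply: vjoin_vsubspace.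
have Jall w : J w.
  case: (pselect (w = 0)) => [->|/eqP w0]; first exact: vsub0.
  have : (setT : set (PG V)) (pgof w0) by [].
  rewrite rT => /(gen_sub_vsubspace KF JS); apply; last exact: pgof_self.
  move=> q [->|pq] t qt; first exact: vjoinl.
  by apply: vjoinr => //; rewrite vE; right; exists q.
have [r1 rr1 [t1 vt1 w1E]] := Jall w1; have [r2 rr2 [t2 vt2 w2E]] := Jall w2.
have r10 : r1 <> 0 by move=> r10; apply: vw1; rewrite -w1E r10 add0r.
have [k kE] := pg_multiple KF r10 rr1 rr2; exists (- k).
have -> : w2 + - k *: w1 = t2 - k *: t1.
  by rewrite -w1E -w2E kE scaleNr scalerDr; abelian.
by apply: (vsubB US) => //; apply: (vsubZ _ US).
Qed.

Lemma vperpE v w : @emb_vec _ e v -> @emb_vec _ e w -> emb_perp v w <-> vperp v w.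
Proof.
move=> [x xv] [y yw]; case: pi_e => [_ _ col]; split.
  move=> vw p q v0 w0 pv qw.
  rewrite (pg_eq KF v0 pv xv) (pg_eq KF w0 qw yw).
  exact/col/(emb_perpE v0 w0 xv yw).
move=> vw; case: (pselect (v = 0)) => [->|v0]; first exact: Or31.
case: (pselect (w = 0)) => [->|w0]; first exact: Or32.
by apply: (emb_perpI xv yw); apply/col/vw.
Qed.

End QuasiPolarity.

(** * Converse direction: splitting off the radical *)

Section Backward.
Variable S : geometry.
Hypothesis S_polar : polar_space S.
Hypothesis S_nondeg : non_degenerate S.
Variables (l0 : set S) (p0 q0 : S).
Hypothesis l0_line : line l0.
Hypothesis p0q0 : p0 <> q0.
Hypothesis l0p0 : l0 p0.
Hypothesis l0q0 : l0 q0.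
Variable e : embedding S.
Let K := emb_ring e.
Let V := emb_space e.
Let KF : GRing.field_axiom K := @emb_ringP S e.
Let PS := emb_polar_set S_polar S_nondeg e.
Let Q := @emb_vec S e.
Let P := @emb_perp S e.
Implicit Types (x y z : S) (u v w : V) (k : K) (N M : set S).

Lemma subspace_perp (X : set S) : subspace (perp X).
Proof.
move=> l Ll x y xy lx ly xX yX z lz n Xn.
exact: (line_all S_polar Ll lx ly xy (xX _ Xn) (yX _ Xn)).
Qed.

Lemma sub_generator_isotropic N : sub_generator N -> isotropic (vec_of (e := e) N).
Proof. by case=> Ns _; apply: vec_of_isotropic. Qed.

Lemma sub_generator_nontrivial N : sub_generator N ->
  exists v, vec_of (e := e) N v /\ v <> 0.
Proof.
move=> [Ns [M GM MN]]; apply: contrapT => nN.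
have [m [Mm Nm ME]] := hyperplane_of_vec S_polar S_nondeg e p0 (proj1 GM) MN.
have [_ MQ _] := generator_isotropic e p0 GM.
have m0 : m <> 0 by move=> m0; apply: Nm; left.
apply: (generator_not_point S_polar S_nondeg l0_line p0q0 l0p0 l0q0 GM (MQ _ Mm) _ m0).
rewrite ME => _ [_ [k _ <-] [n Nn <-]]; exists k => //.
have -> : n = 0 by apply: contrapT => n0; apply: nN; exists n.
by rewrite addr0.
Qed.

(** The definition provides only one generator M over N. This transfers maximality to the span of N
    and any further a collinear with N, which will be a generator of the tight embedding. *)
Lemma sub_generator_max N a v : sub_generator N -> Q a -> ~ vec_of N a ->
  (forall n, vec_of N n -> P a n) -> Q v -> P v a ->
  (forall n, vec_of N n -> P v n) -> vjoin (vspan1 a) (vec_of N) v.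
Proof.
move=> [Ns [M GM MN]] Qa Na aN Qv va vN.
have [m [Mm Nm ME]] := hyperplane_of_vec S_polar S_nondeg e p0 (proj1 GM) MN.
have [MS MQ MP] := generator_isotropic e p0 GM.
have [NS NQ NP] := vec_of_isotropic e p0 Ns.
have NM (n : V) : vec_of N n -> vec_of M n.
  by move=> Nn; rewrite ME; exists 0; [exists 0; rewrite ?scale0r|exists n; rewrite ?add0r].
have Qm := MQ _ Mm.
have inM w : Q w -> P w m -> (forall n, vec_of N n -> P w n) -> vec_of M w.
  move=> Qw wm wN; apply: (generator_max S_polar S_nondeg p0 GM Qw) => u Mu.
  move: (Mu); rewrite ME => -[_ [k _ <-] [n Nn uE]]; have Qu := MQ _ Mu.
  rewrite -uE; apply: (ps_perpD PS); rewrite ?uE //; [exact: (ps_scale PS)|exact: NQ|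
    exact: (ps_perpZ PS)|exact: wN].
case: (pselect (P m a)) => ma.
  have [_ [k _ <-] [n Nn aE]] : vjoin (vspan1 m) (vec_of N) a.
    by rewrite -ME; apply: inM => //; apply: (ps_sym PS).
  have k0 : k <> 0 by move=> k0; apply: Na; rewrite -aE k0 scale0r add0r.
  have mE : m = k^-1 *: a - k^-1 *: n.
    by rewrite -aE scalerDr addrK scalerA mulVr ?scale1r //; apply: (div_unit KF).
  have vm : P v m.
    rewrite mE; apply: (ps_perpB PS); rewrite -?mE //.
    - exact: (ps_scale PS).
    - by apply: (ps_scale PS); apply: NQ.
    - exact: (ps_perpZ PS).
    - by apply: (ps_perpZ PS); apply: vN.
  have : vec_of M v by apply: inM.
  rewrite ME => -[_ [l _ <-] [n' Nn' <-]]; rewrite mE.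
  exists ((l * k^-1) *: a); first by exists (l * k^-1).
  exists (n' - (l * k^-1) *: n); first by apply: vsubB => //; apply: vsubZ.
  by rewrite scalerBr !scalerA; abelian.
(* m is not collinear with a, so the line av has a point v + k a collinear with m, hence in M. Its
   m-component is zero because a is collinear with it and with N but not with m. *)
have av : P a v by apply: (ps_sym PS).
have [k mk] := ps_meet PS Qm Qa Qv av ma.
have Qka := ps_scale PS k Qa.
have Qw : Q (v + k *: a) by apply: (ps_add PS) => //; apply: (ps_perpZ PS).
have : vec_of M (v + k *: a).
  apply: inM => //; first exact: (ps_sym PS).
  move=> n Nn; apply: (ps_perpDl PS) => //; first exact: NQ.
    exact: vN.
  by apply: (ps_perpZl PS); apply: aN.
rewrite ME => -[_ [l _ <-] [n Nn wE]].
have aw : P a (v + k *: a).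
  by apply: (ps_perpD PS) => //; apply: (ps_perpZ PS); apply: (ps_refl PS).
have l0' : l = 0.
  apply: contrapT => l1; apply: ma; apply: (ps_sym PS); apply: (ps_perpZ_inv KF PS l1).
  have lE : l *: m = v + k *: a - n by rewrite -wE addrK.
  rewrite lE; apply: (ps_perpB PS); rewrite -?lE //; [exact: NQ|exact: (ps_scale PS)|exact: aN].
have vE : v = (- k) *: a + n.
  by move: wE; rewrite l0' scale0r add0r => ->; rewrite scaleNr; abelian.
by rewrite vE; exists (- k *: a); [exists (- k)|exists n].
Qed.

Section OptimalPair.
Variable pi : PG V -> set (PG V).
Hypothesis pi_e : quasi_polarity_of pi.
Variables N N' : set S.
Hypothesis SN : sub_generator N.
Hypothesis SN' : sub_generator N'.
Hypothesis NN' : opposite N N'.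
Hypothesis minN : perp_minimal N N'.
Hypothesis cardN : `I_2 #<= perp (N `|` N').
Let X := gen (N `|` N').
Hypothesis optN :
  gen (emb_map e @` X `|` orth pi (emb_map e @` X)) =
  orth pi (emb_map e @` (X `&` perp X)).

Let B v w := vperp pi v w.
Let A : set V := vec_of N.
Let A' : set V := vec_of N'.
Let AI : isotropic A := sub_generator_isotropic SN.
Let AI' : isotropic A' := sub_generator_isotropic SN'.
Let AS : vsubspace A. Proof. by case: AI. Qed.
Let AS' : vsubspace A'. Proof. by case: AI'. Qed.
Let AQ : A `<=` Q. Proof. by case: AI. Qed.
Let AQ' : A' `<=` Q. Proof. by case: AI'. Qed.
Let BS v : vsubspace [set w | B v w] := vperp_vsubspace pi_e v.
Let B_sym v w : B v w -> B w v. Proof. exact: vperp_sym. Qed.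
Let BP v w : Q v -> Q w -> P v w <-> B v w. Proof. exact: vperpE. Qed.
Let BD v w w' : B v w -> B v w' -> B v (w + w').
Proof. exact: (vsubD (BS v)). Qed.
Let BZ v k w : B v w -> B v (k *: w). Proof. exact: (vsubZ k (BS v)). Qed.
Let BB v w w' : B v w -> B v w' -> B v (w - w').
Proof. exact: (vsubB (BS v)). Qed.

Let in_perp M x v : evec x v -> v <> 0 ->
  perp M x <-> forall w, vec_of M w -> P v w.
Proof.
move=> xv v0; split=> [xX w [->|[y Xy yw]]|vX y Xy]; first exact: ps_perp0 PS _.
  by apply: (emb_perpI xv yw); apply: collinear_sym; apply: xX.
have [w w0 yw] := evec_vector e y.
by apply/collinear_sym/(emb_perpE v0 w0 xv yw)/vX; right; exists y.
Qed.

Let opp v : A v -> (forall w, A' w -> P v w) -> v = 0.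
Proof.
move=> [//|[x Nx xv]] vA'; apply: contrapT => v0.
have : (perp N' `&` N) x by split=> //; apply/(in_perp N' xv v0).
by rewrite (proj2 NN').
Qed.

Let opp' v : A' v -> (forall w, A w -> P v w) -> v = 0.
Proof.
move=> [//|[x Nx xv]] vA'; apply: contrapT => v0.
have : (perp N `&` N') x by split=> //; apply/(in_perp N xv v0).
by rewrite (proj1 NN').
Qed.

Let T v := [/\ Q v, forall w, A w -> P v w & forall w, A' w -> P v w].

Let T_perp x v : evec x v -> v <> 0 -> perp (N `|` N') x <-> T v.
Proof.
move=> xv v0; split=> [xN|[_ vA vA']].
  have vN w := proj1 (in_perp (N `|` N') xv v0) xN w.
  split; first by exists x.
    by move=> w [->|[y Ny yw]]; apply: vN; [left|right; exists y => //; left].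
  by move=> w [->|[y Ny yw]]; apply: vN; [left|right; exists y => //; right].
apply/(in_perp (N `|` N') xv v0) => w [->|[y [Ny|Ny] yw]].
- exact: ps_perp0 PS _.
- by apply: vA; right; exists y.
- by apply: vA'; right; exists y.
Qed.

(** c lies in the span of a and N, and its component in N is collinear with N', hence zero by
    opposition. So {N, N'}^perp contains no line. *)
Let T_collinear a c : T a -> T c -> a <> 0 -> P c a -> vspan1 a c.
Proof.
move=> [Qa aA aA'] [Qc cA cA'] a0 ca.
have Aa : ~ A a by move=> Aa; apply: a0; apply: opp.
have [_ [k _ <-] [n An cE]] := sub_generator_max SN Qa Aa aA Qc ca cA.
have n0 : n = 0.
  apply: opp => // w A'w.
  have nE : n = c - k *: a by rewrite -cE; abelian.
  rewrite nE; apply: (ps_perpBl PS); rewrite -?nE //;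
    [exact: AQ'|exact: (ps_scale PS)|exact: AQ|exact: cA'|].
  by apply: (ps_perpZl PS); apply: aA'.
by exists k => //; rewrite -cE n0 addr0.
Qed.

(** Two points of {N, N'}^perp are non-collinear by [T_collinear], which excludes the singular
    alternative of [perp_minimal]. As N and N' are disjoint, the other one places {N, N'}^perp
    inside {a, b}^perp^perp, which is the last clause. *)
Let opposite_points : exists a b, [/\ T a, T b, ~ P a b &
  forall v u, T v -> Q u -> P a u -> P b u -> P v u].
Proof.
have [p [q [pq Np Nq]]] := card_ge2E cardN.
have [a a0 pa] := evec_vector e p; have [b b0 qb] := evec_vector e q.
have Ta : T a by apply/(T_perp pa a0).
have Tb : T b by apply/(T_perp qb b0).
have ab : ~ P a b.
  move=> /(ps_sym PS) /(T_collinear Ta Tb a0) [k _ kE]; apply: pq.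
  apply: (evec_eq b0 _ qb); rewrite -kE; apply: vsubZ => //.
  exact: evec_vsubspace.
have npq : ~ collinear p q by move=> /(emb_perpI pa qb).
exists a, b; split=> // v x Tv [y yx] ax bx.
case: (pselect (v = 0)) => [->|v0]; first exact: ps_perp0l PS _.
case: (pselect (x = 0)) => [->|x0]; first exact: ps_perp0 PS _.
case: minN => [[_ sN]|minNN].
  by case: npq; apply: (sN q Nq p Np).
have [z zv] : Q v by case: Tv.
have : perp (N `|` N') z by apply/(T_perp zv v0).
rewrite (minNN p q Np Nq npq) => /(_ (perp (perp [set p; q]))) zpq.
have py := emb_perpE a0 x0 pa yx ax; have qy := emb_perpE b0 x0 qb yx bx.
have : perp (perp [set p; q]) z.
  apply: zpq; split; first exact: subspace_perp.
  move=> w [[Nw N'w]|//]; have [u u0 wu] := evec_vector e w.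
  case: u0; apply: opp; first by right; exists w.
  move=> t A't; have [_ _ P'] := AI'; apply: P' => //.
  by right; exists w.
move=> /(_ y) zy; apply: (emb_perpI zv yx); apply: collinear_sym; apply: zy.
by move=> w [->|->].
Qed.

Let X_vec x v : X x -> evec x v -> vjoin A A' v.
Proof.
have JS := vjoin_vsubspace AS AS'.
move=> Xx; apply: (gen_points_of JS _ Xx) => y [Ny|Ny] w yw.
  by apply: vjoinl => //; right; exists y.
by apply: vjoinr => //; right; exists y.
Qed.

Let NX : N `|` N' `<=` X. Proof. by move=> x Nx Y [_]; apply. Qed.

(** Makes the right-hand side of [optN] the whole of PG(V). *)
Let X_radical : X `&` perp X = set0.
Proof.
apply/seteqP; split=> // x [Xx xX]; have [v v0 xv] := evec_vector e x.
have [Qv vA vA'] : T v by apply/(T_perp xv v0) => n /NX; apply: xX.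
have [n An [n' A'n' vE]] := X_vec Xx xv; have [_ _ AP] := AI; have [_ _ AP'] := AI'.
have n0 : n = 0.
  apply: opp => // w A'w; have nE : n = v - n' by rewrite -vE; abelian.
  by rewrite nE; apply: (ps_perpBl PS); rewrite -?nE; [exact: AQ'| |exact: AQ'|exact: AQ|exact: vA'|exact: AP'].
have n'0 : n' = 0.
  apply: opp' => // w Aw; have nE : n' = v - n by rewrite -vE; abelian.
  by rewrite nE; apply: (ps_perpBl PS); rewrite -?nE; [exact: AQ| |exact: AQ|exact: AQ'|exact: vA|exact: AP].
by apply: v0; rewrite -vE n0 n'0 addr0.
Qed.

Let W : set V := [set v | (forall w, A w -> B w v) /\ forall w, A' w -> B w v].

Let WS : vsubspace W.
Proof.
split.
- by split=> w _; apply: (vsub0 (BS w)).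
- by move=> v w [v1 v2] [w1 w2]; split=> u Au; apply: BD; auto.
- by move=> k v [v1 v2]; split=> u Au; apply: BZ; auto.
Qed.

Let T_W v : T v -> W v.
Proof.
move=> [Qv vA vA']; split=> w Aw; apply: B_sym; apply/BP => //;
  by [exact: AQ|exact: AQ'|exact: vA|exact: vA'].
Qed.

Let optimal_span v : vjoin (vjoin A A') W v.
Proof.
have JS := vjoin_vsubspace AS AS'; have JWS := vjoin_vsubspace JS WS.
case: (pselect (v = 0)) => [->|/eqP v0]; first exact: vsub0.
have : orth pi (emb_map e @` (X `&` perp X)) (pgof v0).
  by rewrite X_radical image_set0 => p [].
rewrite -optN => /(gen_sub_vsubspace KF JWS); apply; last exact: pgof_self.
move=> p [[x Xx <-]|pX] u pu.
  by apply: vjoinl => //; apply: X_vec pu.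
apply: vjoinr => //.
by split=> w [->|[y Ny yw]] q q' w0 u0 qw q'u //;
  rewrite (pg_eq KF w0 qw yw) (pg_eq KF u0 q'u pu); apply: pX; exists y => //;
  apply: NX; [left|right].
Qed.

Let radical : set V := [set v | forall w, B v w].

Let radicalS : vsubspace radical.
Proof.
split=> [w|v w Rv Rw u|k v Rv u]; apply: B_sym.
- exact: (vsub0 (BS w)).
- by apply: BD; apply: B_sym.
- by apply: BZ; apply: B_sym.
Qed.

Section OppositePoints.
Variables a b : V.
Hypothesis Ta : T a.
Hypothesis Tb : T b.
Hypothesis ab : ~ P a b.
Hypothesis Tab : forall v u, T v -> Q u -> P a u -> P b u -> P v u.

Let Qa : Q a. Proof. by case: Ta. Qed.
Let Qb : Q b. Proof. by case: Tb. Qed.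
Let nBab : ~ B a b. Proof. by move=> /(BP Qa Qb). Qed.
Let nBba : ~ B b a. Proof. by move=> /B_sym. Qed.
Let Baa : B a a. Proof. exact/BP/(ps_refl PS). Qed.
Let Bbb : B b b. Proof. exact/BP/(ps_refl PS). Qed.

Let D : set V := [set v | [/\ W v, B a v & B b v]].

Let decomposition v : exists n n' k l d,
  [/\ A n, A' n', D d & v = n + n' + (k *: a + l *: b) + d].
Proof.
have [_ [n An [n' A'n' <-]] [w Ww <-]] := optimal_span v.
have [k ak] := vperp_codim pi_e w nBab.
(* The second correction, by a multiple of a, keeps orthogonality to a, since a is orthogonal to
   itself. *)
have [l bl] := vperp_codim pi_e (w + k *: b) nBba.
exists n, n', (- l), (- k), (w + k *: b + l *: a); split=> //.
  split=> //.
    by apply: vsubD => //; [apply: vsubD => //|]; apply: vsubZ => //; exact: T_W.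
  by apply: BD => //; apply: BZ.
by rewrite !scaleNr; abelian.
Qed.

Let BA n v : A n -> W v -> B n v. Proof. by move=> An []; auto. Qed.
Let BA' n v : A' n -> W v -> B n v. Proof. by move=> An []; auto. Qed.
Let WD d : D d -> W d. Proof. by case. Qed.

Let W_comb k l d : D d -> W (k *: a + l *: b + d).
Proof.
move=> Dd; apply: vsubD => //; last exact: WD.
by apply: vsubD => //; apply: vsubZ => //; exact: T_W.
Qed.

(* Subtracting a point of <N, a> and then one of <N', b> from a vector of [Q]
   removes its components in N and N'. *)
Let reduce c c' n n' k l d M M' : T c -> T c' -> ~ P c c' ->
  (forall u, vec_of M u -> Q u) -> (forall u, vec_of M' u -> Q u) ->
  (forall u v, vec_of M u -> W v -> B u v) ->
  (forall u v, vec_of M' u -> W v -> B u v) ->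
  (forall u, vec_of M u -> P c u) -> (forall u, vec_of M' u -> P c' u) ->
  (forall u v, vec_of M' u -> vec_of M' v -> P u v) ->
  vec_of M n -> vec_of M' n' -> W d -> B c d -> B c' d ->
  Q (n + n' + (k *: c + l *: c') + d) ->
  ~ P c (n + n' + (k *: c + l *: c') + d) ->
  exists k' l', Q (k' *: c + l' *: c' + d).
Proof.
move=> Tc Tc' cc' MQ MQ' MW MW' cM cM' MP' Mn Mn' Wd cd c'd Qv cv.
have [[Qc _ _] [Qc' _ _]] := (Tc, Tc').
have [Qn Qn'] := (MQ _ Mn, MQ' _ Mn').
set v := _ + d in Qv cv.
have vc : ~ P v c by move=> /(ps_sym PS).
have [m vm] := ps_meet PS Qv Qc Qn (cM _ Mn) vc.
have nc : P n c by apply: (ps_sym PS); apply: cM.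
have n'c' : P n' c' by apply: (ps_sym PS); apply: cM'.
have Qnm : Q (n + m *: c).
  by apply: (ps_add PS) => //; [exact: (ps_scale PS)|exact: (ps_perpZ PS)].
have Qv1 := ps_sub PS Qv Qnm vm.
have v1E : v - (n + m *: c) = n' + ((k - m) *: c + l *: c' + d).
  by rewrite /v scalerBl; abelian.
have Wd1 k' l' : W (k' *: c + l' *: c' + d).
  apply: vsubD => //; apply: vsubD => //; apply: vsubZ => //; exact: T_W.
case: (pselect (P c' (v - (n + m *: c)))) => [c'v1|c'v1].
(* Here c' is orthogonal to every other term of v - (n + m c), so the coefficient of c vanishes;
   then n' is collinear with this vector and can be removed directly. *)
- have c'n' : B c' n' by apply/BP => //; apply: cM'.
  have cc'0 : B c' ((k - m) *: c).
    have E : (k - m) *: c = v - (n + m *: c) - (n' + l *: c' + d).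
      by rewrite v1E; abelian.
    rewrite E; apply: BB; first exact/BP.
    by apply: BD => //; apply: BD => //; apply/BZ/BP => //; apply: (ps_refl PS).
  have km0 : k - m = 0.
    apply: contrapT => km0; apply: cc'; apply: (ps_sym PS).
    by apply: (ps_perpZ_inv KF PS km0); apply/BP => //; apply: (ps_scale PS).
  exists (k - m), l; rewrite [X in Q X](_ : _ = v - (n + m *: c) - n'); last first.
    by rewrite v1E; abelian.
  apply: (ps_sub PS) => //; apply: (ps_sym PS); apply/BP => //.
  rewrite v1E; apply: BD; last exact: MW'.
  by apply/BP => //; apply: MP'.
- have v1c' : ~ P (v - (n + m *: c)) c' by move=> /(ps_sym PS).
  have [m' vm'] := ps_meet PS Qv1 Qc' Qn' (cM' _ Mn') v1c'.
  have Qnm' : Q (n' + m' *: c').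
    by apply: (ps_add PS) => //; [exact: (ps_scale PS)|exact: (ps_perpZ PS)].
  exists (k - m), (l - m').
  rewrite [X in Q X](_ : _ = v - (n + m *: c) - (n' + m' *: c')).
    exact: (ps_sub PS).
  by rewrite v1E !scalerBl; abelian.
Qed.

Let aA n : A n -> P a n. Proof. by case: Ta => _ + _; apply. Qed.
Let aA' n : A' n -> P a n. Proof. by case: Ta => _ _; apply. Qed.
Let bA n : A n -> P b n. Proof. by case: Tb => _ + _; apply. Qed.
Let bA' n : A' n -> P b n. Proof. by case: Tb => _ _; apply. Qed.

Let reduced n n' k l d : A n -> A' n' -> D d ->
  Q (n + n' + (k *: a + l *: b) + d) -> exists k' l', Q (k' *: a + l' *: b + d).
Proof.
move=> An A'n' Dd; have [Wd ad bd] := Dd; have [_ _ AP] := AI; have [_ _ AP'] := AI'.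
have ba : ~ P b a by move=> /(ps_sym PS).
have left_case k1 l1 : Q (n + n' + (k1 *: a + l1 *: b) + d) ->
    ~ P a (n + n' + (k1 *: a + l1 *: b) + d) ->
    exists k' l', Q (k' *: a + l' *: b + d).
  exact: (reduce Ta Tb ab AQ AQ' BA BA' aA bA' AP' An A'n' Wd ad bd).
have right_case k1 l1 : Q (n + n' + (k1 *: a + l1 *: b) + d) ->
    ~ P b (n + n' + (k1 *: a + l1 *: b) + d) ->
    exists k' l', Q (k' *: a + l' *: b + d).
  have -> : n + n' + (k1 *: a + l1 *: b) + d = n' + n + (l1 *: b + k1 *: a) + d.
    by abelian.
  move=> Qv bv.
  have [k' [l' Qr]] := reduce Tb Ta ba AQ' AQ BA' BA bA' aA AP A'n' An Wd bd ad Qv bv.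
  by exists l', k'; rewrite [l' *: a + _]addrC.
move=> Qv; case: (pselect (P a (n + n' + (k *: a + l *: b) + d))) => [av|]; last exact: left_case.
case: (pselect (P b (n + n' + (k *: a + l *: b) + d))) => [bv|]; last exact: right_case.
have [Qn Qn'] := (AQ An, AQ' A'n').
have [Ban Ban'] : B a n /\ B a n' by split; apply/BP => //; [apply: aA|apply: aA'].
have [Bbn Bbn'] : B b n /\ B b n' by split; apply/BP => //; [apply: bA|apply: bA'].
(* The point is collinear with both a and b: the first kills the coefficient of b, the second that
   of a. *)
have l0E : l = 0.
  apply: contrapT => l1; apply: ab; apply: (ps_perpZ_inv KF PS l1).
  apply/BP => //; first exact: (ps_scale PS).
  have E : l *: b = n + n' + (k *: a + l *: b) + d - (n + n' + k *: a + d) by abelian.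
  rewrite E; apply: BB; first exact/BP.
  by do 3?[apply: BD => //]; apply: BZ.
have k0E : k = 0.
  apply: contrapT => k1; apply: ba; apply: (ps_perpZ_inv KF PS k1).
  apply/BP => //; first exact: (ps_scale PS).
  have E : k *: a = n + n' + (k *: a + l *: b) + d - (n + n' + l *: b + d) by abelian.
  rewrite E; apply: BB; first exact/BP.
  by do 3?[apply: BD => //]; apply: BZ.
move: Qv av bv; rewrite k0E l0E !scale0r !addr0 => Qv av bv.
case: (pselect (P n n')) => nn'.
- exists 0, 0; rewrite !scale0r !add0r.
  have Bnn' : B n n' by apply/BP.
  have Q1 : Q (n' + d).
    have -> : n' + d = n + n' + d - n by abelian.
    apply: (ps_sub PS) => //; apply: (ps_sym PS); apply/BP => //.
    apply: BD; last exact: BA.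
    by apply: BD => //; apply/BP => //; apply: (ps_refl PS).
  have -> : d = n' + d - n' by abelian.
  apply: (ps_sub PS) => //; apply: (ps_sym PS); apply/BP => //.
  apply: BD; last exact: BA'.
  by apply/BP => //; apply: (ps_refl PS).
(* Adding a yields a point that is not collinear with b, which returns to [right_case]. *)
- have Qva : Q (n + n' + d + a) by apply: (ps_add PS) => //; apply: (ps_sym PS).
  have E : n + n' + d + a = n + n' + (1 *: a + 0 *: b) + d.
    by rewrite scale1r scale0r; abelian.
  apply: (right_case 1 0); rewrite -E // => bva; apply: ba.
  have aE : a = n + n' + d + a - (n + n' + d) by abelian.
  by rewrite aE; apply: (ps_perpB PS); rewrite -?aE.
Qed.

Let opposite_pair : exists w w', [/\ A w, A' w' & ~ P w w'].
Proof.
have [z [Az z0]] := sub_generator_nontrivial SN.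
apply: contrapT => nz; apply: z0; apply: opp => // w A'w.
by apply: contrapT => zw; apply: nz; exists z, w.
Qed.

Let D_radical n n' k l d : A n -> A' n' -> D d ->
  Q (n + n' + (k *: a + l *: b) + d) -> radical d.
Proof.
move=> An A'n' Dd Qv; have [k' [l' Qt]] := reduced An A'n' Dd Qv.
have [Wd ad bd] := Dd; have Wt := W_comb k' l' Dd.
have Tt : T (k' *: a + l' *: b + d).
  split=> // w Aw; apply: (ps_sym PS); apply/BP => //;
    by [exact: AQ|exact: AQ'|exact: BA|exact: BA'].
(* [generated_by_opposite] needs two non-collinear points of {a, b}^perp; N and N' contain them. *)
have [z [z' [Az A'z' zz']]] := opposite_pair.
have [Qz Qz'] := (AQ Az, AQ' A'z').
move=> w; apply: (emb_vec_span (BS d) _ w).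
apply: (generated_by_opposite PS Qa Qb ab Qz Qz' (aA Az) (bA Az) (aA' A'z') (bA' A'z') zz' (BS d)).
- exact: B_sym.
- exact: B_sym.
- move=> u Qu au bu; apply: B_sym.
  have dE : d = k' *: a + l' *: b + d - (k' *: a + l' *: b) by abelian.
  rewrite dE; apply: BB.
    by apply/BP => //; apply: (ps_sym PS); apply: Tab.
  by apply: BD; apply/BZ/BP => //; apply: (ps_sym PS).
Qed.

Let spanned v : vjoin (vjoin (vjoin (vspan1 a) A) (vjoin (vspan1 b) A')) radical v.
Proof.
have [LS _ _] := vspan1_isotropic S_polar S_nondeg Qa.
have [LS' _ _] := vspan1_isotropic S_polar S_nondeg Qb.
have JS := vjoin_vsubspace LS AS; have JS' := vjoin_vsubspace LS' AS'.
have JJ := vjoin_vsubspace (vjoin_vsubspace JS JS') radicalS.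
apply: (emb_vec_span JJ) => u Qu.
have [n [n' [k [l [d [An A'n' Dd uE]]]]]] := decomposition u.
have Rd : radical d by apply: (@D_radical n n' k l) => //; rewrite -uE.
exists (n + n' + (k *: a + l *: b)); last by exists d.
exists (k *: a + n); first by exists (k *: a); [exists k|exists n].
exists (l *: b + n'); first by exists (l *: b); [exists l|exists n'].
by abelian.
Qed.

Let R : vsub V := VSub radicalS.

Let R_vec x v : evec x v -> vsub_set R v -> v = 0.
Proof.
move=> xv Rv; have Qv : Q v by exists x.
by apply: (ps_nondeg PS Qv) => y Qy; apply/BP => //; apply: Rv.
Qed.

(** If v - w is radical, w is orthogonal to v, so v - w belongs to [Q] and [R_vec] makes it 0. *)
Let R_inj x y v w : evec x v -> evec y w -> v <> 0 -> vsub_set R (v - w) -> x = y.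
Proof.
move=> xv yw v0 Rvw; have Qv : Q v by exists x.
have Qw : Q w by exists y.
have Pvw : P v w.
  apply/BP => //; have -> : w = v - (v - w) by abelian.
  by apply: BB; [apply/BP => //; apply: (ps_refl PS)|apply: B_sym; apply: Rvw].
have [z zvw] : Q (v - w) by apply: (ps_sub PS).
have /eqP := R_vec zvw Rvw; rewrite subr_eq0 => /eqP vw.
by apply: (evec_eq v0 xv); rewrite vw.
Qed.

Let generator_of c M : sub_generator M -> T c -> ~ vec_of M c ->
  (forall u, vec_of M u -> P c u) ->
  generator (points_of (vjoin (vspan1 c) (vec_of M))).
Proof.
move=> SM [Qc _ _] Mc cM; have [MS MQ MP] := sub_generator_isotropic SM.
have MI := sub_generator_isotropic SM.
have [LS LQ LP] := vspan1_isotropic S_polar S_nondeg Qc.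
have Jc : vjoin (vspan1 c) (vec_of M) c by apply: vjoinl => //; exact: vspan1_self.
apply: (generator_points_of p0).
  apply: (vjoin_isotropic S_polar S_nondeg) => //.
  by move=> _ w [k _ <-] Mw; apply/(ps_perpZl PS)/cM.
move=> v Qv vJ; apply: sub_generator_max => //; first exact: vJ.
by move=> n Mn; apply: vJ; apply: vjoinr.
Qed.

Lemma tight_quotient : admits_tight_embedding S.
Proof.
exists (quotient_embedding R_vec R_inj).
have a0 : a <> 0 by move=> a0; apply: ab; rewrite a0; exact: ps_perp0l PS _.
have b0 : b <> 0 by move=> b0; apply: ab; rewrite b0; exact: ps_perp0 PS _.
have Aa : ~ A a by move=> Aa; apply: a0; apply: opp.
have Ab : ~ A' b by move=> A'b; apply: b0; apply: opp'.
exists (points_of (vjoin (vspan1 a) A)), (points_of (vjoin (vspan1 b) A')); split.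
- exact: generator_of.
- exact: generator_of.
- apply: (@qemb_gen S e R R_vec) => U US RU XU v.
  have [LS _ _] := vspan1_isotropic S_polar S_nondeg Qa.
  have [LS' _ _] := vspan1_isotropic S_polar S_nondeg Qb.
  have JS := vjoin_vsubspace LS AS; have JS' := vjoin_vsubspace LS' AS'.
  have JQ : vjoin (vspan1 a) A `<=` Q.
    move=> _ [_ [k _ <-] [n An <-]]; apply: (ps_add PS); [exact: (ps_scale PS)|exact: AQ|].
    by apply: (ps_perpZl PS); apply: aA.
  have JQ' : vjoin (vspan1 b) A' `<=` Q.
    move=> _ [_ [k _ <-] [n An <-]]; apply: (ps_add PS); [exact: (ps_scale PS)|exact: AQ'|].
    by apply: (ps_perpZl PS); apply: bA'.
  have [_ [m Jm [m' Jm' <-]] [r Rr <-]] := spanned v.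
  apply: vsubD => //; last exact: RU.
  apply: vsubD => //.
    case: (pselect (m = 0)) => [->|m0]; first exact: vsub0.
    have [x xm] := JQ _ Jm; apply: (XU x) => //; left.
    exact: (evec_sub JS m0 xm).
  case: (pselect (m' = 0)) => [->|m0]; first exact: vsub0.
  have [x xm] := JQ' _ Jm'; apply: (XU x) => //; right.
  exact: (evec_sub JS' m0 xm).
Qed.

End OppositePoints.

Lemma tight_of_optimal_pair : admits_tight_embedding S.
Proof.
by have [a [b [Ta Tb ab Tab]]] := opposite_points; apply: (tight_quotient Ta Tb ab Tab).
Qed.

End OptimalPair.
End Backward.

Theorem theorem3p6 (S : geometry)
    (S_polar : polar_space S) (S_nondeg : non_degenerate S)
    (S_thick : thick_lined S) (S_rank : rank_ge S 2)
    (S_emb : embeddable S) :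
  admits_tight_embedding S <->
  exists N N' : set S,
    [/\ sub_generator N /\ sub_generator N',
        opposite N N',
        perp_minimal N N',
        `I_2 #<= perp (N `|` N') &
        optimally_embeddable (gen (N `|` N'))].
Proof.
have [l [p [q [Ll pq lp lq]]]] := rank_ge2_line S_rank; split.
  move=> [e [M [M' [GM GM' MM']]]].
  have [u0 [u1 [Mu0 Mu1 u01 [f [fD fZ f_sym fP]]]]] :=
    tight_form S_polar S_nondeg Ll pq lp lq GM GM' MM'.
  exact: (tight_statement S_polar S_nondeg p GM GM' MM' Mu0 Mu1 u01 fD fZ f_sym fP).
move=> [N [N' [[SN SN'] NN' minN cardN [e [pi [pi_e optN]]]]]].
exact: (tight_of_optimal_pair S_polar S_nondeg Ll pq lp lq pi_e SN SN' NN' minN cardN optN).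
Qed.
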